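(* Assume that there exist absolute constants $\kappa''\ge1$, $c_3>0$ depending on $\kappa''$ ($c_3\le\frac{9}{1568(\kappa'')^4}$ is sufficient), $0\le\gamma_3<1/16$, $\epsilon>0$, $\delta_3\ge0$ such that: $k\le c_3N$; with probability at least $1-\gamma_3$, $\max_{1\le i\le N}\|\Gamma_{1:k}^{-1/2}\phi_{1:k}(X_i)\|_{\mathcal H}^2\le\delta_3k$; and for any $f\in\mathcal H_{1:k}$, $\|f\|_{L_{4+\epsilon}}\le\kappa''\|f\|_{L_2}$. Then there exist absolute constants $c,c_{l},C_{u}>0$ such that with probability at least $1-\gamma_3-\frac c{N^\epsilon}-2\exp(-k)$, for all $f_{1:k}\in\mathcal H_{1:k}$, $$c_l\,\|\Gamma_{1:k}^{1/2}f_{1:k}\|_{\mathcal H}\le\frac1{\sqrt N}\|\mathbb X_{\phi,1:k}f_{1:k}\|_2\le C_u\,\|\Gamma_{1:k}^{1/2}f_{1:k}\|_{\mathcal H},$$ where $c_l$ can be taken as $\frac12$ and $C_u$ can be taken as $\sqrt{2C_{DMU}^2(1+c_3)}$ for an absolute constant $C_{DMU}$.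
   Context: $\Omega\subset\mathbb R^d$ is a compact Hausdorff space, $\mu$ a probability measure on $\Omega$, $K$ a continuous positive definite kernel on $\Omega$ with $\|K\|_\infty\le1$ (the paper remarks that it is enough that $\Gamma$ below is positive, compact, symmetric and trace-class), $\mathcal H$ its RKHS, $\phi(x)=K(x,\cdot)$; $X_1,\dots,X_N$ are i.i.d. with law $\mu$ (the law of $X$). $\Gamma=\mathbb E[\phi(X)\otimes\phi(X)]$ has eigenvalues $\sigma_1\ge\sigma_2\ge\dots$ with $\mathcal H$-orthonormal eigenfunctions $(\varphi_j)$; $\mathcal H_{1:k}=\mathrm{span}(\varphi_j:j\le k)$, $\phi_{1:k}(x)$ is the orthogonal projection of $\phi(x)$ onto $\mathcal H_{1:k}$, $\Gamma_{1:k}^{\pm1/2}=\sum_{j\le k}\sigma_j^{\pm1/2}\varphi_j\otimes\varphi_j$, $(\mathbb X_{\phi,1:k}f)_i=\langle\phi_{1:k}(X_i),f\rangle_{\mathcal H}$, $i=1,\dots,N$. $L_q=L_q(\mu)$. $C_{DMU}$ is the constant such that, under the $L_{4+\epsilon}$--$L_2$ norm equivalence and diagonal bound, the largest singular value of the $N\times k$ matrix of the $\Gamma_{1:k}^{-1/2}\phi_{1:k}(X_i)$ is at most $C_{DMU}(\sqrt k+\sqrt N)$ with probability at least $1-\gamma_3-c/N^\epsilon$. The parameters of the assumption are regarded as absolute constants, so absolute constants may depend on them. *)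

(* Defs.v *)
From HB Require Import structures.
From mathcomp Require Import all_boot all_order all_algebra.
From mathcomp Require Import all_classical all_reals all_analysis.

Set Implicit Arguments.
Unset Strict Implicit.
Unset Printing Implicit Defensive.

Import Order.TTheory GRing.Theory Num.Theory.
Import numFieldNormedType.Exports.

Local Open Scope classical_set_scope.
Local Open Scope ring_scope.

(* A subset [Om] of R^d as a space of its own, with the topology induced by R^d
   and its Borel sigma-algebra.  Measurable types are pointed in the library,
   hence the base point [x0], which plays no other role (a set carrying a
   probability measure is nonempty). *)
Definition subspace_of (R : realType) (d : nat) (Om : set 'rV[R]_d) (x0 : Om)
  : Type := set_type Om.

Section borel_subspace.
Variables (R : realType) (d : nat) (Om : set 'rV[R]_d) (x0 : Om).

HB.instance Definition _ := Topological.copy (subspace_of x0) (set_type Om).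
HB.instance Definition _ := isPointed.Build (subspace_of x0) x0.

Definition borel_display : measure_display :=
  sigma_display (@open (subspace_of x0)).

HB.instance Definition _ := @isMeasurable.Build borel_display
  (subspace_of x0) <<s @open (subspace_of x0) >>
  (@sigma_algebra0 _ setT _) (@sigma_algebraC _ _) (@sigma_algebra_bigcup _ setT _).

End borel_subspace.

Section rkhs.
Variables (R : realType) (T : Type).
Implicit Types (K : T -> T -> R) (H V : set (T -> R)).
Implicit Types (ip : (T -> R) -> (T -> R) -> R) (f g h u v : T -> R).

Definition posdef_kernel K : Prop :=
  (forall x y, K x y = K y x) /\
  (forall (n : nat) (x : 'I_n -> T) (a : 'I_n -> R),
     0 <= \sum_(i < n) \sum_(j < n) a i * a j * K (x i) (x j)).

Definition hnorm ip f : R := Num.sqrt (ip f f).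

(* [(H, ip)] is the reproducing kernel Hilbert space of [K], [ip] being only
   meaningful on [H].  The feature map [phi x = K(x, _)] is [K x]. *)
Record is_rkhs K H ip : Prop := IsRKHS {
  rkhs0 : H 0 ;
  rkhs_linear : forall (a : R) f g, H f -> H g -> H (a *: f + g) ;
  rkhs_ipC : forall f g, H f -> H g -> ip f g = ip g f ;
  rkhs_ip_linear : forall (a : R) f g h, H f -> H g -> H h ->
    ip (a *: f + g) h = a * ip f h + ip g h ;
  rkhs_ip_gt0 : forall f, H f -> f <> 0 -> 0 < ip f f ;
  rkhs_complete : forall u_ : nat -> (T -> R), (forall n, H (u_ n)) ->
    (forall e : R, 0 < e -> exists n0 : nat, forall n m : nat,
       (n0 <= n)%N -> (n0 <= m)%N -> hnorm ip (u_ n - u_ m) < e) ->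
    exists2 f, H f & (fun n => hnorm ip (u_ n - f)) @ \oo --> (0 : R) ;
  rkhs_kernel : forall x, H (K x) ;
  rkhs_reproducing : forall f x, H f -> ip f (K x) = f x
}.

Definition tensor ip u v f : T -> R := ip v f *: u.

Definition span_upto (e : nat -> T -> R) (k : nat) : set (T -> R) :=
  [set f | exists a : 'I_k -> R, f = \sum_(j < k) a j *: e j].

Definition orth_proj ip V f : T -> R :=
  xget 0 [set g | V g /\ forall h, V h -> ip (f - g) h = 0].

(* Eigenvalues in nonincreasing order, repeated with multiplicity, with
   orthonormal eigenvectors; indices start at 0.  If [G] has finite rank, [s] is
   padded with zeros.  [e j] is unconstrained when [s j = 0], since [H] may be
   finite-dimensional or the null space of [G] trivial.  The last clause says
   that every nonzero eigenvalue is listed with its full multiplicity. *)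
Record is_eigensystem H ip (G : (T -> R) -> (T -> R))
    (s : nat -> R) (e : nat -> T -> R) : Prop := IsEigensystem {
  eigen_ge0 : forall j, 0 <= s j ;
  eigen_noninc : forall i j, (i <= j)%N -> s j <= s i ;
  eigen_mem : forall j, 0 < s j -> H (e j) ;
  eigen_orthonormal : forall i j, 0 < s i -> 0 < s j ->
    ip (e i) (e j) = (i == j)%:R ;
  eigen_eq : forall j, 0 < s j -> G (e j) = s j *: e j ;
  eigen_complete : forall f, H f ->
    (forall j, 0 < s j -> ip f (e j) = 0) -> G f = 0
}.

Definition cov_sqrt ip (s : nat -> R) (e : nat -> T -> R) (k : nat) f : T -> R :=
  \sum_(j < k) Num.sqrt (s j) *: tensor ip (e j) (e j) f.

Definition cov_invsqrt ip (s : nat -> R) (e : nat -> T -> R) (k : nat) f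
  : T -> R :=
  \sum_(j < k) (Num.sqrt (s j))^-1 *: tensor ip (e j) (e j) f.

Definition feature_upto K ip (e : nat -> T -> R) (k : nat) (x : T) : T -> R :=
  orth_proj ip (span_upto e k) (K x).

Definition whitened_feature K ip (s : nat -> R) (e : nat -> T -> R) (k : nat)
    (x : T) : T -> R :=
  cov_invsqrt ip s e k (feature_upto K ip e k x).

Definition sampling_op K ip (e : nat -> T -> R) (k N : nat) (x : 'I_N -> T) f
  : 'cV[R]_N :=
  \col_(i < N) ip (feature_upto K ip e k (x i)) f.

(* Rows: coordinates of the whitened features in the basis [e 0, ..., e k.-1]. *)
Definition whitened_mx K ip (s : nat -> R) (e : nat -> T -> R) (k N : nat)
    (x : 'I_N -> T) : 'M[R]_(N, k) :=
  \matrix_(i < N, j < k) ip (e j) (whitened_feature K ip s e k (x i)).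

End rkhs.

Definition norm2 (R : realType) (N : nat) (v : 'cV[R]_N) : R :=
  Num.sqrt (\sum_(i < N) v i 0 ^+ 2).

Definition max_singular_value (R : realType) (N k : nat) (M : 'M[R]_(N, k)) : R :=
  sup [set t : R | 0 <= t /\ eigenvalue (M^T *m M) (t ^+ 2)].

Section covariance.
Variables (R : realType) (disp : measure_display) (T : measurableType disp).
Variables (mu : probability T R) (H : set (T -> R)).
Variable ip : (T -> R) -> (T -> R) -> R.

(* Expectation of an [H]-valued map in the weak (Pettis) sense. *)
Definition hexpectation (Z : T -> (T -> R)) : T -> R :=
  xget 0 [set g | H g /\
    forall h, H h -> ip g h = (\int[mu]_x ip (Z x) h)%R].

(* E[phi(X) (x) phi(X)]. *)
Definition cov_op (K : T -> T -> R) (f : T -> R) : T -> R :=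
  hexpectation (fun x => tensor ip (K x) (K x) f).

End covariance.

Section sampling.
Variables (R : realType) (disp disp' : measure_display).
Variables (S : measurableType disp) (T : measurableType disp').
Variable P : probability S R.

Definition iid_sample (mu : probability T R) (N : nat)
    (X : 'I_N -> {RV P >-> T}) : Prop :=
  (forall i (A : set T), measurable A -> distribution P (X i) A = mu A) /\
  (forall (J : {set 'I_N}) (A : 'I_N -> set T), (forall i, measurable (A i)) ->
     P (\bigcap_(i in [set` J]) (X i @^-1` A i)) =
     (\prod_(i in J) P (X i @^-1` A i))%E).

(* "E holds with probability at least p"; for measurable [E] this is
   [p%:E <= P E]. *)
Definition with_prob_ge (p : R) (E : set S) : Prop :=
  exists A : set S, [/\ measurable A, A `<=` E & (p%:E <= P A)%E].

End sampling.

(* Main.v *)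
(* In the basis (e_j / sqrt(sigma_j)) the features become i.i.d. isotropic
   vectors Y_1, ..., Y_N of R^k whose marginals satisfy the L_(4+eps)-L_2 norm
   equivalence, and both claims concern the matrix Y with rows Y_i. Write
   Y(b) = sum_i b_i Y_i and n = max(k, N).

   Upper bound. Fix an integer vector z with |z|_1 <= m and a set of m indices
   outside its support. By Markov's inequality, and since Y(z) is independent of
   the corresponding rows, |<Y_i, Y(z)>| > s_m |Y(z)| for all of them has
   probability at most (kappa / s_m)^((4+eps) m). With s_m of order
   (n/m)^(1/2-eta), a union bound shows that off an event of probability
   O(n^-eps), for every m >= 4 and z fewer than m rows outside the support of z
   have such a large product. On this event let B be the supremum of |Y(b)|^2
   over the unit ball. Cut b at dyadic magnitudes and telescope |Y(u_x)|^2 over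
   the truncations u_x. Each increment <Y(u_x - u_(x-1)), Y(u_x + u_(x-1))> is
   bounded, after adding a small multiple of |Y(u_x + u_(x-1))|^2, by rounding
   u_x + u_(x-1) to a multiple of an integer vector, where the scarcity of large
   products applies. Summing over the levels gives B <= B/4 + O(n).

   Lower bound. The L_4-L_2 equivalence and a Chernoff bound for nonnegative
   variables give sum_i <Y_i, z>^2 >= (3/8) N |z|^2 simultaneously for the at
   most 24^k integer vectors z with |z|_1 <= 3k. Rounding a unit vector to the
   lattice of step 1 / (2 sqrt k) costs at most N/8, since
   sum_i |Y_i|^2 <= 2 k N with high probability; hence
   sum_i <Y_i, v>^2 >= (N/4) |v|^2. *)

(* The marginals have only 4 + eps moments, so a union bound over a net of the whole sphere cannot
   give the upper bound. Integer vectors of l1 norm at most m are few enough for moments of that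
   order, and a vector c of small l1 norm can be replaced by one as in Maurey's sampling argument.
   What is rounded is a quadratic function of c: the first-order error averages out, and what
   remains is a variance, of order lam |c|_1 max |Y_i|^2 for lattice step lam, without any
   dependence on the dimension.

   Rows in the support of z, and the exceptional rows, escape the probabilistic estimate. On them
   the unknown bound B itself is used, which is why the argument closes through B <= B/4 + O(n).
   There are about log n levels, and losing the same fraction of B at each would leave a logarithm.
   Since eta > 0, the thresholds leave a geometric slack away from the last level; [tent] turns it
   into lattice steps whose losses are summable.

   The number n = max(k, N) appears because the singular value bound is claimed without k <= c3
   N. *)
Require Import Defs.
From HB Require Import structures.
From mathcomp Require Import all_boot all_order all_algebra.
From mathcomp Require Import all_classical all_reals all_analysis.
From mathcomp Require Import measurable_realfun.
From mathcomp Require Import ring lra.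

Set Implicit Arguments.
Unset Strict Implicit.
Unset Printing Implicit Defensive.

Import Order.TTheory GRing.Theory Num.Theory.
Import numFieldNormedType.Exports.

Local Open Scope classical_set_scope.
Local Open Scope ring_scope.

(** * Rounding to the integer lattice *)

Section dot.
Variables (R : realType) (k : nat).
Implicit Types u v w : 'rV[R]_k.

Definition dot u v : R := \sum_(a < k) u 0 a * v 0 a.

Lemma dotC u v : dot u v = dot v u.
Proof. by apply: eq_bigr => a _; rewrite mulrC. Qed.

Lemma dotDl u v w : dot (u + v) w = dot u w + dot v w.
Proof. by rewrite -big_split; apply: eq_bigr => a _; rewrite mxE mulrDl. Qed.

Lemma dotZl (t : R) u v : dot (t *: u) v = t * dot u v.
Proof. by rewrite mulr_sumr; apply: eq_bigr => a _; rewrite mxE mulrA. Qed.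

Lemma dotDr u v w : dot u (v + w) = dot u v + dot u w.
Proof. by rewrite dotC dotDl !(dotC u). Qed.

Lemma dotZr (t : R) u v : dot u (t *: v) = t * dot u v.
Proof. by rewrite dotC dotZl dotC. Qed.

Lemma dotBl u v w : dot (u - v) w = dot u w - dot v w.
Proof. by rewrite -scaleN1r dotDl dotZl mulN1r. Qed.

Lemma dotBr u v w : dot u (v - w) = dot u v - dot u w.
Proof. by rewrite dotC dotBl !(dotC u). Qed.

Lemma dot0l v : dot 0 v = 0.
Proof. by rewrite /dot big1 // => a _; rewrite mxE mul0r. Qed.

Lemma dot_ge0 u : 0 <= dot u u.
Proof. by apply: sumr_ge0 => a _; rewrite -expr2 sqr_ge0. Qed.

Lemma dot_sqr u : dot u u = \sum_a u 0 a ^+ 2.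
Proof. by apply: eq_bigr => a _; rewrite expr2. Qed.

Lemma dot_eq0 u : dot u u = 0 -> u = 0.
Proof.
rewrite dot_sqr => /eqP; rewrite psumr_eq0 => [/allP h|a _]; last exact: sqr_ge0.
apply/rowP => a; rewrite mxE; apply/eqP.
by have := h a (mem_index_enum _); rewrite sqrf_eq0.
Qed.

Lemma dot_amgm (t : R) u v : 0 < t ->
  dot u v <= t * dot v v + dot u u / (4 * t).
Proof.
move=> t0; have := dot_ge0 ((2 * t) *: v - u).
rewrite dotBl !dotBr !dotZl !dotZr (dotC v u) => h.
rewrite -subr_ge0.
have -> : t * dot v v + dot u u / (4 * t) - dot u v =
  (2 * t * (2 * t * dot v v - dot u v) - (2 * t * dot u v - dot u u)) / (4 * t).
  by field; lra.
by rewrite divr_ge0 //; lra.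
Qed.

Lemma dot_mulmx N (b : 'rV[R]_N) (Y : 'M[R]_(N, k)) w :
  dot (b *m Y) w = \sum_i b 0 i * dot (row i Y) w.
Proof.
under eq_bigr do rewrite /dot mulr_sumr; rewrite exchange_big /=.
apply: eq_bigr => a _; rewrite mxE mulr_suml; apply: eq_bigr => i _.
by rewrite mxE mulrA.
Qed.

Lemma dotZZ (t : R) u : dot (t *: u) (t *: u) = t ^+ 2 * dot u u.
Proof. by rewrite dotZl dotZr mulrA expr2. Qed.

Lemma dotD2 u v : dot (u + v) (u + v) <= 2 * dot u u + 2 * dot v v.
Proof.
have := dot_ge0 (u - v); rewrite dotBl !dotBr dotDl !dotDr (dotC v u); lra.
Qed.

End dot.

Section rounding.
Variables (R : realType) (N : nat).
Implicit Types (x c : 'rV[R]_N) (G Q : 'rV[R]_N -> R).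

Definition set_coord x (i : 'I_N) (t : R) : 'rV[R]_N :=
  x + (t - x 0 i) *: delta_mx 0 i.

Lemma set_coordE x i t j :
  set_coord x i t 0 j = if j == i then t else x 0 j.
Proof.
rewrite !mxE /=; case: eqP => [->|_]; last by rewrite mulr0 addr0.
by rewrite mulr1 addrC subrK.
Qed.

(* Method of conditional expectations: the coordinates are rounded one at a time. *)
Lemma greedy_rounding G (lo hi err : 'I_N -> R) c :
  (forall x i, x 0 i = c 0 i ->
     G (set_coord x i (lo i)) <= G x + err i \/
     G (set_coord x i (hi i)) <= G x + err i) ->
  exists x, (forall i, x 0 i = lo i \/ x 0 i = hi i) /\
            G x <= G c + \sum_i err i.
Proof.
move=> step.
suff /(_ (index_enum 'I_N) (index_enum_uniq _)) [x [xs _ Gx]] :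
  forall s : seq 'I_N, uniq s -> exists x,
    [/\ forall i, i \in s -> x 0 i = lo i \/ x 0 i = hi i,
        forall i, i \notin s -> x 0 i = c 0 i &
        G x <= G c + \sum_(i <- s) err i].
  by exists x; split => // i; exact: xs (mem_index_enum i).
elim=> [_|i s IH /= /andP[iNs us]].
  by exists c; split => //; rewrite big_nil addr0.
have [x [xs xc Gx]] := IH us.
have key t : t = lo i \/ t = hi i -> G (set_coord x i t) <= G x + err i ->
  exists x', [/\ forall j, j \in i :: s -> x' 0 j = lo j \/ x' 0 j = hi j,
        forall j, j \notin i :: s -> x' 0 j = c 0 j &
        G x' <= G c + \sum_(j <- i :: s) err j].
  move=> ht hG; exists (set_coord x i t); split.
  - move=> j; rewrite inE set_coordE; case: eqP => [-> //|_ /=]; exact: xs.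
  - by move=> j; rewrite inE negb_or set_coordE => /andP[/negbTE -> /xc].
  - by rewrite big_cons; lra.
by case: (step x i (xc i iNs)) => h; apply: key h; [left|right].
Qed.

(* Rounding [c] to [lam Z^N] at random without bias would leave the expected l1
   norm unchanged and increase the expectation of [Q] by [\sum_i v i * q2 i], where
   [v i = lam^2 p_i (1 - p_i)] is the variance of the i-th coordinate. *)
Lemma round_quadratic Q (q1 : 'rV[R]_N -> 'I_N -> R) (q2 : 'I_N -> R) (lam A : R) :
  0 < lam ->
  (forall x i t, Q (x + t *: delta_mx 0 i) = Q x + t * q1 x i + t ^+ 2 * q2 i) ->
  forall c, exists (z : 'I_N -> int) (v : 'I_N -> R),
    [/\ forall i, [/\ 0 <= v i, v i <= lam ^+ 2 / 4 & v i <= lam * `|c 0 i|],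
        forall i, `|z i|%:~R <= `|c 0 i| / lam + 1 :> R &
        Q (lam *: \row_i (z i)%:~R) + A * \sum_i lam * `|z i|%:~R <=
        Q c + A * (\sum_i `|c 0 i|) + \sum_i v i * q2 i].
Proof.
move=> lam0 HQ c.
pose f i := Num.floor (c 0 i / lam); pose p i : R := c 0 i / lam - (f i)%:~R.
have fp i : 0 <= p i < 1.
  have /andP[h1 h2] := floor_itv (c 0 i / lam).
  by rewrite /p /f subr_ge0 h1 ltrBlDl /= -[X in _ + X]/(1%:~R) -intrD.
have cE i : c 0 i = lam * ((f i)%:~R + p i).
  by rewrite /p addrC subrK mulrCA divff ?mulr1 ?gt_eqF.
pose v i := lam ^+ 2 * (p i * (1 - p i)).
pose G x := Q x + A * \sum_i `|x 0 i|.
have sgnf i : (0 <= f i) || (f i <= -1).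
  by case: (ltP (f i) 0) => h; rewrite ?orbT //=; rewrite orbC -ltzD1 h.
have sumG x i t : \sum_j `|set_coord x i t 0 j| = \sum_j `|x 0 j| + (`|t| - `|x 0 i|).
  rewrite (bigD1 i) //= (bigD1 i (P := xpredT)) //= set_coordE eqxx.
  rewrite (eq_bigr (fun j => `|x 0 j|)); last by move=> j /negbTE ji; rewrite set_coordE ji.
  by ring.
(* No zero lies strictly between consecutive multiples of [lam], so the absolute value is affine on
   the cell and unbiased rounding preserves its mean. *)
have absE i : `|c 0 i| = (1 - p i) * `|lam * (f i)%:~R| + p i * `|lam * (f i + 1)%:~R|.
  rewrite {1}cE intrD.
  have /andP[p0 p1] := fp i; case/orP: (sgnf i) => h.
    have h' : 0 <= (f i)%:~R :> R by rewrite ler0z.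
    have h1 : 0 <= lam * (f i)%:~R by nra.
    have h2 : 0 <= lam * ((f i)%:~R + 1) by nra.
    have h3 : 0 <= lam * ((f i)%:~R + p i) by nra.
    by rewrite !ger0_norm //; ring.
  have h' : (f i)%:~R <= -1 :> R by rewrite -[-1]/((-1)%:~R) ler_int.
  have h1 : lam * (f i)%:~R <= 0 by nra.
  have h2 : lam * ((f i)%:~R + 1) <= 0 by nra.
  have h3 : lam * ((f i)%:~R + p i) <= 0 by nra.
  by rewrite !ler0_norm //; ring.
have [x i xc|x [xlh Gx]] := @greedy_rounding G (fun i => lam * (f i)%:~R)
   (fun i => lam * (f i + 1)%:~R) (fun i => v i * q2 i) c.
  apply/orP; rewrite -!lerBlDl.
  set a := (X in X <= _); set b := (X in _ || (X <= _)).
  (* [a] and [b] are the increments of [G] for rounding down and up. In their mean with weights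
     [1 - p i] and [p i] the linear term and the l1 term cancel, so one of the two increments is at
     most the variance term. *)
  have E : (1 - p i) * a + p i * b = v i * q2 i.
    rewrite /a /b /G /set_coord !HQ -!/(set_coord _ _ _) !sumG xc absE /v {1 2 3 4}cE intrD.
    by ring.
  have /andP[p0 p1] := fp i.
  case: (leP a (v i * q2 i)) => //= ha.
  rewrite leNgt; apply/negP => hb.
  have : v i * q2 i < (1 - p i) * a + p i * b by nra.
  by rewrite E ltxx.
pose z i : int := if x 0 i == lam * (f i)%:~R then f i else f i + 1.
have xz i : x 0 i = lam * (z i)%:~R.
  by rewrite /z; case: eqP => // h; case: (xlh i).
exists z, v; split.
- move=> i; have /andP[p0 p1] := fp i; split.
  + by rewrite /v; apply: mulr_ge0; nra.
  + have h : p i * (1 - p i) <= 4^-1 by have := sqr_ge0 (p i - 2^-1); rewrite expr2; lra.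
    by rewrite /v; apply: ler_wpM2l => //; rewrite exprn_ge0 // ltW.
  + rewrite /v expr2 -mulrA ler_pM2l // {1}cE normrM (gtr0_norm lam0) ler_pM2l //.
    case/orP: (sgnf i) => h.
      have h' : 0 <= (f i)%:~R :> R by rewrite ler0z.
      by rewrite ger0_norm; [nra|lra].
    have h' : (f i)%:~R <= -1 :> R by rewrite -[-1]/((-1)%:~R) ler_int.
    by rewrite ler0_norm; [nra|lra].
- move=> i; have /andP[p0 p1] := fp i.
  rewrite {1}cE normrM (gtr0_norm lam0) mulrAC divff ?gt_eqF // mul1r.
  rewrite intr_norm /z; case: ifP => _; rewrite ?intrD;
    rewrite !ler_norml; move: (ler_norm ((f i)%:~R + p i : R)) (ler_norm (- ((f i)%:~R + p i : R)));
    by rewrite normrN => h1 h2; apply/andP; split; lra.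
- have -> : lam *: \row_i (z i)%:~R = x.
    by apply/rowP => i; rewrite !mxE xz.
  rewrite (eq_bigr (fun i => `|x 0 i|)) //.
  by move=> i _; rewrite xz normrM (gtr0_norm lam0) intr_norm.
Qed.
End rounding.

(** * Upper bound from the scarcity of large products *)

Section lattice_bounds.
Variables (R : realType) (N k : nat) (Y : 'M[R]_(N, k)).

Definition int_row (z : 'I_N -> int) : 'rV[R]_N := \row_i (z i)%:~R.

(** Only rows outside the support of [z] are counted, as these are independent of Y(z). The start at
    [m = 4] comes from the union bound, which leaves a probability of order (m/n)^(eps m / 4), of
    which the power eps is wanted. *)
Definition few_large_products (s : nat -> R) : Prop :=
  forall (m : nat) (z : 'I_N -> int), (4 <= m <= N)%N ->
    (\sum_i `|z i| <= m)%N ->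
    (#|[set i | (z i == 0) &&
         (s m * Num.sqrt (dot (int_row z *m Y) (int_row z *m Y)) <
          `|dot (row i Y) (int_row z *m Y)|)%R]%SET| < m)%N.

Variables (rho B2 : R) (s : nat -> R).
Hypothesis rowY : forall i, dot (row i Y) (row i Y) <= rho.
Hypothesis B2P : forall b : 'rV_N, dot (b *m Y) (b *m Y) <= B2 * dot b b.
Hypothesis B2_ge0 : 0 <= B2.
Hypothesis s_ge0 : forall m, 0 <= s m.
Hypothesis HY : few_large_products s.

(* At most [2 m] coordinates of [d] lie on the support of [z] or at a large
   product; on these only the operator norm bound [B2] is available. *)
Lemma lattice_bound (t tau lam smu : R) (mu : nat) (d : 'rV[R]_N) (z : 'I_N -> int) :
  0 < t -> 0 < lam -> (forall i, `|d 0 i| <= tau) ->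
  (forall m, (mu + 4 <= m)%N -> s m <= smu) ->
  dot (d *m Y) ((lam *: int_row z) *m Y) <=
    2 * t * dot ((lam *: int_row z) *m Y) ((lam *: int_row z) *m Y)
    + ((\sum_i `|d 0 i|) * smu) ^+ 2 / (4 * t)
    + B2 * tau ^+ 2 / (2 * t) * ((\sum_i `|z i|%:~R) + (mu + 4)%:R).
Proof.
move=> t0 lam0 dtau smuP; set w := (lam *: _) *m Y.
pose m := (\sum_i `|z i| + (mu + 4))%N.
pose bad := [set i | (z i == 0) &&
         (s m * Num.sqrt (dot (int_row z *m Y) (int_row z *m Y)) <
          `|dot (row i Y) (int_row z *m Y)|)%R]%SET.
pose T := [set i | z i != 0]%SET :|: bad.
have cT : (#|T| <= m + m)%N.
  rewrite (leq_trans (leq_card_setU _ _)) // leq_add //.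
    rewrite /m (leq_trans _ (leq_addr _ _)) // -sum1_card big_mkcond /=.
    by apply: leq_sum => i _; rewrite inE; case: ifP => //; rewrite absz_gt0.
  (* For m > N scarcity says nothing, but there are only N rows anyway. *)
  have [mN|Nm] := leqP m N.
    apply/ltnW/HY; last by rewrite leq_addr.
    by rewrite mN andbT /m addnA leq_addl.
  by rewrite (leq_trans _ (ltnW Nm)) // (leq_trans (max_card _)) ?card_ord.
pose d1 : 'rV[R]_N := \row_i if i \in T then d 0 i else 0.
pose d2 : 'rV[R]_N := \row_i if i \in T then 0 else d 0 i.
have -> : d = d1 + d2.
  by apply/rowP => i; rewrite !mxE; case: ifP; rewrite ?addr0 ?add0r.
have d12 : \sum_i `|(d1 + d2) 0 i| = \sum_i `|d 0 i|.
  by apply: eq_bigr => i _; rewrite !mxE; case: ifP; rewrite ?addr0 ?add0r.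
rewrite d12 mulmxDl dotDl.
have tau0 : 0 <= tau ^+ 2 by rewrite sqr_ge0.
have m_R : m%:R = (\sum_i `|z i|%:~R) + (mu + 4)%:R :> R.
  by rewrite /m natrD natr_sum.
have h1 : dot (d1 *m Y) w <= t * dot w w + B2 * tau ^+ 2 / (2 * t) * m%:R.
  apply: le_trans (@dot_amgm _ _ t _ _ t0) _; rewrite lerD2l.
  have -> : B2 * tau ^+ 2 / (2 * t) * m%:R = (B2 * (tau ^+ 2 * (m + m)%:R)) / (4 * t).
    by rewrite natrD; field; lra.
  rewrite ler_wpM2r ?invr_ge0 ?mulr_ge0 ?(ltW t0) //.
  apply: le_trans (B2P _) _; rewrite ler_wpM2l // dot_sqr.
  apply: (@le_trans _ _ (\sum_i if i \in T then tau ^+ 2 else 0)).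
    apply: ler_sum => i _; rewrite mxE; case: ifP => _; last by rewrite expr0n.
    by have := dtau i; rewrite ler_norml => /andP[? ?]; nra.
  rewrite -big_mkcond /= sumr_const -[X in X <= _]mulr_natr ler_wpM2l // ler_nat; exact: cT.
have smu0 : 0 <= smu by apply: le_trans (s_ge0 (mu + 4)) (smuP _ _).
pose y := Num.sqrt (dot w w); pose S := \sum_i `|d 0 i|.
have y2 : y ^+ 2 = dot w w by rewrite sqr_sqrtr ?dot_ge0.
have yE : y = lam * Num.sqrt (dot (int_row z *m Y) (int_row z *m Y)).
  by rewrite /y /w -scalemxAl dotZZ sqrtrM ?sqr_ge0 // sqrtr_sqr gtr0_norm.
have h2 : dot (d2 *m Y) w <= S * smu * y.
  rewrite dot_mulmx /S !mulr_suml; apply: ler_sum => i _.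
  rewrite mxE; case: ifPn => iT; first by rewrite mul0r !mulr_ge0 // sqrtr_ge0.
  apply: le_trans (ler_norm _) _; rewrite normrM -!mulrA ler_wpM2l //.
  move: iT; rewrite !inE negb_or negbK negb_and => /andP[-> /=]; rewrite -leNgt => h.
  rewrite /w -scalemxAl dotZr normrM (gtr0_norm lam0) yE mulrCA ler_wpM2l ?(ltW lam0) //.
  apply: le_trans h _; rewrite ler_wpM2r ?sqrtr_ge0 //; apply: smuP.
  by rewrite /m leq_addl.
have h3 : S * smu * y <= t * dot w w + (S * smu) ^+ 2 / (4 * t).
  rewrite -y2 -subr_ge0.
  have -> : t * y ^+ 2 + (S * smu) ^+ 2 / (4 * t) - S * smu * y =
    (2 * t * y - S * smu) ^+ 2 / (4 * t) by field; lra.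
  by rewrite divr_ge0 ?sqr_ge0 //; lra.
rewrite -m_R -/S; lra.
Qed.

(** [lattice_bound] charges both for the quadratic form and for the l1 norm of [z], so the rounding
    of [c] must keep both under control at once: [Q] collects the first, and [A] is exactly the
    price of the second. The variance bound [v i <= lam * |c i|] turns the rounding error into the
    term with [rho]. *)
Lemma level_bound (t tau lam smu : R) (mu : nat) (d c : 'rV[R]_N) :
  0 < t -> 0 < lam -> (forall i, `|d 0 i| <= tau) ->
  (forall m, (mu + 4 <= m)%N -> s m <= smu) ->
  dot (d *m Y) (c *m Y) <=
    2 * t * (dot (c *m Y) (c *m Y) + lam * rho * \sum_i `|c 0 i|)
    + ((\sum_i `|d 0 i|) * smu) ^+ 2 / (4 * t)
    + B2 * tau ^+ 2 / (2 * t) * ((\sum_i `|c 0 i|) / lam + (mu + 4)%:R).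
Proof.
move=> t0 lam0 dtau smuP.
pose Q (x : 'rV[R]_N) := 2 * t * dot (x *m Y) (x *m Y) - dot (d *m Y) (x *m Y).
pose q1 (x : 'rV[R]_N) i := 4 * t * dot (x *m Y) (row i Y) - dot (d *m Y) (row i Y).
pose q2 i := 2 * t * dot (row i Y) (row i Y).
pose A := B2 * tau ^+ 2 / (2 * t) / lam.
have QE x i u : Q (x + u *: delta_mx 0 i) = Q x + u * q1 x i + u ^+ 2 * q2 i.
  rewrite /Q /q1 /q2 !mulmxDl -scalemxAl -rowE !dotDl !dotDr !dotZl !dotZr.
  by rewrite (dotC (row i Y) (x *m Y)); ring.
have [z [v [vP _]]] := round_quadratic A lam0 QE c.
rewrite -/(int_row z).
set w := _ *m Y.
have := @lattice_bound t tau lam smu mu d z t0 lam0 dtau smuP; rewrite /= -/w /Q.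
set S := \sum_i _.
have -> : A * (\sum_i lam * `|z i|%:~R) = B2 * tau ^+ 2 / (2 * t) * \sum_i `|z i|%:~R.
  by rewrite -mulr_sumr mulrA /A divfK // gt_eqF.
have -> : A * (\sum_i `|c 0 i|) = B2 * tau ^+ 2 / (2 * t) * ((\sum_i `|c 0 i|) / lam).
  by rewrite /A [RHS]mulrA [LHS]mulrAC.
have vb : \sum_i v i * q2 i <= 2 * t * (lam * rho * \sum_i `|c 0 i|).
  rewrite !mulr_sumr; apply: ler_sum => i _; have [v0 _ v2] := vP i.
  have := rowY i; have := dot_ge0 (row i Y); rewrite /q2.
  set D := dot _ _ => D0 Drho.
  apply: (@le_trans _ _ (v i * (2 * t * rho))).
    by rewrite ler_wpM2l // ler_wpM2l //; lra.
  rewrite mulrC; have -> : 2 * t * (lam * rho * `|c 0 i|) = 2 * t * rho * (lam * `|c 0 i|) by ring.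
  by rewrite ler_wpM2l //; rewrite mulr_ge0 //; lra.
lra.
Qed.

End lattice_bounds.

Section operator_bound.
Variables (R : realType) (N k : nat) (Y : 'M[R]_(N, k)) (rho : R).
Hypothesis rowY : forall i, dot (row i Y) (row i Y) <= rho.

(** Triangle inequality. Crude, but it makes the supremum in [contraction_bound] finite, and it
    suffices for the entries above [h], which have small l1 norm. *)
Lemma dot_mulmx_le_norm1 (b : 'rV[R]_N) :
  dot (b *m Y) (b *m Y) <= rho * (\sum_i `|b 0 i|) ^+ 2.
Proof.
rewrite dot_mulmx expr2 mulr_suml mulr_sumr; apply: ler_sum => i _.
rewrite dotC dot_mulmx !mulr_sumr; apply: ler_sum => j _.
have := rowY i; have := rowY j.
have h1 := dot_ge0 (row i Y - row j Y); have h2 := dot_ge0 (row i Y + row j Y).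
move: h1 h2; rewrite dotBl !dotBr dotDl !dotDr (dotC (row j Y) (row i Y)) => h1 h2 h3 h4.
apply: le_trans (ler_norm _) _; rewrite !normrM.
have -> : rho * (`|b 0 i| * `|b 0 j|) = `|b 0 i| * (`|b 0 j| * rho) by ring.
by do 2 apply: ler_wpM2l => //; rewrite ler_norml; apply/andP; split; lra.
Qed.

(* Apply the hypothesis to the best constant [B2]. *)
Lemma contraction_bound (C : R) : 0 <= C ->
  (forall B2 : R, 0 <= B2 ->
     (forall b : 'rV_N, dot (b *m Y) (b *m Y) <= B2 * dot b b) ->
     forall b : 'rV_N, dot b b <= 1 -> dot (b *m Y) (b *m Y) <= B2 / 4 + C) ->
  forall b : 'rV_N, dot (b *m Y) (b *m Y) <= 4 / 3 * C * dot b b.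
Proof.
move=> C0 H.
pose E : set R := ([set x | exists2 b : 'rV[R]_N, dot b b <= 1 & x = dot (b *m Y) (b *m Y)])%classic.
have E0 : E 0 by exists 0; rewrite ?mul0mx dot0l.
have ubE : ubound E (`|rho| * N%:R ^+ 2).
  move=> _ [b b1 ->]; apply: le_trans (dot_mulmx_le_norm1 b) _.
  apply: le_trans (ler_wpM2r _ (ler_norm _)) _; first by rewrite sqr_ge0.
  apply: ler_wpM2l => //.
  rewrite lerXn2r ?nnegrE ?sumr_ge0 //.
  rewrite -[leRHS]mulr1 -[N in leRHS]card_ord mulr_natl -sumr_const; apply: ler_sum => i _.
  rewrite -(@expr_le1 _ 2) // -normrX ger0_norm ?sqr_ge0 //.
  apply: le_trans b1; rewrite dot_sqr (bigD1 i) //= lerDl sumr_ge0 // => j _.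
  exact: sqr_ge0.
have supE : has_sup E by split; [exists 0|eexists; exact: ubE].
pose B2 := sup E.
have B0 : 0 <= B2 by apply: (ub_le_sup (proj2 supE)).
have BP (b : 'rV[R]_N) : dot (b *m Y) (b *m Y) <= B2 * dot b b.
  have [/dot_eq0->|b0] := eqVneq (dot b b) 0; first by rewrite mul0mx !dot0l mulr0.
  have bp : 0 < dot b b by rewrite lt0r b0 dot_ge0.
  pose n := Num.sqrt (dot b b); have n2 : n ^+ 2 = dot b b by rewrite sqr_sqrtr ?dot_ge0.
  have n0 : 0 < n by rewrite sqrtr_gt0.
  have : E (dot ((n^-1 *: b) *m Y) ((n^-1 *: b) *m Y)).
    by exists (n^-1 *: b) => //; rewrite dotZZ exprVn n2 mulVf.
  move/(ub_le_sup (proj2 supE)); rewrite -scalemxAl dotZZ exprVn n2.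
  by rewrite -/B2 mulrC ler_pdivrMr.
have HB : B2 <= B2 / 4 + C.
  by apply: ge_sup => [|_ [b b1 ->]]; [exists 0 | exact: H].
move=> b; apply: le_trans (BP b) _; apply: ler_wpM2r; first exact: dot_ge0.
lra.
Qed.

End operator_bound.

Section geometric_sums.
Variable R : realType.

Lemma sum_geom2 (h : R) L : 0 <= h -> \sum_(x < L) h * 2^-1 ^+ x <= 2 * h.
Proof.
move=> h0; suff -> : \sum_(x < L) h * 2^-1 ^+ x = 2 * h * (1 - 2^-1 ^+ L).
  have : 0 <= 2^-1 ^+ L :> R by rewrite exprn_ge0 ?invr_ge0.
  by move=> ?; nra.
elim: L => [|L IH]; first by rewrite big_ord0 expr0 subrr mulr0.
by rewrite big_ord_recr /= IH exprS; lra.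
Qed.

(** The terms not below [y] count as 0, and the first one below it starts a geometric series of
    ratio 1/2. *)
Lemma sum_geom2_lt (h y : R) L : 0 <= h -> 0 <= y ->
  \sum_(x < L) (if h * 2^-1 ^+ x < y then h * 2^-1 ^+ x else 0) <= 2 * y.
Proof.
move=> + y0; elim: L h => [|L IH] h h0; first by rewrite big_ord0 mulr_ge0.
have [hy|hy] := ltP h y.
  apply: (@le_trans _ _ (2 * h)); last by lra.
  apply: le_trans (sum_geom2 L.+1 h0); apply: ler_sum => x _.
  by case: ifP => _; [|rewrite mulr_ge0 ?exprn_ge0 ?invr_ge0].
rewrite big_ord_recl /= expr0 mulr1 ltNge hy /= add0r.
under eq_bigr do rewrite /bump /= add1n exprS mulrA.
by apply: IH; lra.
Qed.

Lemma sum_geomV (q : R) L : 1 < q -> \sum_(x < L) q^-1 ^+ x <= (1 - q^-1)^-1.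
Proof.
move=> q1; have q0 : 0 < q by lra.
have hq : 0 < 1 - q^-1 by rewrite subr_gt0 invf_lt1.
suff E : (1 - q^-1) * (\sum_(x < L) q^-1 ^+ x) = 1 - q^-1 ^+ L.
  rewrite -(ler_pM2l hq) E divff ?gt_eqF // gerBl exprn_ge0 // invr_ge0; lra.
elim: L => [|L IH]; first by rewrite big_ord0 mulr0 expr0 subrr.
by rewrite big_ord_recr /= mulrDr IH exprS; ring.
Qed.

End geometric_sums.

Section magnitude_levels.
Variables (R : realType) (N L : nat) (b : 'rV[R]_N) (h : R).
Hypothesis b1 : dot b b <= 1.
Hypothesis h0 : 0 < h.
Hypothesis h1 : h <= 1.

Definition tau (x : nat) : R := h * 2^-1 ^+ x.

Definition level_set (x : nat) (i : 'I_N) : bool :=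
  (`|b 0 i| <= h) && ((x == L) || (tau x.+1 < `|b 0 i|)).

(* Index shifted by one: [trunc_vec x.+1] keeps the entries of [b]
   of magnitude in ]tau x.+1, h], or in [0, h] when [x = L], and [trunc_vec 0 = 0]. *)
Definition trunc_vec (x : nat) : 'rV[R]_N :=
  if x is x'.+1 then \row_i (if level_set x' i then b 0 i else 0) else 0.

Definition level_norm (x : nat) : R := \sum_i `|trunc_vec x.+1 0 i|.

Lemma tau_gt0 x : 0 < tau x.
Proof. by rewrite mulr_gt0 // exprn_gt0 // invr_gt0. Qed.

Lemma tauS x : tau x.+1 = tau x / 2.
Proof. by rewrite /tau exprSr mulrA. Qed.

Lemma level_norm_ge0 x : 0 <= level_norm x.
Proof. exact: sumr_ge0. Qed.

Lemma level_setS x i : (x < L)%N -> level_set x i -> level_set x.+1 i.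
Proof.
rewrite /level_set => xL /andP[-> /= /orP[/eqP xE|h2]]; first by rewrite xE ltnn in xL.
by rewrite (lt_trans _ h2) ?orbT // [ltLHS]tauS; have := tau_gt0 x.+1; lra.
Qed.

Lemma trunc_vecS x i :
  trunc_vec x.+1 0 i = if level_set x i then b 0 i else 0.
Proof. by rewrite mxE. Qed.

Lemma trunc_vec0 i : trunc_vec 0 0 i = 0.
Proof. by rewrite mxE. Qed.

Lemma trunc_vecB x i :
  (trunc_vec x.+1 - trunc_vec x) 0 i = trunc_vec x.+1 0 i - trunc_vec x 0 i.
Proof. by rewrite mxE; congr (_ + _); rewrite mxE. Qed.

Lemma trunc_vec_le x i : `|trunc_vec x 0 i| <= `|b 0 i|.
Proof.
by case: x => [|x]; rewrite mxE ?normr0 //; case: ifP; rewrite ?normr0.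
Qed.

(** An entry that enters at level x was refused at level x - 1, hence is at most [tau x]; at x = 0
    the cap [h = tau 0] serves instead. *)
Lemma level_diff_le x i : (x <= L)%N -> `|(trunc_vec x.+1 - trunc_vec x) 0 i| <= tau x.
Proof.
move=> xL; rewrite trunc_vecB trunc_vecS; case: x xL => [_|x xL].
  rewrite trunc_vec0 subr0; case: ifP => [/andP[bh _]|_]; first by rewrite /tau expr0 mulr1.
  by rewrite normr0 ltW // tau_gt0.
rewrite trunc_vecS; case: ifPn => [h3|h3]; last first.
  rewrite [level_set x i]negbTE; last by apply: contra h3; exact: level_setS.
  by rewrite subrr normr0 ltW // tau_gt0.
case: ifPn => h2; first by rewrite subrr normr0 ltW // tau_gt0.
move: h2; rewrite /level_set; case/andP: h3 => -> _ /=; rewrite negb_or => /andP[_].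
by rewrite -leNgt subr0.
Qed.

Lemma level_diff_norm1 x : (x <= L)%N ->
  \sum_i `|(trunc_vec x.+1 - trunc_vec x) 0 i| <= level_norm x.
Proof.
move=> xL; apply: ler_sum => i _.
rewrite trunc_vecB; case: x xL => [|x] xL; first by rewrite trunc_vec0 subr0.
rewrite !trunc_vecS; case: ifPn => h3; last first.
  rewrite [level_set x i]negbTE ?subrr //; apply: contra h3; exact: level_setS.
by case: ifP; rewrite ?subrr ?normr0 ?subr0.
Qed.

Lemma level_sum_norm1 x : (x <= L)%N ->
  \sum_i `|(trunc_vec x.+1 + trunc_vec x) 0 i| <= 2 * level_norm x.
Proof.
move=> xL; rewrite mulr_sumr; apply: ler_sum => i _.
apply: le_trans (_ : `|trunc_vec x.+1 0 i| + `|trunc_vec x 0 i| <= _).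
  by rewrite mxE ler_normD.
suff : `|trunc_vec x 0 i| <= `|trunc_vec x.+1 0 i| by lra.
case: x xL => [|x] xL; first by rewrite trunc_vec0 normr0.
rewrite !trunc_vecS; case: ifPn => [h2|_]; last by rewrite normr0.
by rewrite level_setS.
Qed.

Lemma level_sum_sqr x : dot (trunc_vec x.+1 + trunc_vec x) (trunc_vec x.+1 + trunc_vec x) <= 4.
Proof.
have le1 y : dot (trunc_vec y) (trunc_vec y) <= 1.
  apply: le_trans b1; rewrite !dot_sqr; apply: ler_sum => i _.
  by rewrite -[leLHS]real_normK ?num_real // -[leRHS]real_normK ?num_real // lerXn2r ?nnegrE // trunc_vec_le.
apply: le_trans (dotD2 _ _) _; have := le1 x; have := le1 x.+1; lra.
Qed.

Hypothesis NL : N%:R * (2^-1 ^+ L) ^+ 2 <= 1 :> R.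

Let tauL : N%:R * tau L ^+ 2 <= 1.
Proof.
rewrite /tau exprMn mulrCA; apply: mulr_ile1 => //; last by rewrite exprn_ile1 // ltW.
- by rewrite exprn_ge0 // ltW.
Qed.

Let abs_sqr (t : R) i : 0 < t -> t * `|b 0 i| <= (t ^+ 2 + b 0 i ^+ 2) / 2.
Proof.
move=> t0; have := sqr_ge0 (t - `|b 0 i|).
by rewrite sqrrB real_normK ?num_real // -mulr_natr; lra.
Qed.

(** Exchange the sums. Below the last level, entry i occurs only where [tau x] is less than 2 |b_i|,
    and such [tau x] sum to at most 4 |b_i|, which gives 4 |b|^2. The last level contains all the
    small entries; there |b_i| [tau L] is at most half of [tau L ^+ 2] plus b_i^2, and N
    [tau L ^+ 2] is at most 1. In total 4 + 1/2 + 1/2. *)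
Lemma sum_level_mass : \sum_(x < L.+1) tau x * level_norm x <= 5.
Proof.
have E x : tau x * level_norm x = \sum_i `|b 0 i| * (if level_set x i then tau x else 0).
  rewrite /level_norm mulr_sumr; apply: eq_bigr => i _; rewrite mxE.
  by case: ifP; rewrite ?normr0 ?mulr0 // mulrC.
under eq_bigr do rewrite E.
rewrite exchange_big /=.
have key i : \sum_(x < L.+1) `|b 0 i| * (if level_set x i then tau x else 0) <=
   4 * b 0 i ^+ 2 + (tau L ^+ 2 + b 0 i ^+ 2) / 2.
  rewrite -mulr_sumr big_ord_recr /= mulrDr; apply: lerD; last first.
    apply: le_trans (abs_sqr i (tau_gt0 L)); rewrite mulrC ler_wpM2r //.
    by case: ifP => // _; rewrite ltW // tau_gt0.
  apply: (@le_trans _ _ (`|b 0 i| * (2 * (2 * `|b 0 i|)))); last first.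
    by rewrite -[b 0 i ^+ 2]real_normK ?num_real //; rewrite expr2; lra.
  apply: ler_wpM2l => //.
  have y0 : 0 <= 2 * `|b 0 i| by rewrite mulr_ge0.
  apply: le_trans (sum_geom2_lt L (ltW h0) y0).
  apply: ler_sum => x _; rewrite -/(tau x); case: ifP => [/andP[_]|_].
    rewrite (ltn_eqF (ltn_ord x)) /= tauS => hx; rewrite ifT //; lra.
  by case: ifP => // _; rewrite ltW // tau_gt0.
apply: le_trans (ler_sum _ (fun i _ => key i)) _.
rewrite big_split /= -mulr_suml -mulr_sumr big_split /= sumr_const card_ord.
rewrite -mulr_natl; move: b1 tauL; rewrite dot_sqr; lra.
Qed.

Lemma level_norm_le x : (x <= L)%N -> level_norm x <= 2 / tau x.
Proof.
move=> xL; rewrite ler_pdivlMr ?tau_gt0 // mulrC /level_norm mulr_sumr.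
have [xE|xnL] := eqVneq x L; last first.
  apply: (@le_trans _ _ (\sum_i 2 * b 0 i ^+ 2)); last first.
    by rewrite -mulr_sumr -dot_sqr; move: b1; lra.
  apply: ler_sum => i _; rewrite trunc_vecS; case: ifP => [/andP[_]|_]; last first.
    by rewrite normr0 mulr0 mulr_ge0 // sqr_ge0.
  rewrite (negbTE xnL) /= tauS -[b 0 i ^+ 2]real_normK ?num_real // => hx.
  have := normr_ge0 (b 0 i); nra.
rewrite xE; apply: (@le_trans _ _ (\sum_i (tau L ^+ 2 + b 0 i ^+ 2) / 2)).
  apply: ler_sum => i _; apply: le_trans (abs_sqr i (tau_gt0 L)).
  by rewrite ler_wpM2l ?(ltW (tau_gt0 _)) // trunc_vec_le.
rewrite -mulr_suml big_split /= sumr_const card_ord -mulr_natl -dot_sqr.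
by move: b1 tauL; lra.
Qed.

End magnitude_levels.

Section one_level.
Variable R : realType.

(** [2 * S / (t * D)] bounds the l1 norm of the sum of two truncations in units of the lattice step,
    so it decides which m matters. With r its ratio to n, the squared threshold is Cs^2 r^-1 r^(2
    eta): the factor r^-1 gives the n t S on the right, and r^(2 eta), at most (4 / (t^2 n))^(2
    eta), pays for D^2. This gain is what eta > 0 buys. *)
Lemma threshold_exists (Cs eta n t S D C3 : R) :
  0 < Cs -> 0 <= eta <= 1 / 4 -> 0 < n -> 0 < t -> 0 <= S -> S <= 2 / t -> 1 <= D ->
  D ^+ 2 * (4 / (t ^+ 2 * n)) `^ (2 * eta) <= C3 ->
  exists (mu : nat) (smu : R),
    [/\ mu%:R <= 2 * S / (t * D) + 1,
        forall m, (mu + 4 <= m)%N -> Cs * (n / m%:R) `^ (1 / 2 - eta) <= smu &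
        (S * smu) ^+ 2 * D <= Cs ^+ 2 * C3 / 2 * n * (t * S)].
Proof.
move=> Cs0 /andP[eta0 eta1] n0 t0 S0 St D1 DC.
have C30 : 0 <= C3 by apply: le_trans DC; rewrite mulr_ge0 ?sqr_ge0 ?powR_ge0.
have p0 : 0 <= 1 / 2 - eta by lra.
have D0 : 0 < D by lra.
have [->|Sn0] := eqVneq S 0.
  exists 0%N, (Cs * n `^ (1 / 2 - eta)); split.
  - by rewrite mulr0 mul0r add0r.
  - move=> m m4; rewrite ler_wpM2l ?(ltW Cs0) // ge0_ler_powR ?nnegrE ?divr_ge0 ?(ltW n0) //.
    rewrite ler_pdivrMr ?ltr0n ?(leq_trans _ m4) // ler_peMr ?(ltW n0) //.
    by rewrite ler1n (leq_trans _ m4).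
  - by rewrite mul0r expr0n /= mul0r !mulr0.
have {Sn0}S0 : 0 < S by rewrite lt0r Sn0.
pose M := 2 * S / (t * D).
have M0 : 0 < M by rewrite divr_gt0 ?mulr_gt0.
pose r := M / n; have r0 : 0 < r by rewrite divr_gt0.
exists (Num.trunc M).+1, (Cs * r^-1 `^ (1 / 2 - eta)); split.
- by have /andP[h _] := truncn_itv (ltW M0); rewrite -natr1 lerD2r.
- move=> m m4; have m0 : (0 < m)%N by apply: leq_trans m4; rewrite addnS.
  rewrite ler_wpM2l ?(ltW Cs0) // ge0_ler_powR ?nnegrE ?divr_ge0 ?invr_ge0 ?(ltW n0) ?(ltW r0) //.
  rewrite /r invfM invrK mulrC ler_pM2r // lef_pV2 ?posrE ?ltr0n //.
  apply: (le_trans (ltW (truncnS_gt M))); rewrite ler_nat; apply: leq_trans m4; exact: leq_addr.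
rewrite exprMn [(Cs * _) ^+ 2]exprMn -[(_ `^ _) ^+ 2]powR_mulrn ?powR_ge0 // -powRrM.
have -> : (1 / 2 - eta) * 2%:R = 1 - 2 * eta by lra.
have rV0 : r^-1 != 0 by rewrite invr_eq0 gt_eqF.
rewrite powRB ?rV0 ?implybT // powRr1 ?invr_ge0 ?(ltW r0) //.
have -> : r^-1 `^ (2 * eta) = (r `^ (2 * eta))^-1.
  by rewrite -powR_inv1 ?(ltW r0) // -powRrM mulN1r powRN.
rewrite invrK.
have -> : S ^+ 2 * (Cs ^+ 2 * (r^-1 * r `^ (2 * eta))) * D =
  Cs ^+ 2 / 2 * n * (t * S) * (D ^+ 2 * r `^ (2 * eta)).
  rewrite /r /M; field; rewrite !gt_eqF //.
have -> : Cs ^+ 2 * C3 / 2 * n * (t * S) = Cs ^+ 2 / 2 * n * (t * S) * C3 by field.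
apply: ler_wpM2l.
  apply: mulr_ge0; last by rewrite mulr_ge0 // ltW.
  by rewrite mulr_ge0 ?divr_ge0 ?sqr_ge0 // ltW.
apply: le_trans DC; apply: ler_wpM2l; first exact: sqr_ge0.
apply: ge0_ler_powR; rewrite ?nnegrE ?(ltW r0) ?divr_ge0 ?mulr_ge0 ?sqr_ge0 ?(ltW n0) ?(ltW t0) //.
rewrite /r /M -mulrA -invfM ler_pdivrMr ?mulr_gt0 //.
have -> : 4 / (t ^+ 2 * n) * (t * D * n) = 2 * (2 / t) * D by field; rewrite !gt_eqF.
have : S <= 2 / t * D by apply: le_trans St _; rewrite ler_peMr // divr_ge0 // ltW.
lra.
Qed.

Section one_matrix.
Variables (N k : nat) (Y : 'M[R]_(N, k)) (rho B2 : R) (s : nat -> R).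
Hypothesis rho0 : 0 <= rho.
Hypothesis rowY : forall i, dot (row i Y) (row i Y) <= rho.
Hypothesis B2P : forall b : 'rV_N, dot (b *m Y) (b *m Y) <= B2 * dot b b.
Hypothesis B2_ge0 : 0 <= B2.
Hypothesis s_ge0 : forall m, 0 <= s m.
Hypothesis HY : few_large_products Y s.

(* With [u, v] two consecutive truncations, |Y(u)|^2 - |Y(v)|^2 is
   <Y(u - v), Y(u + v)>, to which [level_bound] applies with [d = u - v],
   [c = u + v], lattice step [t D] and splitting parameter [g / D]. *)
Lemma level_term (L : nat) (b : 'rV[R]_N) (h : R) (x : nat) (D g smu E : R) (mu : nat) :
  dot b b <= 1 -> 0 < h -> (x <= L)%N -> 0 < D -> 0 < g ->
  let t := tau h x in let S := level_norm L b h x in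
  mu%:R <= 2 * S / (t * D) + 1 ->
  (forall m, (mu + 4 <= m)%N -> s m <= smu) ->
  (S * smu) ^+ 2 * D <= E * (t * S) ->
  (dot (trunc_vec L b h x.+1 *m Y) (trunc_vec L b h x.+1 *m Y) -
  dot (trunc_vec L b h x *m Y) (trunc_vec L b h x *m Y) <=
    8 * g * B2 * D^-1 + (4 * g * rho + E / (4 * g) + 2 * B2 / g) * (t * S)
    + 5 * B2 / (2 * g) * (t ^+ 2 * D))%R.
Proof.
move=> b1 h0 xL D0 g0 t S muP smuP SE.
have t0 : 0 < t := tau_gt0 h0 x.
have S0 : 0 <= S by exact: level_norm_ge0.
set u := trunc_vec L b h x.+1; set v := trunc_vec L b h x.
have -> : dot (u *m Y) (u *m Y) - dot (v *m Y) (v *m Y) =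
   dot ((u - v) *m Y) ((u + v) *m Y).
  by rewrite mulmxBl mulmxDl dotBl !dotDr (dotC (v *m Y) (u *m Y)); ring.
pose w := g / D; have w0 : 0 < w by rewrite divr_gt0.
have lam0 : 0 < t * D by rewrite mulr_gt0.
have dt i : `|(u - v) 0 i| <= t by exact: level_diff_le.
apply: le_trans (level_bound rowY B2P B2_ge0 s_ge0 HY (u + v) w0 lam0 dt smuP) _.
have hd : \sum_i `|(u - v) 0 i| <= S by exact: level_diff_norm1.
have hc : \sum_i `|(u + v) 0 i| <= 2 * S by exact: level_sum_norm1.
have hcc : dot ((u + v) *m Y) ((u + v) *m Y) <= 4 * B2.
  apply: le_trans (B2P _) _; rewrite mulrC; apply: ler_wpM2r => //.
  exact: level_sum_sqr.
have smu0 : 0 <= smu by apply: le_trans (s_ge0 (mu + 4)) (smuP _ _).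
set d1 := \sum_i _ in hd *; set c1 := \sum_i _ in hc *.
have d0 : 0 <= d1 by exact: sumr_ge0.
have e1 : (d1 * smu) ^+ 2 / (4 * w) <= E / (4 * g) * (t * S).
  have -> : (d1 * smu) ^+ 2 / (4 * w) = ((d1 * smu) ^+ 2 * D) / (4 * g).
    by rewrite /w; field; rewrite !gt_eqF.
  rewrite [leRHS]mulrAC; apply: ler_wpM2r; first by rewrite invr_ge0; lra.
  apply: le_trans SE; apply: ler_wpM2r; first exact: ltW.
  by rewrite lerXn2r ?nnegrE ?mulr_ge0 // ler_wpM2r.
have e2 : 2 * w * (dot ((u + v) *m Y) ((u + v) *m Y) + t * D * rho * c1) <=
   8 * g * B2 * D^-1 + 4 * g * rho * (t * S).
  apply: (@le_trans _ _ (2 * w * (4 * B2 + t * D * rho * (2 * S)))).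
    apply: ler_wpM2l; first by rewrite mulr_ge0 // ltW.
    apply: lerD => //; apply: ler_wpM2l => //.
    by rewrite mulr_ge0 // ltW.
  by rewrite /w le_eqVlt; apply/orP; left; apply/eqP; field; rewrite !gt_eqF.
have e3 : B2 * t ^+ 2 / (2 * w) * (c1 / (t * D) + (mu + 4)%:R) <=
   2 * B2 / g * (t * S) + 5 * B2 / (2 * g) * (t ^+ 2 * D).
  apply: (@le_trans _ _ (B2 * t ^+ 2 / (2 * w) * (2 * S / (t * D) + (2 * S / (t * D) + 5)))).
    apply: ler_wpM2l.
      apply: divr_ge0; first by apply: mulr_ge0; [|exact: sqr_ge0].
      by apply: mulr_ge0; [|exact: ltW].
    apply: lerD; last by rewrite natrD; lra.
    by rewrite ler_wpM2r // invr_ge0 ltW.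
  by rewrite /w le_eqVlt; apply/orP; left; apply/eqP; field; rewrite !gt_eqF.
lra.
Qed.

End one_matrix.
End one_level.

Section all_levels.
Variable R : realType.

Lemma log4_exists n : (0 < n)%N -> exists L, (n <= 4 ^ L <= 4 * n)%N.
Proof.
move=> n0; have [n1|n1] := leqP n 1; first by exists 0%N; rewrite expn0 n1 muln_gt0 n0.
have /andP[h1 h2] := @up_log_bounds 4 n isT n1; exists (up_log 4 n).
rewrite h2 /=; move: h1 h2; case: (up_log 4 n) => [|L] /= h1 h2; first by rewrite expn0 muln_gt0 n0.
by rewrite expnS leq_mul2l ltnW.
Qed.

Lemma powR_exprn (a r : R) m : 0 <= a -> (a ^+ m) `^ r = (a `^ r) ^+ m.
Proof.
by move=> a0; rewrite -powR_mulrn // -powRrM mulrC powRrM powR_mulrn // powR_ge0.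
Qed.

Lemma half_powR_itv (eta : R) : 0 < eta <= 1 / 4 -> 1 / 2 <= 2^-1 `^ (2 * eta) < 1.
Proof.
move=> /andP[e0 e1]; apply/andP; split.
  rewrite mul1r -[leLHS]powRr1 ?invr_ge0 //; apply: ger_powR; last by lra.
  by rewrite invr_gt0 ltr0n /= invf_le1 // ler1n.
rewrite /powR invr_eq0 pnatr_eq0 /= expR_lt1.
have : ln (2^-1 : R) < 0 by apply: ln_lt0; rewrite invr_gt0 ltr0n /= invf_lt1 // ltr1n.
by move=> ?; nra.
Qed.

(* The relative lattice step at level [x]: large enough in the middle for the
   reciprocals to have a small sum, small enough at both ends for [tau^2 tent]
   to be summable and for [tent_threshold]. *)
Definition tent (K0 q : R) (L x : nat) : R := K0 * q^-1 ^+ minn x (L - x).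

Section tent.
Variables (K0 q : R) (L : nat).
Hypothesis K0_ge1 : 1 <= K0.
Hypothesis q_half : 1 / 2 <= q.
Hypothesis q_lt1 : q < 1.

Let q0 : 0 < q. Proof. by move: q_half; lra. Qed.
Let q1 : 1 <= q^-1. Proof. by rewrite invf_ge1 // ltW. Qed.
Let K00 : 0 < K0. Proof. by move: K0_ge1; lra. Qed.

Lemma tent_ge1 x : 1 <= tent K0 q L x.
Proof. by rewrite /tent mulr_ege1 // exprn_ege1. Qed.

Lemma tent_lel x : tent K0 q L x <= K0 * q^-1 ^+ x.
Proof. by rewrite ler_pM2l // ler_weXn2l // geq_minl. Qed.

Lemma tent_ler x : tent K0 q L x <= K0 * q^-1 ^+ (L - x).
Proof. by rewrite ler_pM2l // ler_weXn2l // geq_minr. Qed.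

Lemma sum_tentV : \sum_(x < L.+1) (tent K0 q L x)^-1 <= 2 / (K0 * (1 - q)).
Proof.
have qV : 1 < q^-1 by rewrite invf_gt1.
have h : \sum_(x < L.+1) q ^+ x <= (1 - q)^-1.
  by have := sum_geomV L.+1 qV; rewrite invrK.
apply: (@le_trans _ _ (\sum_(x < L.+1) K0^-1 * (q ^+ x + q ^+ (L - x)))).
  apply: ler_sum => x _; rewrite /tent invfM exprVn invrK ler_pM2l ?invr_gt0 //.
  rewrite /minn; case: ifP => _; [rewrite lerDl|rewrite lerDr]; exact/exprn_ge0/ltW.
rewrite -mulr_sumr big_split /=.
have -> : \sum_(x < L.+1) q ^+ (L - x) = \sum_(x < L.+1) q ^+ x.
  by rewrite (reindex_inj rev_ord_inj) /=; apply: eq_bigr => x _; rewrite subSS subKn // -ltnS.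
rewrite invfM mulrA [X in _ <= X * _]mulrC -mulrA ler_pM2l ?invr_gt0 //; move: h; lra.
Qed.

Lemma sum_tau2_tent (h : R) : 0 <= h ->
  \sum_(x < L.+1) tau h x ^+ 2 * tent K0 q L x <= 2 * (h ^+ 2 * K0).
Proof.
move=> h0; apply: le_trans (sum_geom2 L.+1 (_ : 0 <= h ^+ 2 * K0)); last first.
  by rewrite mulr_ge0 ?sqr_ge0 // ltW.
apply: ler_sum => x _; apply: (@le_trans _ _ (tau h x ^+ 2 * (K0 * q^-1 ^+ x))).
  by rewrite ler_wpM2l ?sqr_ge0 // tent_lel.
have -> : tau h x ^+ 2 * (K0 * q^-1 ^+ x) = h ^+ 2 * K0 * (2^-1 ^+ x * (2^-1 * q^-1) ^+ x).
  by rewrite /tau !exprMn; ring.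
apply: ler_wpM2l; first by rewrite mulr_ge0 ?sqr_ge0 // ltW.
rewrite ler_piMr ?exprn_ge0 ?invr_ge0 // exprn_ile1 ?mulr_ge0 ?invr_ge0 ?(ltW q0) //.
by rewrite -invfM invf_le1; move: q_half; lra.
Qed.

End tent.

(** The ratio q = 2^(-2 eta) is made for this cancellation: as 4^L <= 4 n, the base is at most (16 /
    h^2) 4^-(L - x), whose power 2 eta contains q^(2 (L - x)), while the squared tent is at most
    K0^2 q^(-2 (L - x)). *)
Lemma tent_threshold (K0 h eta n : R) (L x : nat) :
  1 <= K0 -> 0 < h -> h <= 1 -> 0 < eta <= 1 / 4 -> 0 < n -> 4 ^+ L <= 4 * n ->
  (x <= L)%N ->
  tent K0 (2^-1 `^ (2 * eta)) L x ^+ 2 * (4 / (tau h x ^+ 2 * n)) `^ (2 * eta) <=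
  16 * K0 ^+ 2 / h ^+ 2.
Proof.
move=> K1 h0 h1 he n0 nL xL; have /andP[e0 e1] := he.
have /andP[q1 q2] := half_powR_itv he; set q := 2^-1 `^ _ in q1 q2 *.
have q0 : 0 < q by lra.
have K00 : 0 < K0 by lra.
have A1 : 1 <= 16 / h ^+ 2.
  rewrite ler_pdivlMr ?exprn_gt0 // mul1r (le_trans (_ : _ <= 1)) //; last by lra.
  by rewrite exprn_ile1 // ltW.
apply: (@le_trans _ _ ((K0 * q^-1 ^+ (L - x)) ^+ 2 * (16 / h ^+ 2 * q ^+ (L - x) ^+ 2))); last first.
  have E : q^-1 ^+ (L - x) * q ^+ (L - x) = 1 by rewrite -exprMn mulVf ?expr1n ?gt_eqF.
  have -> : (K0 * q^-1 ^+ (L - x)) ^+ 2 * (16 / h ^+ 2 * q ^+ (L - x) ^+ 2) =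
    16 * K0 ^+ 2 / h ^+ 2 * (q^-1 ^+ (L - x) * q ^+ (L - x)) ^+ 2 by ring.
  by rewrite E expr1n mulr1.
apply: ler_pM.
- exact: sqr_ge0.
- exact: powR_ge0.
- rewrite lerXn2r ?nnegrE ?mulr_ge0 ?exprn_ge0 ?invr_ge0 ?(ltW q0) ?(ltW K00) //.
  by apply: tent_ler.
have -> : q ^+ (L - x) ^+ 2 = ((2^-1 ^+ (L - x)) ^+ 2) `^ (2 * eta).
  by rewrite /q !powR_exprn ?exprn_ge0 ?invr_ge0.
apply: (@le_trans _ _ ((16 / h ^+ 2 * (2^-1 ^+ (L - x)) ^+ 2) `^ (2 * eta))).
  apply: ge0_ler_powR; first by lra.
  - by rewrite nnegrE divr_ge0 // mulr_ge0 ?sqr_ge0 // ltW.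
  - by rewrite nnegrE mulr_ge0 ?sqr_ge0 //; lra.
  have t0 : 0 < tau h x := tau_gt0 h0 x.
  rewrite ler_pdivrMr; last by rewrite (mulr_gt0 (exprn_gt0 2 t0) n0).
  have E : 2^-1 ^+ (L - x) * 2^-1 ^+ x = (2 ^+ L)^-1 :> R.
    by rewrite -exprD subnK // exprVn.
  have -> : 16 / h ^+ 2 * (2^-1 ^+ (L - x)) ^+ 2 * (tau h x ^+ 2 * n) =
    16 * (2^-1 ^+ (L - x) * 2^-1 ^+ x) ^+ 2 * n by rewrite /tau; field; rewrite gt_eqF.
  rewrite E exprVn -exprM mulnC exprM mulrAC ler_pdivlMr ?exprn_gt0 ?mulr_gt0 //.
  by move: nL; rewrite -[2 ^+ 2]/(2 * 2) -natrM; lra.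
rewrite powRM ?sqr_ge0 //; last by lra.
apply: ler_wpM2r; first exact: powR_ge0.
by apply: ler1_powR => //; lra.
Qed.

Theorem few_large_products_bound (delta Cs eta : R) :
  0 <= delta -> 0 < Cs -> 0 < eta <= 1 / 4 ->
  exists2 C : R, 0 < C & forall (N k n : nat) (Y : 'M[R]_(N, k)),
    (0 < n)%N -> (N <= n)%N ->
    (forall i, dot (row i Y) (row i Y) <= delta * n%:R) ->
    few_large_products Y (fun m => Cs * (n%:R / m%:R) `^ (1 / 2 - eta)) ->
    forall b : 'rV_N, dot (b *m Y) (b *m Y) <= C * n%:R * dot b b.
Proof.
move=> delta0 Cs0 he; have /andP[e0 e1] := he.
have /andP[q1 q2] := half_powR_itv he; set q := 2^-1 `^ _ in q1 q2.
(* [g] and [K0] are such that the three sums below add at most [B2 / 8] in total. *)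
pose g : R := 240; pose K0 := (16 * 240 * 24) / (1 - q); pose h := K0^-1.
have g0 : 0 < g by rewrite /g ltr0n.
have g0' := ltW g0.
have K1 : (16 * 240 * 24) <= K0 by rewrite ler_pdivlMr; lra.
have K00 : 0 < K0 by lra.
have h0 : 0 < h by rewrite invr_gt0.
have h1 : h <= 1 by rewrite invf_le1; lra.
pose C3 := 16 * K0 ^+ 2 / h ^+ 2.
have C30 : 0 <= C3 by apply: divr_ge0; [apply: mulr_ge0; [exact: ler0n|exact: sqr_ge0]|exact: sqr_ge0].
pose E := Cs ^+ 2 * C3 / 2.
have E0 : 0 <= E by rewrite /E; apply: divr_ge0 => //; rewrite mulr_ge0 ?sqr_ge0.
pose F := 2 * (delta / h ^+ 2) + 2 * ((4 * g * delta + E / (4 * g)) * 5) + 1.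
have dh0 : 0 <= delta / h ^+ 2 by rewrite divr_ge0 ?sqr_ge0.
have F0 : 0 < F by rewrite /F /g; lra.
exists (4 / 3 * F); first by lra.
move=> N k n Y n0 Nn rowY HY.
have nR : 0 < n%:R :> R by rewrite ltr0n.
suff H : forall b : 'rV_N, dot (b *m Y) (b *m Y) <= 4 / 3 * (F * n%:R) * dot b b.
  by move=> b; rewrite -[4 / 3 * F * _]mulrA.
apply: (contraction_bound rowY); first by rewrite mulr_ge0 // ltW.
move=> B2 B20 B2P b b1.
(* The lower bound on 4^L makes the entries of the last level negligible ([NL]); the upper bound is
   the one used by [tent_threshold]. *)
have [L /andP[L1 L2]] := log4_exists n0.
have L2' : 4 ^+ L <= 4 * n%:R :> R by rewrite -natrX -natrM ler_nat.
have NL : N%:R * (2^-1 ^+ L) ^+ 2 <= 1 :> R.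
  rewrite -exprM mulnC exprM exprVn exprVn -[2 ^+ 2]/(2 * 2) ler_pdivrMr ?exprn_gt0 ?mulr_gt0 //.
  by rewrite mul1r -natrM -natrX ler_nat (leq_trans Nn).
pose u := trunc_vec L b h L.+1.
(* The entries above [h] have l1 norm at most 1/h, so for them the bound on the rows is enough; the
   levels treat only the others. *)
pose v : 'rV[R]_N := \row_i if `|b 0 i| <= h then 0 else b 0 i.
have bE : b = v + u.
  apply/rowP => i; rewrite mxE trunc_vecS mxE /level_set eqxx orTb andbT.
  by case: ifP; rewrite ?add0r ?addr0.
rewrite bE mulmxDl; apply: le_trans (dotD2 _ _) _.
have hv : dot (v *m Y) (v *m Y) <= delta / h ^+ 2 * n%:R.
  apply: le_trans (dot_mulmx_le_norm1 rowY v) _.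
  rewrite [leRHS]mulrAC; apply: ler_wpM2l; first by rewrite mulr_ge0 // ltW.
  rewrite -exprVn lerXn2r ?nnegrE ?sumr_ge0 ?invr_ge0 ?(ltW h0) ?(ltW K00) //.
  apply: (@le_trans _ _ (h^-1 * dot b b)); last by rewrite ler_piMr // invr_ge0 ltW.
  rewrite dot_sqr mulr_sumr; apply: ler_sum => i _; rewrite mxE; case: ifPn => bh.
    by rewrite normr0 mulr_ge0 ?sqr_ge0 // invr_ge0 ltW.
  rewrite -ltNge in bh; rewrite mulrC ler_pdivlMr // -[b 0 i ^+ 2]real_normK ?num_real // expr2.
  by rewrite ler_wpM2l // ltW.
pose D x := tent K0 q L x.
pose t x := tau h x; pose S x := level_norm L b h x.
pose T x : R :=
    8 * g * B2 * (D x)^-1 + (4 * g * (delta * n%:R) + E * n%:R / (4 * g) + 2 * B2 / g) * (t x * S x)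
    + 5 * B2 / (2 * g) * (t x ^+ 2 * D x).
have term (x : nat) : (x <= L)%N ->
  dot (trunc_vec L b h x.+1 *m Y) (trunc_vec L b h x.+1 *m Y) -
  dot (trunc_vec L b h x *m Y) (trunc_vec L b h x *m Y) <=
    T x.
  move=> xL; have t0 : 0 < t x := tau_gt0 h0 x.
  have D1 : 1 <= D x by apply: tent_ge1 => //; lra.
  have /threshold_exists H : Cs > 0 by [].
  have [|||||||mu [smu [h2 h3 h4]]] := H eta n%:R (t x) (S x) (D x) C3.
  - by rewrite (ltW e0).
  - by [].
  - by [].
  - exact: level_norm_ge0.
  - exact: level_norm_le.
  - by [].
  - by apply: tent_threshold => //; lra.
  apply: (level_term _ rowY B2P B20 _ HY b1 h0 xL _ _ h2 h3 h4) => //; try lra.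
  - by rewrite mulr_ge0 // ltW.
  - by move=> m; rewrite mulr_ge0 ?powR_ge0 // ltW.
have hu : dot (u *m Y) (u *m Y) <=
    8 * g * B2 * (2 / (K0 * (1 - q))) + (4 * g * (delta * n%:R) + E * n%:R / (4 * g) + 2 * B2 / g) * 5
    + 5 * B2 / (2 * g) * (2 * (h ^+ 2 * K0)).
  have := @telescope_sumr R 0 L.+1 (fun x => dot (trunc_vec L b h x *m Y) (trunc_vec L b h x *m Y)) isT.
  rewrite [trunc_vec L b h 0]/= mul0mx dot0l subr0 -/u => <-.
  rewrite big_mkord; apply: (@le_trans _ _ (\sum_(x < L.+1) T x)).
    by apply: ler_sum => x _; apply: term; exact: leq_ord.
  rewrite /T.
  rewrite !big_split /= -!mulr_sumr; apply: lerD; first apply: lerD.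
  - apply: ler_wpM2l; last by apply: sum_tentV => //; lra.
    by apply: mulr_ge0 => //; apply: mulr_ge0.
  - apply: ler_wpM2l; last exact: sum_level_mass.
    have n0' := ltW nR.
    have w1 : 0 <= 4 * g * (delta * n%:R) by apply: mulr_ge0; apply: mulr_ge0.
    have w2 : 0 <= E * n%:R / (4 * g) by apply: divr_ge0; apply: mulr_ge0.
    have w3 : 0 <= 2 * B2 / g by apply: divr_ge0 => //; apply: mulr_ge0.
    by apply: addr_ge0 => //; apply: addr_ge0.
  - apply: ler_wpM2l; first by apply: divr_ge0; apply: mulr_ge0.
    by apply: sum_tau2_tent; lra.
have e2 : K0 * (1 - q) = (16 * 240 * 24) by rewrite /K0 divfK //; lra.
have e3 : h ^+ 2 * K0 <= 1.
  by rewrite expr2 -mulrA mulVf ?gt_eqF // mulr1.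
have e4 : 5 * B2 / (2 * g) * (2 * (h ^+ 2 * K0)) <= B2 / 48.
  have -> : 5 * B2 / (2 * g) * (2 * (h ^+ 2 * K0)) = B2 / 48 * (h ^+ 2 * K0) by rewrite /g; field.
  by rewrite ler_piMr // divr_ge0.
move: hv hu; rewrite e2 /F /g in e4 *; set X := h ^+ 2 * K0 in e4 *.
set Z := dot _ _; set W := dot _ _; set V := delta / h ^+ 2; nra.
Qed.

End all_levels.

(** * Lower bound from lattice points *)

Section quadratic.
Variables (R : realType) (N k : nat) (Y : 'M[R]_(N, k)).

(** A matrix and its transpose have the same norm: for b_i = <Y_i, v> the left-hand side is both
    |b|^2 and <Y(b), v>, and [dot_amgm] absorbs half of it. *)
Lemma dual_bound (C : R) : 0 < C ->
  (forall b : 'rV_N, dot (b *m Y) (b *m Y) <= C * dot b b) ->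
  forall v : 'rV_k, \sum_i dot (row i Y) v ^+ 2 <= C * dot v v.
Proof.
move=> C0 H v; pose b : 'rV[R]_N := \row_i dot (row i Y) v.
have E : \sum_i dot (row i Y) v ^+ 2 = dot b b.
  by rewrite dot_sqr; apply: eq_bigr => i _; rewrite mxE.
have E' : dot (b *m Y) v = dot b b.
  by rewrite dot_mulmx -E; apply: eq_bigr => i _; rewrite mxE expr2.
have C2 : 0 < C / 2 by lra.
have := @dot_amgm _ _ (C / 2) (b *m Y) v C2; rewrite E E'.
have : dot (b *m Y) (b *m Y) / (4 * (C / 2)) <= dot b b / 2.
  rewrite ler_pdivrMr; last by lra.
  by have := H b; lra.
lra.
Qed.

Lemma lattice_lower_bound : (0 < k)%N ->
  (forall z : 'I_k -> int, (\sum_j `|z j| <= 3 * k)%N ->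
     3 / 8 * N%:R * dot (int_row R z) (int_row R z) <=
     \sum_i dot (row i Y) (int_row R z) ^+ 2) ->
  \sum_i dot (row i Y) (row i Y) <= 2 * k%:R * N%:R ->
  forall v : 'rV_k, N%:R / 4 * dot v v <= \sum_i dot (row i Y) v ^+ 2.
Proof.
move=> k0 Hz Htr.
suff H (v : 'rV[R]_k) : dot v v = 1 -> N%:R / 4 <= \sum_i dot (row i Y) v ^+ 2.
  move=> v; have [/dot_eq0->|v0] := eqVneq (dot v v) 0.
    by rewrite dot0l mulr0; apply: sumr_ge0 => i _; exact: sqr_ge0.
  have vp : 0 < dot v v by rewrite lt0r v0 dot_ge0.
  pose n := Num.sqrt (dot v v); have n2 : n ^+ 2 = dot v v by rewrite sqr_sqrtr ?dot_ge0.
  have /H : dot (n^-1 *: v) (n^-1 *: v) = 1 by rewrite dotZZ exprVn n2 mulVf.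
  under eq_bigr do rewrite dotZr exprMn exprVn n2.
  by rewrite -mulr_sumr [leRHS]mulrC ler_pdivlMr.
move=> v1; pose r := Num.sqrt (k%:R : R).
have kR : 0 < k%:R :> R by rewrite ltr0n.
have r0 : 0 < r by rewrite sqrtr_gt0.
have r2 : r ^+ 2 = k%:R by rewrite sqr_sqrtr ?ler0n.
pose lam := (2 * r)^-1; have lam0 : 0 < lam by rewrite invr_gt0 mulr_gt0.
have lam2 : lam ^+ 2 = (4 * k%:R)^-1 by rewrite /lam exprVn exprMn r2 -natrX.
(* By homogeneity [Q] is nonnegative at every admissible lattice vector, and rounding [v] raises it
   by at most N/8. Hence Q(v) >= - N/8, which is the claim. *)
pose Q (x : 'rV[R]_k) := \sum_i dot (row i Y) x ^+ 2 - 3 / 8 * N%:R * dot x x.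
pose q1 (x : 'rV[R]_k) j := \sum_i 2 * (dot (row i Y) x * Y i j) - 3 / 4 * N%:R * x 0 j.
pose q2 j := \sum_i Y i j ^+ 2 - 3 / 8 * N%:R.
have dot_delta (u : 'rV[R]_k) j : dot u (delta_mx 0 j) = u 0 j.
  rewrite /dot (bigD1 j) //= mxE !eqxx mulr1 big1 ?addr0 // => a /negbTE aj.
  by rewrite mxE aj andbF mulr0.
have dot_delta2 j : dot (delta_mx 0 j : 'rV[R]_k) (delta_mx 0 j) = 1.
  by rewrite dot_delta mxE !eqxx.
have QE x j t : Q (x + t *: delta_mx 0 j) = Q x + t * q1 x j + t ^+ 2 * q2 j.
  have E : \sum_i dot (row i Y) (x + t *: delta_mx 0 j) ^+ 2 =
      \sum_i dot (row i Y) x ^+ 2 + t * (\sum_i 2 * (dot (row i Y) x * Y i j))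
      + t ^+ 2 * \sum_i Y i j ^+ 2.
    rewrite [X in _ + X + _]mulr_sumr [X in _ = _ + X]mulr_sumr -!big_split /=.
    by apply: eq_bigr => i _; rewrite dotDr dotZr dot_delta mxE; ring.
  rewrite /Q /q1 /q2 E dotDl !dotDr !dotZl !dotZr (dotC (delta_mx 0 j) x).
  rewrite dot_delta2 !dot_delta.
  by field.
(* No weight on the l1 norm here: [|z j| <= 2 sqrt k |v j| + 1] already gives a total of at most 3
   k, since 2 sqrt k |v_j| <= 1 + k v_j^2. *)
have [z [w [wP zP]]] := round_quadratic 0 lam0 QE v.
rewrite !mul0r !addr0 -/(int_row R z).
have zk : (\sum_j `|z j| <= 3 * k)%N.
  rewrite -(ler_nat R) natr_sum natrM.
  apply: (@le_trans _ _ (\sum_j (2 * (r * `|v 0 j|) + 1))).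
    apply: ler_sum => j _; apply: le_trans (zP j) _.
    by rewrite /lam invrK; lra.
  rewrite big_split /= sumr_const card_ord -[1 *+ k]/(k%:R) -mulr_sumr.
  have : \sum_j r * `|v 0 j| <= \sum_j (1 + k%:R * v 0 j ^+ 2) / 2.
    apply: ler_sum => j _; have := sqr_ge0 (1 - r * `|v 0 j|).
    by rewrite sqrrB expr1n exprMn r2 real_normK ?num_real // -mulr_natr; lra.
  rewrite -mulr_suml big_split /= sumr_const card_ord -[1 *+ k]/(k%:R).
  rewrite -!mulr_sumr -dot_sqr v1; lra.
have hz := Hz z zk.
have Qz : 0 <= Q (lam *: int_row R z).
  rewrite /Q dotZZ; under eq_bigr do rewrite dotZr exprMn.
  by rewrite -mulr_sumr subr_ge0 mulrCA ler_wpM2l // sqr_ge0.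
have : \sum_j w j * q2 j <= N%:R / 8.
  apply: (@le_trans _ _ (\sum_j lam ^+ 2 / 4 * \sum_i Y i j ^+ 2)).
    apply: ler_sum => j _; have [w0 w1 _] := wP j.
    have y0 : 0 <= \sum_i Y i j ^+ 2 by apply: sumr_ge0 => i _; exact: sqr_ge0.
    apply: (@le_trans _ _ (w j * \sum_i Y i j ^+ 2)); last exact: ler_wpM2r.
    apply: ler_wpM2l => //; rewrite /q2 gerBl; have := ler0n R N; lra.
  rewrite -mulr_sumr exchange_big /=.
  rewrite (eq_bigr (fun i => dot (row i Y) (row i Y))); last first.
    by move=> i _; rewrite dot_sqr; apply: eq_bigr => j _; rewrite mxE.
  apply: (@le_trans _ _ (lam ^+ 2 / 4 * (2 * k%:R * N%:R))).
    by apply: ler_wpM2l => //; rewrite divr_ge0 ?sqr_ge0.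
  by rewrite lam2 le_eqVlt; apply/orP; left; apply/eqP; field; rewrite gt_eqF.
rewrite {2}/Q v1; lra.
Qed.

End quadratic.

(** * Counting *)

Section counting.
Variable R : realType.

(** The constant is the maximum of x^eps e^(- a x), attained at x = eps / a. *)
Lemma powR_le_expR (eps a : R) : 0 < eps -> 0 < a ->
  forall x, 0 < x -> x `^ eps <= expR (- eps - eps * ln (a / eps)) * expR (a * x).
Proof.
move=> e0 a0 x x0; rewrite /powR gt_eqF // -expRD ler_expR.
have ae0 : 0 < a / eps by rewrite divr_gt0.
have := le_ln1Dx (_ : -1 < a / eps * x - 1).
rewrite addrCA subrr addr0 lnM ?posrE // => /(_ _) h.
have {h} : ln (a / eps) + ln x <= a / eps * x - 1 by apply: h; nra.
rewrite -(ler_pM2l e0) => h.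
have E : eps * (a / eps * x - 1) = a * x - eps by field; rewrite gt_eqF.
by rewrite E in h; lra.
Qed.

Lemma expR_quarter : expR (1 / 4 : R) <= 4 / 3.
Proof.
have h := expR_ge1Dx (- (1 / 4) : R).
have e0 : 0 < expR (1 / 4 : R) := expR_gt0 _.
rewrite expRN in h.
have : (1 - 1 / 4) * expR (1 / 4) <= 1 :> R.
  by rewrite -(ler_pM2r e0) mulVf ?gt_eqF // in h.
lra.
Qed.

Lemma one_add_expn_le (x : R) N : 0 <= x -> (1 + x) ^+ N <= expR (x * N%:R).
Proof.
move=> x0; rewrite mulrC expRM_natl lerXn2r ?nnegrE ?expR_ge0 ?expR_ge1Dx //; lra.
Qed.

(** Generating function: expand the power into a sum over all functions; each one counted
    contributes at least x^m, as x <= 1. *)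
Lemma card_weight_le (I A : finType) (wt : A -> nat) (m : nat) (x : R) :
  0 <= x <= 1 ->
  #|[set f : {ffun I -> A} | (\sum_i wt (f i) <= m)%N]%SET|%:R * x ^+ m <=
  (\sum_a x ^+ wt a) ^+ #|I|.
Proof.
move=> /andP[x0 x1].
have -> : (\sum_a x ^+ wt a) ^+ #|I| = \prod_(i : I) \sum_a x ^+ wt a.
  by rewrite prodr_const.
rewrite (bigA_distr_bigA (fun (_ : I) a => x ^+ wt a)).
rewrite mulr_natl -sumr_const big_mkcond /=; apply: ler_sum => f _.
have p0 : 0 <= \prod_i x ^+ wt (f i) by apply: prodr_ge0 => i _; exact: exprn_ge0.
rewrite inE; case: ifP => // h.
by rewrite -expr_sum ler_wiXn2l.
Qed.

(* The integers of absolute value at most [m], as a finite type. *)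
Definition code m := option (bool * 'I_m).
Definition code_wt m (a : code m) : nat := if a is Some (_, i) then i.+1 else 0%N.
Definition decode m (a : code m) : int :=
  if a is Some (s, i) then (if s then - (i.+1)%:Z else (i.+1)%:Z) else 0.

Lemma absz_decode m (a : code m) : `|decode a|%N = code_wt a.
Proof. by case: a => [[[] i]|]. Qed.

Lemma decode_surj m (z : int) : (`|z| <= m)%N -> exists a : code m, decode a = z.
Proof.
case: z => [[|n]|n] /= h.
- by exists None.
- by exists (Some (false, Ordinal h)).
- by exists (Some (true, Ordinal h)).
Qed.

Lemma sum_code_wt m (x : R) : 0 <= x <= 1 / 2 -> \sum_(a : code m) x ^+ code_wt a <= 1 + 4 * x.
Proof.
move=> /andP[x0 x1].
have -> : \sum_(a : code m) x ^+ code_wt a = 1 + 2 * \sum_(i < m) x ^+ i.+1.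
  rewrite (bigID (fun a : code m => a == None)) /= big_pred1_eq expr0; congr (_ + _).
  rewrite (reindex_omap Some id) /=; last by case.
  rewrite (eq_bigl xpredT); last by move=> [s i]; rewrite /= eqxx.
  rewrite (eq_bigr (fun p : bool * 'I_m => x ^+ p.2.+1)); last by case.
  rewrite -(pair_bigA _ (fun (s : bool) (i : 'I_m) => x ^+ i.+1)) /=.
  by rewrite big_bool /= mulr2n mulrDl !mul1r.
rewrite lerD2l -[4]/(2 * 2)%N%:R natrM -mulrA ler_pM2l //.
apply: (@le_trans _ _ (x * \sum_(i < m) 1 * 2^-1 ^+ i)).
  rewrite mulr_sumr; apply: ler_sum => i _; rewrite exprS mul1r ler_wpM2l //.
  by rewrite lerXn2r ?nnegrE ?invr_ge0 //; lra.
rewrite mulrC ler_wpM2r //; have := @sum_geom2 R 1 m ler01; lra.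
Qed.

Lemma card_code_le (k m : nat) (x : R) : 0 < x <= 1 / 2 ->
  #|[set f : {ffun 'I_k -> code m} | (\sum_i code_wt (f i) <= m)%N]%SET|%:R <=
  x^-1 ^+ m * (1 + 4 * x) ^+ k.
Proof.
move=> /andP[x0 x1]; rewrite exprVn mulrC ler_pdivlMr ?exprn_gt0 //.
have hx : 0 <= x <= 1 by apply/andP; split; lra.
apply: le_trans (card_weight_le 'I_k (@code_wt m) m hx) _.
have h0 : 0 <= \sum_(a : code m) x ^+ code_wt a.
  by apply: sumr_ge0 => a _; rewrite exprn_ge0 // ltW.
rewrite card_ord lerXn2r ?nnegrE //; first by lra.
by apply: sum_code_wt; apply/andP; split; lra.
Qed.

Lemma bin_le (N m : nat) (y : R) : 0 < y -> 'C(N, m)%:R <= y^-1 ^+ m * (1 + y) ^+ N.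
Proof.
move=> y0; rewrite exprVn mulrC ler_pdivlMr ?exprn_gt0 //.
have [mN|mN] := leqP m N; last first.
  by rewrite bin_small // mul0r exprn_ge0 //; lra.
rewrite exprDn (bigD1 (Ordinal (mN : (m < N.+1)%N))) //= expr1n mul1r -[y ^+ m *+ _]mulr_natl lerDl.
by apply: sumr_ge0 => i _; rewrite expr1n mul1r -[leRHS]mulr_natl mulr_ge0 // exprn_ge0 // ltW.
Qed.

(* There are at most [(union_const (n/m)^2)^m] pairs of an integer vector of l1
   norm at most [m] and a set of [m] rows. The exponent solves
   [(1/2 - level_exponent) (4 + eps) = 2 + eps/4], which beats this number. *)
Definition union_const : R := 2 * expR 3.
Definition level_const (kappa : R) : R := 2 * union_const * kappa.
Definition level_exponent (eps : R) : R := eps / (4 * (4 + eps)).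
Definition level_threshold (kappa eps : R) (n m : nat) : R :=
  level_const kappa * (n%:R / m%:R) `^ (1 / 2 - level_exponent eps).

Let union_const_ge1 : 1 <= union_const.
Proof. by have := @expR_ge1Dx R 3; rewrite /union_const; lra. Qed.

Lemma level_threshold_gt0 (kappa eps : R) (n m : nat) : 0 < kappa -> (0 < n)%N -> (0 < m)%N ->
  0 < level_threshold kappa eps n m.
Proof.
move=> k0 n0 m0; rewrite /level_threshold mulr_gt0 ?powR_gt0 ?divr_gt0 ?ltr0n //.
by rewrite /level_const; have := union_const_ge1; move=> ?; rewrite mulr_gt0 //; lra.
Qed.

(** With r = m/n, the counting bounds at x = r/2 and y = r give (2/r)^m e^(2m) vectors and (1/r)^m
    e^m sets of rows, together (A / r^2)^m for A = [union_const]. The probability is at most ((2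
    A)^-1 r^(2 + eps/4))^m. What remains is 2^-m r^(eps m / 4), and m >= 4. *)
Lemma union_term_le (kappa eps : R) (n N m : nat) :
  1 <= kappa -> 0 < eps -> (0 < n)%N -> (N <= n)%N -> (4 <= m <= N)%N ->
  #|[set f : {ffun 'I_N -> code m} | (\sum_i code_wt (f i) <= m)%N]%SET|%:R * 'C(N, m)%:R *
    ((kappa / level_threshold kappa eps n m) `^ (4 + eps)) ^+ m <=
  2^-1 ^+ m * (m%:R / n%:R) `^ eps.
Proof.
move=> kappa1 eps0 n0 Nn /andP[m4 mN].
have nR : 0 < n%:R :> R by rewrite ltr0n.
have mR : 0 < m%:R :> R by rewrite ltr0n (leq_trans _ m4).
pose r : R := m%:R / n%:R; have r0 : 0 < r by rewrite divr_gt0.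
have r1 : r <= 1 by rewrite ler_pdivrMr // mul1r ler_nat (leq_trans mN).
have rN : r * N%:R <= m%:R.
  rewrite /r mulrAC ler_pdivrMr // ler_wpM2l ?ler_nat // ltW //.
have U1 := union_const_ge1; set A := union_const in U1.
have h1 : #|[set f : {ffun 'I_N -> code m} | (\sum_i code_wt (f i) <= m)%N]%SET|%:R <=
    (2 / r) ^+ m * expR (2 * m%:R).
  have hr : 0 < r / 2 <= 1 / 2 by apply/andP; split; lra.
  apply: le_trans (card_code_le N m hr) _; rewrite invfM invrK [r^-1 * _]mulrC.
  apply: ler_wpM2l; first by rewrite exprn_ge0 // mulr_ge0 // invr_ge0 ltW.
  apply: le_trans (one_add_expn_le N _) _; first by lra.
  by rewrite ler_expR; lra.
have h2 : 'C(N, m)%:R <= r^-1 ^+ m * expR m%:R.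
  apply: le_trans (bin_le N m r0) _.
  apply: ler_wpM2l; first by rewrite exprn_ge0 // invr_ge0 ltW.
  by apply: le_trans (one_add_expn_le N (ltW r0)) _; rewrite ler_expR.
have h3 : #|[set f : {ffun 'I_N -> code m} | (\sum_i code_wt (f i) <= m)%N]%SET|%:R * 'C(N, m)%:R
    <= (A / r ^+ 2) ^+ m.
  apply: le_trans (ler_pM _ _ h1 h2) _; rewrite ?ler0n //.
  rewrite mulrACA -expRD -exprMn.
  have -> : 2 * m%:R + m%:R = 3 * m%:R :> R by lra.
  rewrite mulrC [3 * _]mulrC expRM_natl -exprMn /A /union_const.
  rewrite le_eqVlt; apply/orP; left; apply/eqP; congr (_ ^+ _).
  by field; rewrite gt_eqF.
have e1 : (1 / 2 - level_exponent eps) * (4 + eps) = 2 + eps / 4.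
  by rewrite /level_exponent; field; lra.
have p1 : (kappa / level_threshold kappa eps n m) `^ (4 + eps) <=
    (2 * A)^-1 * (r ^+ 2 * r `^ (eps / 4)).
  have -> : kappa / level_threshold kappa eps n m =
     (2 * A)^-1 * r `^ (1 / 2 - level_exponent eps).
    rewrite /level_threshold /level_const -/A.
    have -> : n%:R / m%:R = r^-1 :> R by rewrite /r invf_div.
    rewrite -[r^-1]powR_inv1 ?(ltW r0) // -powRrM mulN1r powRN.
    have := powR_gt0 (1 / 2 - level_exponent eps) r0.
    by move=> ?; field; rewrite !gt_eqF //; lra.
  rewrite powRM ?invr_ge0 ?powR_ge0 //; last by lra.
  rewrite -powRrM e1 [r `^ (2 + _)]powRD ?(gt_eqF r0) ?implybT // powR_mulrn ?(ltW r0) //.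
  apply: ler_wpM2r; first by rewrite mulr_ge0 ?powR_ge0 ?sqr_ge0.
  apply: ge1r_powR; last by lra.
  by rewrite invr_gt0 invf_le1; lra.
have h4 : (A / r ^+ 2) * ((2 * A)^-1 * (r ^+ 2 * r `^ (eps / 4))) = 2^-1 * r `^ (eps / 4).
  by field; apply/andP; split; rewrite gt_eqF //; lra.
apply: (@le_trans _ _ ((2^-1 * r `^ (eps / 4)) ^+ m)).
  rewrite -h4 exprMn; apply: ler_pM; rewrite ?mulr_ge0 ?ler0n ?exprn_ge0 ?powR_ge0 //.
  rewrite lerXn2r ?nnegrE ?powR_ge0 ?mulr_ge0 ?invr_ge0 ?sqr_ge0 ?powR_ge0 //; lra.
rewrite exprMn -[(_ `^ _) ^+ m]powR_mulrn ?powR_ge0 // -powRrM -/r.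
apply: ler_wpM2l; first by rewrite exprn_ge0 // invr_ge0.
apply: ger_powR; first by rewrite r0.
have : 4 <= m%:R :> R by rewrite ler_nat.
by move=> ?; nra.
Qed.

(** The factor m^eps is O((4/3)^m), by [powR_le_expR] and e^(1/4) <= 4/3. This leaves the series of
    (2/3)^m, whose sum is the 3 in the constant. *)
Lemma union_sum_le (kappa eps : R) : 1 <= kappa -> 0 < eps ->
  exists2 c : R, 0 < c & forall n N : nat, (0 < n)%N -> (N <= n)%N ->
  \sum_(m < N.+1 | (4 <= m)%N)
    #|[set f : {ffun 'I_N -> code m} | (\sum_i code_wt (f i) <= m)%N]%SET|%:R * 'C(N, m)%:R *
    ((kappa / level_threshold kappa eps n m) `^ (4 + eps)) ^+ m <= c / n%:R `^ eps.
Proof.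
move=> kappa1 eps0.
pose C0 := expR (- eps - eps * ln (1 / 4 / eps)); have C00 : 0 < C0 := expR_gt0 _.
exists (3 * C0); first by rewrite mulr_gt0.
move=> n N n0 Nn; have nR : 0 < n%:R :> R by rewrite ltr0n.
apply: (@le_trans _ _ (\sum_(m < N.+1) C0 / n%:R `^ eps * (3 / 2)^-1 ^+ m)); last first.
  rewrite -mulr_sumr; have -> : 3 * C0 / n%:R `^ eps = C0 / n%:R `^ eps * 3 by ring.
  apply: ler_wpM2l; first by rewrite divr_ge0 ?powR_ge0 // ltW.
  have q1 : 1 < 3 / 2 :> R by lra.
  have e3 : 3 = (1 - (3 / 2)^-1)^-1 :> R by field.
  rewrite [leRHS]e3.
  exact: sum_geomV.
rewrite big_mkcond /=; apply: ler_sum => m _.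
case: ifP => m4; last first.
  apply: mulr_ge0; first by rewrite divr_ge0 ?powR_ge0 // ltW.
  by rewrite exprn_ge0 // invr_ge0 divr_ge0.
have mN : (4 <= m <= N)%N by rewrite m4 /= -ltnS.
apply: le_trans (union_term_le kappa1 eps0 n0 Nn mN) _.
have mR : 0 < m%:R :> R by rewrite ltr0n (leq_trans _ m4).
rewrite powRM ?invr_ge0 ?(ltW mR) ?(ltW nR) //.
have q0 : 0 < 1 / 4 :> R by lra.
have := powR_le_expR eps0 q0 mR; rewrite -/C0.
have E : expR (1 / 4 * m%:R) <= (4 / 3) ^+ m :> R.
  by rewrite mulrC expRM_natl lerXn2r ?nnegrE ?expR_ge0 ?expR_quarter //; lra.
have -> : n%:R^-1 `^ eps = (n%:R `^ eps)^-1.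
  by rewrite -powR_inv1 ?(ltW nR) // -powRrM mulN1r powRN.
move=> h; set v := (n%:R `^ eps)^-1; have v0 : 0 <= v by rewrite invr_ge0 powR_ge0.
have h2 : 0 <= 2^-1 ^+ m :> R by rewrite exprn_ge0 // invr_ge0.
have -> : (3 / 2)^-1 ^+ m = 2^-1 ^+ m * (4 / 3) ^+ m :> R.
  by rewrite -exprMn; congr (_ ^+ _); field.
rewrite -/v; apply: (@le_trans _ _ (2^-1 ^+ m * (C0 * (4 / 3) ^+ m * v))).
  apply: ler_wpM2l => //; apply: ler_wpM2r => //; apply: le_trans h _.
  by apply: ler_wpM2l => //; exact: ltW.
rewrite le_eqVlt; apply/orP; left; apply/eqP; ring.
Qed.

End counting.

(** * Independence *)

Section independence.
Context (R : realType) (disp disp' : measure_display).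
Context (S : measurableType disp) (T : measurableType disp').
Variables (P : probability S R) (mu : probability T R) (N : nat).
Variable X : 'I_N -> {RV P >-> T}.

(* A pi-system generating the sigma-algebra of the [X i], [i != j]. *)
Definition others (j : 'I_N) : set (set S) :=
  [set F | exists A : 'I_N -> set T, [/\ forall i, measurable (A i), A j = setT &
     F = \bigcap_i (X i @^-1` A i)]].

Notation SG j := (g_sigma_algebraType (others j)).

Lemma measurable_RV_preimage i (A : set T) : measurable A -> measurable (X i @^-1` A).
Proof. by move=> mA; rewrite -[X in measurable X]setTI; exact: measurable_funP. Qed.

Lemma others_measurable j : others j `<=` measurable.
Proof.
move=> _ [A [mA _ ->]]; apply: fin_bigcap_measurable => [|i _]; first exact: finite_finset.
exact: measurable_RV_preimage.
Qed.

Lemma measurable_others j : measurable_fun [set: S] (fun w : S => w : SG j).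
Proof.
move=> _ A mA; rewrite setTI preimage_id.
exact: (smallest_sub (@sigma_algebra_measurable _ S) (@others_measurable j)).
Qed.

Lemma measurable_RV_others i j : i != j -> measurable_fun [set: SG j] (X i : SG j -> T).
Proof.
move=> ij _ A mA; rewrite setTI; apply: sub_sigma_algebra.
exists (fun l => if l == i then A else setT); split.
- by move=> l; case: ifP.
- by rewrite eq_sym (negbTE ij).
- apply/seteqP; split => [w Aw l _ /=|w /(_ i I)]; last by rewrite /= eqxx.
  by case: eqP => // ->.
Qed.

Hypothesis iidX : iid_sample mu X.

Lemma distribution_iid i (A : set T) : measurable A -> P (X i @^-1` A) = mu A.
Proof. by case: iidX => + _ mA => /(_ i A mA). Qed.

Lemma indep_generators j (B : set T) (F : set S) : measurable B -> others j F ->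
  P (F `&` X j @^-1` B) = (mu B * P F)%E.
Proof.
move=> mB [A [mA Aj ->]].
case: iidX => _ /(_ [set: 'I_N]%SET) prodX.
have setE (A' : 'I_N -> set T) :
    \bigcap_(i in [set` [set: 'I_N]%SET]) (X i @^-1` A' i) = \bigcap_i (X i @^-1` A' i).
  by congr bigcap; apply/seteqP; split => i _ //=; rewrite finset.in_setT.
pose A' i := if i == j then B else A i.
have mA' i : measurable (A' i) by rewrite /A'; case: ifP.
have -> : \bigcap_i (X i @^-1` A i) `&` X j @^-1` B = \bigcap_i (X i @^-1` A' i).
  apply/seteqP; split => [w [Aw Bw] i _|w Aw].
    by rewrite /A' /=; case: eqP => [->//|_]; exact: Aw.
  split => [i _ /=|]; last by have := Aw j I; rewrite /A' /= eqxx.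
  by have := Aw i I; rewrite /A' /=; case: eqP => // -> _; rewrite Aj.
rewrite -!setE !prodX // (bigD1 j) ?finset.in_setT //= [in RHS](bigD1 j) ?finset.in_setT //=.
rewrite [A' j]/A' eqxx Aj preimage_setT probability_setT mul1e distribution_iid //.
congr (_ * _)%E; apply: eq_bigr => i /andP[_ /negbTE ij].
by rewrite /A' ij.
Qed.

Lemma others_setI j : setI_closed (others j).
Proof.
move=> _ _ [A [mA Aj ->]] [B [mB Bj ->]].
exists (fun i => A i `&` B i); split.
- by move=> i; exact: measurableI.
- by rewrite Aj Bj setTI.
- by rewrite -bigcapI; apply: eq_bigcapr => i _; rewrite preimage_setI.
Qed.

Lemma others_setT j : others j setT.
Proof.
exists (fun=> setT); split => //.
by apply/seteqP; split => // w _ i _.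
Qed.

(** For fixed [B] both sides are finite measures in [F] that agree on the pi-system [others j],
    hence on the sigma-algebra it generates. *)
Lemma indep_others j (B : set T) (F : set S) : measurable B -> <<s others j >> F ->
  P (X j @^-1` B `&` F) = (mu B * P F)%E.
Proof.
move=> mB sF.
have mD := measurable_RV_preimage j mB.
have fB : mu B \is a fin_num by exact: fin_num_measure.
have nnB : 0 <= fine (mu B) by rewrite fine_ge0.
pose m1 : {measure set S -> \bar R} := mrestr P mD.
pose m2 : {measure set S -> \bar R} := mscale (NngNum nnB) P.
rewrite setIC; have -> : (mu B * P F = m2 F)%E.
  by rewrite /m2 /= /mscale /= fineK.
rewrite -[LHS]/(m1 F).
apply: (@g_sigma_algebra_measure_unique _ R S (others j) (@others_measurable j)
          (fun=> setT)) => //.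
- by move=> _; exact: others_setT.
- by rewrite bigcup_const //; exists 0%N.
- exact: others_setI.
- move=> A oA; rewrite /m1 /m2 /= /mrestr /mscale /= fineK //.
  exact: indep_generators.
- by move=> _; rewrite /m1 /= /mrestr setTI (le_lt_trans (probability_le1 _ mD)) // ltry.
Qed.

Section peel.
Variable j : 'I_N.
Local Open Scope ereal_scope.

(** The tuple of the other samples is represented by the identity of [S] into [S] with the coarser
    sigma-algebra, so no product of N - 1 spaces is formed. [indep_others] says that the joint law
    of [X j] and [idG] is a product measure, to which Tonelli's theorem applies. *)
Let idG : S -> SG j := fun w => w.
Let midG : measurable_fun [set: S] idG. Proof. exact: measurable_others. Qed.
Let PG : probability (SG j) R :=
  distribution P (HB.pack idG (isMeasurableFun.Build _ _ _ _ idG midG) : {RV P >-> SG j}).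
Let joint : S -> (T * SG j)%type := fun w => (X j w, idG w).
Let mjoint : measurable_fun [set: S] joint.
Proof. by apply: measurable_fun_pair => //; exact: measurable_funP. Qed.
Let PJ : probability (T * SG j)%type R :=
  distribution P (HB.pack joint (isMeasurableFun.Build _ _ _ _ joint mjoint)
    : {RV P >-> (T * SG j)%type}).

Lemma integral_peel (h : T * SG j -> \bar R) :
  measurable_fun setT h -> (forall z, 0 <= h z) ->
  \int[P]_w h (X j w, w) = \int[P]_w \int[mu]_x h (x, w).
Proof.
move=> mh h0.
have E (A : set (T * SG j)) : measurable A -> (mu \x PG) A = PJ A.
  apply: product_measure_unique => B F mB mF.
  exact: indep_others.
transitivity (\int[PJ]_z h z).
  by rewrite ge0_integral_pushforward.
rewrite (eq_measure_integral (mu \x PG)); last by move=> A mA _; apply/esym/E.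
rewrite fubini_tonelli2 //.
rewrite ge0_integral_pushforward //.
- exact: measurable_fun_fubini_tonelli_G.
- by move=> w _; apply: integral_ge0.
Qed.

End peel.

Lemma measurable_fun_others j d' (U : measurableType d') (f : S -> U) :
  measurable_fun [set: SG j] (f : SG j -> U) -> measurable_fun [set: S] f.
Proof.
move=> mf _ A mA; rewrite setTI.
have := mf measurableT A mA; rewrite setTI.
exact: (smallest_sub (@sigma_algebra_measurable _ S) (@others_measurable j)).
Qed.

Local Open Scope ereal_scope.

(* [h j] may depend on the other coordinates through [w], as long as its mean
   over the j-th coordinate is bounded by [c]: peel off one factor at a time. *)
Lemma integral_prod_le (h : 'I_N -> T -> S -> \bar R) (c : R) (s : seq 'I_N) :
  (0 <= c)%R -> uniq s ->
  (forall j x w, 0 <= h j x w) ->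
  (forall j, j \in s -> measurable_fun setT (fun z : T * SG j => h j z.1 z.2)) ->
  (forall i j, i \in s -> j \in s -> i != j ->
     measurable_fun setT (fun w : SG j => h i (X i w) w)) ->
  (forall j, j \in s -> forall w, \int[mu]_x h j x w <= c%:E) ->
  \int[P]_w (\prod_(j <- s) h j (X j w) w) <= (c ^+ size s)%:E.
Proof.
move=> c0 + h0; elim: s => [_ _ _ _|j s IH /= /andP[js us] mh mhX hc].
  by under eq_integral do rewrite big_nil; rewrite integral_cst //= mul1e probability_setT.
pose F w := \prod_(i <- s) h i (X i w) w.
have F0 w : 0 <= F w by apply: prode_ge0.
have mF : measurable_fun [set: SG j] (F : SG j -> _).
  have : forall i, i \in s -> measurable_fun [set: SG j] (fun w : SG j => h i (X i w) w).
    move=> i si; apply: mhX; rewrite ?mem_head // ?inE ?si ?orbT //.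
    by apply: contraTneq si => ->.
  rewrite /F; elim: (s) => [_|i s' IH' ms].
    by under eq_fun do rewrite big_nil; exact: measurable_cst.
  under eq_fun do rewrite big_cons; apply: emeasurable_funM.
    by apply: ms; rewrite mem_head.
  by apply: IH' => l ls; apply: ms; rewrite inE ls orbT.
have IHs : \int[P]_w F w <= (c ^+ size s)%:E.
  apply: IH => //.
  - by move=> i si; apply: mh; rewrite inE si orbT.
  - by move=> i l si sl; apply: mhX; rewrite inE ?si ?sl orbT.
  - by move=> i si; apply: hc; rewrite inE si orbT.
under eq_integral do rewrite big_cons.
have mhF : measurable_fun setT (fun z : T * SG j => h j z.1 z.2 * F z.2).
  apply: emeasurable_funM; first by apply: mh; rewrite mem_head.
  exact: measurableT_comp.
rewrite (@integral_peel j (fun z => h j z.1 z.2 * F z.2)) //=; last first.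
  by move=> z; rewrite mule_ge0.
have mFS : measurable_fun [set: S] F by exact: (@measurable_fun_others j).
apply: (@le_trans _ _ (\int[P]_w (c%:E * F w))).
  apply: ge0_le_integral => //.
  - by move=> w _; apply: integral_ge0 => x _; rewrite mule_ge0.
  - apply: (@measurable_fun_others j).
    by apply: (@measurable_fun_fubini_tonelli_G _ _ T (SG j) _ mu (fun z => h j z.1 z.2 * F z.2)) => // z; rewrite mule_ge0.
  - by apply: emeasurable_funM.
  - move=> w _; rewrite ge0_integralZr //.
    + by apply: lee_wpmul2r => //; apply: hc; rewrite mem_head.
    + exact: (@measurable_fun_pair1 _ _ _ _ _ _ (fun z : T * SG j => h j z.1 z.2) w (mh j (mem_head _ _))).
rewrite ge0_integralZl // exprS EFinM; apply: lee_wpmul2l => //.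
Qed.

End independence.

(** * Large products *)

Section measurability.
Context (R : realType) d (U : measurableType d).

Lemma measurable_dot k (f g : U -> 'rV[R]_k) :
  (forall a, measurable_fun setT (fun x => f x 0 a)) ->
  (forall a, measurable_fun setT (fun x => g x 0 a)) ->
  measurable_fun setT (fun x => dot (f x) (g x)).
Proof. by move=> mf mg; apply: measurable_sum => a; exact: measurable_funM. Qed.

Lemma measurable_sqrt_comp (f : U -> R) :
  measurable_fun setT f -> measurable_fun setT (fun x => Num.sqrt (f x)).
Proof.
move=> mf; apply: (measurableT_comp (f := @Num.sqrt R)) => //.
by apply: continuous_measurable_fun; exact: sqrt_continuous.
Qed.

Lemma measurable_norm_comp (f : U -> R) :
  measurable_fun setT f -> measurable_fun setT (fun x => `|f x|).
Proof. by move=> mf; apply: (measurableT_comp (f := @Num.norm R R)) => //; exact: normr_measurable. Qed.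

Lemma measurable_bool_indic (p : U -> bool) :
  measurable_fun setT p -> measurable_fun setT (fun x => ((p x)%:R : R)%:E).
Proof. by move=> mp; apply: (measurableT_comp (f := fun b : bool => (b%:R : R)%:E)). Qed.

Lemma measurable_bool_set (p : U -> bool) :
  measurable_fun setT p -> measurable [set x | p x].
Proof. by move=> mp; have := mp measurableT [set true] I; rewrite setTI. Qed.

Lemma integral_bool_indic (m : {measure set U -> \bar R}) (p : U -> bool) :
  measurable_fun setT p ->
  (\int[m]_x ((p x)%:R : R)%:E)%E = m [set x | p x].
Proof.
move=> mp; rewrite -[in RHS](setIT [set x | p x]) -integral_indic //.
  by apply: eq_integral => x _; rewrite indicE; congr ((nat_of_bool _)%:R%:E); apply/idP/idP => [px|/set_mem//]; exact: mem_set.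
exact: measurable_bool_set.
Qed.

Lemma le_measure_bigsetU (m : {measure set U -> \bar R}) (I : Type) (s : seq I) (Q : pred I)
    (F : I -> set U) :
  (forall i, Q i -> measurable (F i)) ->
  (m (\big[setU/set0]_(i <- s | Q i) F i) <= \sum_(i <- s | Q i) m (F i))%E.
Proof.
move=> mF; elim: s => [|i s IH]; first by rewrite !big_nil measure0.
rewrite !big_cons; case: ifP => // Qi; apply: le_trans (measureU2 _ _ _) _.
- exact: mF.
- exact: bigsetU_measurable.
- exact: leeD2l.
Qed.

End measurability.

Section sample.
Context (R : realType) (disp disp' : measure_display).
Context (S : measurableType disp) (T : measurableType disp').
Variables (P : probability S R) (mu : probability T R) (N k : nat).
Variable X : 'I_N -> {RV P >-> T}.
Variable W : T -> 'rV[R]_k.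
Hypothesis iidX : iid_sample mu X.
Hypothesis mW : forall a, measurable_fun setT (fun x => W x 0 a).

Definition sample_mx (w : S) : 'M[R]_(N, k) := \matrix_(i, a) W (X i w) 0 a.

Lemma row_sample_mx i w : row i (sample_mx w) = W (X i w).
Proof. by apply/rowP => a; rewrite !mxE. Qed.

Definition sample_comb (z : 'I_N -> int) (w : S) : 'rV[R]_k :=
  int_row R z *m sample_mx w.

Lemma sample_combE z w a :
  sample_comb z w 0 a = \sum_i (z i)%:~R * W (X i w) 0 a.
Proof. by rewrite mxE; apply: eq_bigr => i _; rewrite !mxE. Qed.

Lemma measurable_sample_comb_others j z a : z j = 0 ->
  measurable_fun setT (fun w : g_sigma_algebraType (others X j) => sample_comb z w 0 a).
Proof.
move=> zj; under eq_fun do rewrite sample_combE.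
apply: measurable_sum => i; have [->|ij] := eqVneq i j.
  by under eq_fun do rewrite zj mul0r; exact: measurable_cst.
apply: measurable_funM; first exact: measurable_cst.
by apply: (measurableT_comp (f := fun x => W x 0 a)) => //; exact: measurable_RV_others.
Qed.

Lemma measurable_sample_comb z a : measurable_fun setT (fun w => sample_comb z w 0 a).
Proof.
under eq_fun do rewrite sample_combE.
apply: measurable_sum => i; apply: measurable_funM; first exact: measurable_cst.
by apply: (measurableT_comp (f := fun x => W x 0 a)) => //; exact: measurable_funP.
Qed.

Definition large_product (t : R) (z : 'I_N -> int) (x : T) (w : S) : bool :=
  t * Num.sqrt (dot (sample_comb z w) (sample_comb z w)) < `|dot (W x) (sample_comb z w)|.

Lemma measurable_large_product_comp d (U : measurableType d) (f : U -> T) (g : U -> S) t z :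
  measurable_fun setT f ->
  (forall a, measurable_fun setT (fun u => sample_comb z (g u) 0 a)) ->
  measurable_fun setT (fun u => large_product t z (f u) (g u)).
Proof.
move=> mf mg; apply: measurable_fun_ltr.
  by apply: measurable_funM => //; apply: measurable_sqrt_comp; exact: measurable_dot.
apply: measurable_norm_comp; apply: measurable_dot => // a.
by apply: (measurableT_comp (f := fun x => W x 0 a)).
Qed.

Lemma measurable_large_product t z j :
  measurable [set w | large_product t z (X j w) w].
Proof.
apply: measurable_bool_set; apply: measurable_large_product_comp => // a.
exact: measurable_sample_comb.
Qed.

Variables (kappa q : R).
Hypothesis tailW : forall (t : R) (u : 'rV[R]_k), 0 < t ->
  (mu [set x | (t * Num.sqrt (dot u u) < `|dot (W x) u|)%R] <= ((kappa / t) `^ q)%:E)%E.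

(** As [z] vanishes on [s], Y(z) is measurable with respect to the coordinates other than j for
    every j in [s]. The tail bound is uniform in the vector [u], so it holds with Y(z) frozen, and
    the factors can be peeled off. *)
Lemma prob_large_products (t : R) (z : 'I_N -> int) (s : seq 'I_N) :
  0 < t -> uniq s -> (forall j, j \in s -> z j = 0) ->
  (P (\big[setI/setT]_(j <- s) [set w | large_product t z (X j w) w]) <=
   (((kappa / t) `^ q) ^+ size s)%:E)%E.
Proof.
move=> t0 us zs.
pose h (j : 'I_N) (x : T) (w : S) : \bar R := ((large_product t z x w)%:R)%:E.
have mS j : measurable_fun setT (fun w => large_product t z (X j w) w).
  apply: measurable_large_product_comp => // a.
  exact: measurable_sample_comb.
have -> : P (\big[setI/setT]_(j <- s) [set w | large_product t z (X j w) w]) =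
   (\int[P]_w (\prod_(j <- s) h j (X j w) w))%E.
  rewrite -[in LHS](setIT (\big[_/_]_(_ <- _) _)) -integral_indic //; last first.
    by apply: bigsetI_measurable => j _; exact: measurable_large_product.
  apply: eq_integral => w _; rewrite indicE /h.
  rewrite prodEFin; congr (_%:E).
  elim: (s) => [|j s' IH]; first by rewrite !big_nil in_setT.
  rewrite !big_cons in_setI -mulnb natrM -IH; congr ((nat_of_bool _)%:R * _).
  by apply/idP/idP => [/set_mem//|?]; exact: mem_set.
apply: (integral_prod_le iidX (h := h)) => //.
- exact: powR_ge0.
- by move=> j x w; rewrite lee_fin ler0n.
- move=> j js; apply: measurable_bool_indic.
  apply: measurable_large_product_comp => // a.
  apply: (measurableT_comp (f := fun w : g_sigma_algebraType (others X j) => sample_comb z w 0 a)) => //.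
  exact: measurable_sample_comb_others (zs _ js).
- move=> i j si sj ij; apply: measurable_bool_indic.
  apply: measurable_large_product_comp => [|a]; first exact: measurable_RV_others.
  exact: measurable_sample_comb_others (zs _ sj).
- move=> j js w; rewrite integral_bool_indic; first exact: tailW.
  by apply: measurable_large_product_comp.
Qed.

End sample.

Lemma bigsetU_mem (U : Type) (I : eqType) (s : seq I) (Q : pred I) (F : I -> set U) i u :
  i \in s -> Q i -> F i u -> (\big[setU/set0]_(i <- s | Q i) F i) u.
Proof.
elim: s => // j s IH; rewrite inE big_cons => /orP[/eqP<- -> Fu|si Qi Fu]; first by left.
by case: ifP => _; [right|]; exact: IH.
Qed.

Lemma bigsetI_mem (U : Type) (I : eqType) (s : seq I) (F : I -> set U) u :
  (forall i, i \in s -> F i u) -> (\big[setI/setT]_(i <- s) F i) u.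
Proof.
elim: s => [_|j s IH h]; first by rewrite big_nil.
rewrite big_cons; split; first by apply: h; rewrite mem_head.
by apply: IH => i si; apply: h; rewrite inE si orbT.
Qed.

Section union_bound.
Context (R : realType) (disp disp' : measure_display).
Context (S : measurableType disp) (T : measurableType disp').
Variables (P : probability S R) (mu : probability T R) (N k : nat).
Variable X : 'I_N -> {RV P >-> T}.
Variable W : T -> 'rV[R]_k.
Hypothesis iidX : iid_sample mu X.
Hypothesis mW : forall a, measurable_fun setT (fun x => W x 0 a).
Variables (kappa eps : R) (n : nat).
Hypothesis kappa_ge1 : 1 <= kappa.
Hypothesis n_gt0 : (0 < n)%N.
Hypothesis tailW : forall (t : R) (u : 'rV[R]_k), 0 < t ->
  (mu [set x | (t * Num.sqrt (dot u u) < `|dot (W x) u|)%R] <= ((kappa / t) `^ (4 + eps))%:E)%E.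

Definition coeffs m (f : {ffun 'I_N -> code m}) : 'I_N -> int := fun i => decode (f i).

Definition bad_products m (f : {ffun 'I_N -> code m}) (J : {set 'I_N}) : set S :=
  if J \subset [set i | coeffs f i == 0]%SET then
    \big[setI/setT]_(j <- enum J)
      [set w | large_product X W (level_threshold kappa eps n m) (coeffs f) (X j w) w]
  else set0.

Definition small_codes m : {set {ffun 'I_N -> code m}} :=
  [set f : {ffun 'I_N -> code m} | (\sum_i code_wt (f i) <= m)%N]%SET.

Definition bad_event : set S :=
  \big[setU/set0]_(m < N.+1 | (4 <= m)%N)
    \big[setU/set0]_(f in small_codes m)
      \big[setU/set0]_(J : {set 'I_N} | #|J| == m :> nat) bad_products f J.

Lemma measurable_bad_products m (f : {ffun 'I_N -> code m}) J : measurable (bad_products f J).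
Proof.
rewrite /bad_products; case: ifP => // _; apply: bigsetI_measurable => j _.
exact: measurable_large_product.
Qed.

Lemma measurable_bad_event : measurable bad_event.
Proof.
do 3 (apply: bigsetU_measurable => ? _).
exact: measurable_bad_products.
Qed.

Lemma few_large_off_bad_event w : ~ bad_event w ->
  few_large_products (sample_mx X W w) (level_threshold kappa eps n).
Proof.
move=> nbad m z /andP[m4 mN] zm; rewrite ltnNge; apply/negP => /card_geqP[s [us sm sB]].
apply: nbad.
have zi i : (`|z i| <= m)%N by apply: leq_trans zm; rewrite (bigD1 i) //= leq_addr.
have [f fz] : exists f : {ffun 'I_N -> code m}, forall i, decode (f i) = z i.
  exists [ffun i => projT1 (cid (decode_surj (zi i)))] => i.
  by rewrite ffunE; case: cid.
have cz : coeffs f = z by apply/funext => i; exact: fz.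
pose J := [set i in s]%SET.
have cJ : #|J| = m by rewrite cardsE (card_uniqP us).
have m1 : (m < N.+1)%N by [].
apply: (@bigsetU_mem _ _ _ _ _ (Ordinal m1)) => //; first exact: mem_index_enum.
apply: (@bigsetU_mem _ _ _ _ _ f); first exact: mem_index_enum.
  rewrite inE; apply: leq_trans zm; apply: leq_sum => i _.
  by rewrite -fz absz_decode.
apply: (@bigsetU_mem _ _ _ _ _ J); [exact: mem_index_enum|exact/eqP|].
rewrite /bad_products cz ifT; last first.
  by apply/fintype.subsetP => i; rewrite !inE => /sB; rewrite inE => /andP[].
apply: bigsetI_mem => i; rewrite mem_enum inE => /sB; rewrite inE => /andP[_].
by rewrite /large_product /sample_comb row_sample_mx.
Qed.

Lemma prob_bad_event :
  (P bad_event <= (\sum_(m < N.+1 | (4 <= m)%N)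
    #|small_codes m|%:R * 'C(N, m)%:R *
    ((kappa / level_threshold kappa eps n m) `^ (4 + eps)) ^+ m)%:E)%E.
Proof.
apply: le_trans (le_measure_bigsetU _ _ _) _ => [m _|].
  do 2 (apply: bigsetU_measurable => ? _); exact: measurable_bad_products.
rewrite -sumEFin; apply: lee_sum => m m4.
set p := (_ `^ _) ^+ m.
have p0 : 0 <= p by rewrite exprn_ge0 // powR_ge0.
have t0 : 0 < level_threshold kappa eps n m.
  by apply: level_threshold_gt0 => //; [exact: lt_le_trans ltr01 kappa_ge1|exact: leq_trans m4].
have one (f : {ffun 'I_N -> code m}) (J : {set 'I_N}) : #|J| = m -> (P (bad_products f J) <= p%:E)%E.
  move=> cJ; rewrite /bad_products; case: ifPn => [Jz|_]; last by rewrite measure0 lee_fin.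
  have := @prob_large_products _ _ _ _ _ P mu N k X W iidX mW kappa (4 + eps) tailW _ (coeffs f) (enum J) t0.
  rewrite -cardE cJ; apply; first exact: enum_uniq.
  by move=> j; rewrite mem_enum => /(fintype.subsetP Jz); rewrite inE => /eqP.
apply: le_trans (le_measure_bigsetU _ _ _) _ => [f _|].
  apply: bigsetU_measurable => ? _; exact: measurable_bad_products.
apply: (@le_trans _ _ (\sum_(f in small_codes m) ('C(N, m)%:R * p)%:E)%E).
  apply: lee_sum => f _; apply: le_trans (le_measure_bigsetU _ _ _) _ => [J _|].
    exact: measurable_bad_products.
  apply: (@le_trans _ _ (\sum_(J : {set 'I_N} | #|J| == m :> nat) p%:E)%E).
    by apply: lee_sum => J /eqP; exact: one.
  rewrite sumEFin lee_fin (eq_bigl (fun J => J \in [set J' : {set 'I_N} | #|J'| == m]%SET)).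
    by rewrite sumr_const card_draws card_ord [leRHS]mulr_natl.
  by move=> J; rewrite inE.
by rewrite sumEFin lee_fin sumr_const -[leLHS]mulr_natl mulrA.
Qed.

End union_bound.

(** * Lower tails *)

Section chernoff.
Context (R : realType) (disp disp' : measure_display).
Context (S : measurableType disp) (T : measurableType disp').
Variables (P : probability S R) (mu : probability T R) (N : nat).
Variable X : 'I_N -> {RV P >-> T}.
Hypothesis iidX : iid_sample mu X.

(** The linear term stands on the left so that only nonnegative functions get integrated. For the
    proof, e^x (1 - x + x^2) >= (1 + x) (1 - x + x^2) = 1 + x^3. *)
Lemma expRN_le_quadratic (x : R) : 0 <= x -> expR (- x) + x <= 1 + x ^+ 2.
Proof.
move=> x0; have := @expR_ge1Dx R x; rewrite expRN => h.
have e0 : 0 < expR x := expR_gt0 _.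
suff : (expR x)^-1 <= 1 - x + x ^+ 2 by lra.
rewrite -(ler_pM2l e0) divff ?gt_eqF //.
have : (1 + x) * (1 - x + x ^+ 2) <= expR x * (1 - x + x ^+ 2).
  by apply: ler_wpM2r => //; have := sqr_ge0 (x - 1 / 2); rewrite expr2; lra.
suff : 1 <= (1 + x) * (1 - x + x ^+ 2) by lra.
have -> : (1 + x) * (1 - x + x ^+ 2) = 1 + x ^+ 3 by ring.
by rewrite lerDl exprn_ge0.
Qed.

Lemma expR_le_linear (x : R) : 0 <= x <= 1 / 4 -> expR x <= 1 + 3 / 2 * x.
Proof.
move=> /andP[x0 x1]; have := @expR_ge1Dx R (- x); rewrite expRN => h.
have e0 : 0 < expR x := expR_gt0 _.
have h2 : (1 - x) * expR x <= 1 by rewrite -(ler_pM2r e0) mulVf ?gt_eqF // in h.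
nra.
Qed.

Lemma measurable_sum_sample (g : T -> R) : measurable_fun setT g ->
  measurable_fun setT (fun w => \sum_i g (X i w)).
Proof.
by move=> mg; apply: measurable_sum => i; apply: (measurableT_comp (f := g)).
Qed.

(** The indicator of nonnegative sums is at most the exponential of the sum, whose mean factors by
    independence. *)
Lemma prob_sum_ge0 (g : T -> R) (c : R) : measurable_fun setT g -> 0 <= c ->
  (\int[mu]_x (expR (g x))%:E <= c%:E)%E ->
  (P [set w | (0 <= \sum_i g (X i w))%R] <= (c ^+ N)%:E)%E.
Proof.
move=> mg c0 hc.
have me : measurable_fun setT (fun x => (expR (g x))%:E).
  by apply/measurable_EFinP; apply: (measurableT_comp (f := @expR R)).
have := @integral_prod_le _ _ _ S T P mu N X iidX (fun _ x _ => (expR (g x))%:E) c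
   (index_enum 'I_N) c0 (index_enum_uniq _).
rewrite (_ : size _ = N); last by rewrite -[RHS]card_ord cardT enumT.
have mle : measurable_fun setT (fun w => 0 <= \sum_i g (X i w)).
  by apply: measurable_fun_ler => //; exact: measurable_sum_sample.
move=> H; apply: le_trans _ (H _ _ _ _); last 4 first.
- by move=> j x w; rewrite lee_fin expR_ge0.
- by move=> j _; apply: (measurableT_comp me).
- move=> i j _ _ ij; apply: (measurableT_comp me); exact: measurable_RV_others.
- by move=> j _ _.
rewrite -(integral_bool_indic _ mle); apply: ge0_le_integral => //.
- exact: measurable_bool_indic.
- under eq_fun do rewrite prodEFin -expR_sum.
  by apply/measurable_EFinP; apply: (measurableT_comp (f := @expR R)) => //; exact: measurable_sum_sample.
- move=> w _; rewrite prodEFin -expR_sum lee_fin.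
  case: (leP 0 (\sum_i g (X i w))) => h; last exact: expR_ge0.
  by rewrite (_ : true%:R = expR 0 :> R) ?ler_expR // expR0.
Qed.

Lemma chernoff_lower (g : T -> R) (M t : R) :
  measurable_fun setT g -> (forall x, 0 <= g x) -> 1 <= M -> 0 <= t <= 1 ->
  (\int[mu]_x (g x)%:E = 1)%E -> (\int[mu]_x (g x ^+ 2)%:E <= M%:E)%E ->
  (P [set w | (\sum_i g (X i w) < (1 - t) * N%:R)%R] <=
    (expR (- (t ^+ 2 / (4 * M)) * N%:R))%:E)%E.
Proof.
move=> mg g0 M1 /andP[t0 t1] Eg Eg2.
(* Minimises lam^2 M - lam t; the minimum - t^2 / (4 M) is the exponent claimed. *)
pose lam := t / (2 * M).
have lam0 : 0 <= lam by rewrite divr_ge0 //; lra.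
have lg0 x : 0 <= lam * g x by exact: mulr_ge0.
pose f x := lam * (1 - t) - lam * g x.
have mf : measurable_fun setT f.
  by apply: measurable_funB => //; apply: measurable_funM.
have mexp : measurable_fun setT (fun x => expR (- (lam * g x))).
  by apply: (measurableT_comp (f := @expR R)) => //; apply: measurable_funN; apply: measurable_funM.
have mlg : measurable_fun setT (fun x => lam * g x) by apply: measurable_funM.
have m2 : measurable_fun setT (fun x => g x ^+ 2) by exact: measurable_funX.
have key : (\int[mu]_x (expR (- (lam * g x)))%:E <= (1 - lam + lam ^+ 2 * M)%:E)%E.
  have h : (\int[mu]_x (expR (- (lam * g x)))%:E + lam%:E <= (1 + lam ^+ 2 * M)%:E)%E.
    have -> : (lam%:E = \int[mu]_x (lam * g x)%:E)%E.
      under eq_integral do rewrite EFinM.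
      by rewrite ge0_integralZl // ?Eg ?mule1 //; [apply/measurable_EFinP|move=> x _; rewrite lee_fin].
    rewrite -ge0_integralD //; try exact/measurable_EFinP; try (by move=> x _; rewrite ?lee_fin ?lg0 ?expR_ge0 ?sqr_ge0 // ?mulr_ge0 ?sqr_ge0); try (by rewrite lee_fin ?expR_ge0 ?sqr_ge0 // ?mulr_ge0).
    apply: (@le_trans _ _ (\int[mu]_x (1%:E + (lam ^+ 2)%:E * (g x ^+ 2)%:E))%E).
      apply: ge0_le_integral => //.
      - by move=> x _; rewrite -EFinD lee_fin; apply: addr_ge0; [exact: expR_ge0|exact: mulr_ge0].
      - by apply: emeasurable_funD; exact/measurable_EFinP.
      - by apply: emeasurable_funD => //; apply: emeasurable_funM => //; exact/measurable_EFinP.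
      - move=> x _; rewrite -EFinM -!EFinD lee_fin -exprMn.
        by apply: expRN_le_quadratic; rewrite mulr_ge0.
    rewrite ge0_integralD //; try (by move=> x _; rewrite -EFinM lee_fin mulr_ge0 ?sqr_ge0);
      try (by apply: emeasurable_funM => //; exact/measurable_EFinP).
    rewrite integral_cst //= mul1e probability_setT ge0_integralZl //; try exact/measurable_EFinP; try (by move=> x _; rewrite ?lee_fin ?lg0 ?expR_ge0 ?sqr_ge0 // ?mulr_ge0 ?sqr_ge0); try (by rewrite lee_fin ?expR_ge0 ?sqr_ge0 // ?mulr_ge0).
    rewrite EFinD; apply: leeD => //; rewrite [leRHS]EFinM; apply: lee_wpmul2l => //.
    by rewrite lee_fin sqr_ge0.
  have -> : 1 - lam + lam ^+ 2 * M = (1 + lam ^+ 2 * M) - lam by ring.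
  by rewrite EFinB leeBrDr.
have hc : (\int[mu]_x (expR (f x))%:E <= (expR (- (t ^+ 2 / (4 * M))))%:E)%E.
  under eq_integral do rewrite /f expRD EFinM.
  rewrite ge0_integralZl //; try exact/measurable_EFinP; try (by move=> x _; rewrite ?lee_fin ?lg0 ?expR_ge0 ?sqr_ge0 // ?mulr_ge0 ?sqr_ge0); try (by rewrite lee_fin ?expR_ge0 ?sqr_ge0 // ?mulr_ge0).
  apply: (@le_trans _ _ ((expR (lam * (1 - t)))%:E * (expR (- lam + lam ^+ 2 * M))%:E)%E).
    apply: lee_wpmul2l; first by rewrite lee_fin expR_ge0.
    apply: le_trans key _; rewrite lee_fin; apply: le_trans (expR_ge1Dx _).
    by rewrite addrA.
  rewrite -EFinM -expRD lee_fin ler_expR le_eqVlt; apply/orP; left; apply/eqP.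
  by rewrite /lam; field; lra.
have := @prob_sum_ge0 f (expR (- (t ^+ 2 / (4 * M)))) mf (expR_ge0 _) hc.
rewrite -expRM_natl [N%:R * _]mulrC => H.
apply: le_trans _ H; apply: le_measure; rewrite ?inE.
- by apply: measurable_bool_set; apply: measurable_fun_ltr => //; exact: measurable_sum_sample.
- by apply: measurable_bool_set; apply: measurable_fun_ler => //; exact: measurable_sum_sample.
move=> w /= hw; rewrite /f big_split /= sumr_const card_ord sumrN -mulr_sumr.
by rewrite -mulr_natl subr_ge0 mulrCA ler_wpM2l // mulrC ltW.
Qed.

Lemma chernoff_upper (g : T -> R) (delta : R) :
  measurable_fun setT g -> 0 < delta -> (forall x, 0 <= g x <= delta) ->
  (\int[mu]_x (g x)%:E <= 1)%E ->
  (P [set w | (2 * N%:R <= \sum_i g (X i w))%R] <=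
    (expR (- (8 * delta)^-1 * N%:R))%:E)%E.
Proof.
move=> mg delta0 gd Eg.
have g0 x : 0 <= g x by have /andP[] := gd x.
(* With this choice s g <= 1/4, where [expR_le_linear] applies, and the exponent is 3/2 s - 2 s = -
   1 / (8 delta). *)
pose s := (4 * delta)^-1; have s0 : 0 < s by rewrite invr_gt0; lra.
pose f x := s * g x - 2 * s.
have mf : measurable_fun setT f.
  by apply: measurable_funB => //; apply: measurable_funM.
have lg0 x : 0 <= s * g x by apply: mulr_ge0 => //; exact: ltW.
have mlin : measurable_fun setT (fun x => (s * g x)).
  by apply: measurable_funM.
have key : (\int[mu]_x (expR (s * g x))%:E <= (1 + 3 / 2 * s)%:E)%E.
  apply: (@le_trans _ _ (\int[mu]_x (1%:E + (3 / 2 * s)%:E * (g x)%:E))%E).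
    apply: ge0_le_integral => //.
    - by apply/measurable_EFinP; apply: (measurableT_comp (f := @expR R)).
    - by apply: emeasurable_funD => //; apply: emeasurable_funM => //; exact/measurable_EFinP.
    - move=> x _; rewrite -EFinM -EFinD lee_fin -[3 / 2 * s * _]mulrA; apply: expR_le_linear.
      have /andP[h1 h2] := gd x; rewrite mulr_ge0 ?(ltW s0) //=.
      by rewrite /s mulrC ler_pdivrMr; lra.
  have s1 : 0 <= 3 / 2 * s by rewrite mulr_ge0 // ltW.
  rewrite ge0_integralD //; try (by move=> x _; rewrite -EFinM lee_fin mulr_ge0);
    try (by apply: emeasurable_funM => //; exact/measurable_EFinP).
  rewrite integral_cst //= mul1e probability_setT ge0_integralZl //; try exact/measurable_EFinP; try (by move=> x _; rewrite ?lee_fin ?lg0 ?expR_ge0 ?sqr_ge0 // ?mulr_ge0 ?sqr_ge0); try (by rewrite lee_fin ?expR_ge0 ?sqr_ge0 // ?mulr_ge0).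
  rewrite EFinD; apply: leeD => //; rewrite -[leRHS]mule1; apply: lee_wpmul2l => //.
have hc : (\int[mu]_x (expR (f x))%:E <= (expR (- (8 * delta)^-1))%:E)%E.
  under eq_integral do rewrite /f expRD EFinM.
  rewrite ge0_integralZr //;
    try (by apply/measurable_EFinP; apply: (measurableT_comp (f := @expR R))).
  apply: (@le_trans _ _ ((expR (3 / 2 * s))%:E * (expR (- (2 * s)))%:E)%E).
    apply: lee_wpmul2r; first by rewrite lee_fin expR_ge0.
    by apply: le_trans key _; rewrite lee_fin; exact: expR_ge1Dx.
  rewrite -EFinM -expRD lee_fin ler_expR le_eqVlt; apply/orP; left; apply/eqP.
  by rewrite /s; field; lra.
have := @prob_sum_ge0 f (expR (- (8 * delta)^-1)) mf (expR_ge0 _) hc.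
rewrite -expRM_natl [N%:R * _]mulrC => H.
apply: le_trans _ H; apply: le_measure; rewrite ?inE.
- by apply: measurable_bool_set; apply: measurable_fun_ler => //; exact: measurable_sum_sample.
- by apply: measurable_bool_set; apply: measurable_fun_ler => //; exact: measurable_sum_sample.
move=> w /= hw; rewrite /f big_split /= sumr_const card_ord -mulr_sumr.
rewrite mulNrn subr_ge0 -[leLHS]mulr_natr [2 * s]mulrC -mulrA.
by apply: ler_wpM2l => //; exact: ltW.
Qed.

End chernoff.

Section moments.
Context (R : realType) d (T : measurableType d).
Variables (mu : probability T R) (kappa eps : R).
Hypothesis kappa_gt0 : 0 < kappa.
Hypothesis eps_gt0 : 0 < eps.

Let q : R := 4 + eps.
Let q_gt0 : 0 < q. Proof. by move: eps_gt0; rewrite /q; lra. Qed.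

Lemma tail_of_moment (f : T -> R) (n t : R) : measurable_fun setT f -> 0 < n -> 0 < t ->
  (\int[mu]_x (`|f x| `^ q)%:E <= ((kappa * n) `^ q)%:E)%E ->
  (mu [set x | (t * n < `|f x|)%R] <= ((kappa / t) `^ q)%:E)%E.
Proof.
move=> mf n0 t0 hf.
have tn : 0 < (t * n) `^ q by rewrite powR_gt0 // mulr_gt0.
have mA : measurable_fun setT (fun x => t * n < `|f x|).
  by apply: measurable_fun_ltr => //; exact: measurable_norm_comp.
have mp : measurable_fun setT (fun x => (`|f x| `^ q)%:E).
  apply/measurable_EFinP; apply: (measurableT_comp (f := fun x => x `^ q)).
    exact: measurable_powR.
  exact: measurable_norm_comp.
have h : (((t * n) `^ q)%:E * mu [set x | (t * n < `|f x|)%R] <= ((kappa * n) `^ q)%:E)%E.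
  apply: le_trans _ hf; rewrite -(integral_bool_indic _ mA) -ge0_integralZl //.
  - apply: ge0_le_integral => //.
    + by move=> x _; rewrite -EFinM lee_fin mulr_ge0 ?powR_ge0.
    + by apply: emeasurable_funM => //; exact: measurable_bool_indic.
    + move=> x _; rewrite -EFinM lee_fin; case: (ltP (t * n)) => hx; last first.
        by rewrite mulr0 powR_ge0.
      rewrite mulr1; apply: ge0_ler_powR; rewrite ?nnegrE ?mulr_ge0 ?(ltW t0) ?(ltW n0) ?(ltW q_gt0) //.
      exact: ltW.
  - exact: measurable_bool_indic.
  - by rewrite lee_fin ltW.
have -> : (kappa / t) `^ q = (kappa * n) `^ q / (t * n) `^ q.
  have -> : kappa / t = kappa * n * (t * n)^-1 by field; rewrite !gt_eqF.
  rewrite powRM ?invr_ge0 ?mulr_ge0 ?(ltW kappa_gt0) ?(ltW n0) ?(ltW t0) //; congr (_ * _).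
  by rewrite -powR_inv1 ?mulr_ge0 ?(ltW n0) ?(ltW t0) // -powRrM mulN1r powRN.
by rewrite EFinM lee_pdivlMr // muleC.
Qed.

(** Young's inequality with exponents q/4 and q/eps, applied pointwise to (|f| / K)^4 and 1. The
    weights 4/q and eps/q add up to 1, so the constant [kappa] is not worsened. *)
Lemma fourth_moment (f : T -> R) (n : R) : measurable_fun setT f -> 0 < n ->
  (\int[mu]_x (`|f x| `^ q)%:E <= ((kappa * n) `^ q)%:E)%E ->
  (\int[mu]_x (f x ^+ 4)%:E <= ((kappa * n) ^+ 4)%:E)%E.
Proof.
move=> mf n0 hf; pose K := kappa * n; have K0 : 0 < K by rewrite mulr_gt0.
have KV0 : 0 <= K^-1 by rewrite invr_ge0 ltW.
have pt (y : R) : y ^+ 4 <= K ^+ 4 * (eps / q) + K ^+ 4 * (4 / q) * (K `^ q)^-1 * `|y| `^ q.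
  have a0 : 0 <= (`|y| / K) ^+ 4 by rewrite exprn_ge0 // divr_ge0 // ltW.
  have := @conjugate_powR R ((`|y| / K) ^+ 4) 1 (q / 4) (q / eps) a0 ler01 _ _ _.
  rewrite mulr1 powR1 => /(_ _ _ _) H.
  have {H} : (`|y| / K) ^+ 4 <= ((`|y| / K) ^+ 4) `^ (q / 4) / (q / 4) + 1 / (q / eps).
    apply: H; rewrite ?divr_gt0 //.
    by rewrite !invf_div -mulrDl -/q divff // gt_eqF.
  have -> : ((`|y| / K) ^+ 4) `^ (q / 4) = `|y| `^ q * (K `^ q)^-1.
    rewrite -powR_mulrn ?divr_ge0 ?(ltW K0) // -powRrM.
    have -> : 4 * (q / 4) = q by field.
    rewrite powRM //; congr (_ * _).
    by rewrite -powR_inv1 ?(ltW K0) // -powRrM mulN1r powRN.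
  rewrite expr_div_n -[`|y| ^+ 4]normrX ger0_norm; last first.
    by rewrite -[4%N]/(2 * 2)%N exprM sqr_ge0.
  rewrite ler_pdivrMr ?exprn_gt0 // => h; apply: le_trans h _.
  rewrite le_eqVlt; apply/orP; left; apply/eqP; rewrite -/q.
  by have := powR_gt0 q K0; move=> ?; field; rewrite !gt_eqF.
have mp : measurable_fun setT (fun x => (`|f x| `^ q)%:E).
  apply/measurable_EFinP; apply: (measurableT_comp (f := fun x => x `^ q)).
    exact: measurable_powR.
  exact: measurable_norm_comp.
pose a := K ^+ 4 * (eps / q); pose b := K ^+ 4 * (4 / q) * (K `^ q)^-1.
have a0 : 0 <= a by rewrite mulr_ge0 ?exprn_ge0 ?divr_ge0 ?(ltW K0) ?(ltW q_gt0) // ltW.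
have b0 : 0 <= b.
  apply: mulr_ge0; last by rewrite invr_ge0 powR_ge0.
  by apply: mulr_ge0; [rewrite exprn_ge0 // ltW|rewrite divr_ge0 // ltW].
apply: (@le_trans _ _ (\int[mu]_x (a%:E + b%:E * (`|f x| `^ q)%:E))%E).
  apply: ge0_le_integral => //.
  - by move=> x _; rewrite lee_fin -[4%N]/(2 * 2)%N exprM sqr_ge0.
  - by apply/measurable_EFinP; exact: measurable_funX.
  - by apply: emeasurable_funD => //; exact: emeasurable_funM.
  - by move=> x _; rewrite -EFinM -EFinD lee_fin; exact: pt.
rewrite ge0_integralD //; try (by move=> x _; rewrite -?EFinM lee_fin ?mulr_ge0 ?powR_ge0);
  try exact: emeasurable_funM.
rewrite integral_cst //= probability_setT mule1.
rewrite ge0_integralZl //; try (by move=> x _; rewrite lee_fin powR_ge0).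
have -> : (kappa * n) ^+ 4 = a + b * K `^ q.
  have Kq : K `^ q != 0 by rewrite gt_eqF // powR_gt0.
  rewrite /a /b -/K -mulrA mulVf // mulr1 -mulrDr -mulrDl [eps + 4]addrC -/q.
  by rewrite divff ?mulr1 // gt_eqF.
by rewrite EFinD [(b * _)%:E]EFinM; apply: leeD => //; exact: lee_wpmul2l.
by move=> x _; rewrite -EFinM lee_fin; apply: mulr_ge0 => //; exact: powR_ge0.
Qed.

End moments.

Section low_event.
Context (R : realType) (disp disp' : measure_display).
Context (S : measurableType disp) (T : measurableType disp').
Variables (P : probability S R) (mu : probability T R) (N k : nat).
Variable X : 'I_N -> {RV P >-> T}.
Variable W : T -> 'rV[R]_k.
Hypothesis iidX : iid_sample mu X.
Hypothesis mW : forall a, measurable_fun setT (fun x => W x 0 a).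
Variable kappa : R.
Hypothesis kappa_ge1 : 1 <= kappa.
Hypothesis isoW : forall v, (\int[mu]_x (dot (W x) v ^+ 2)%:E = (dot v v)%:E)%E.
Hypothesis fourthW : forall v,
  (\int[mu]_x (dot (W x) v ^+ 4)%:E <= (kappa ^+ 4 * dot v v ^+ 2)%:E)%E.

Let mdot v : measurable_fun setT (fun x => dot (W x) v).
Proof. by apply: measurable_dot. Qed.

Definition low_products (v : 'rV[R]_k) : set S :=
  [set w | \sum_i dot (W (X i w)) v ^+ 2 < 3 / 8 * N%:R * dot v v].

Lemma measurable_low_products v : measurable (low_products v).
Proof.
apply: measurable_bool_set; apply: measurable_fun_ltr => //.
by apply: (measurable_sum_sample X (g := fun x => dot (W x) v ^+ 2)); exact: measurable_funX.
Qed.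

Lemma prob_low_products v :
  (P (low_products v) <= (expR (- (25 / 256 / kappa ^+ 4) * N%:R))%:E)%E.
Proof.
have [/dot_eq0->|v0] := eqVneq (dot v v) 0.
  rewrite (_ : low_products 0 = set0) ?measure0 ?lee_fin ?expR_ge0 //.
  apply/seteqP; split => // w; rewrite /low_products /= dot0l mulr0 ltNge.
  by rewrite sumr_ge0 // => i _; exact: sqr_ge0.
have vp : 0 < dot v v by rewrite lt0r v0 dot_ge0.
have vV : 0 <= (dot v v)^-1 by rewrite invr_ge0 ltW.
pose g x := dot (W x) v ^+ 2 * (dot v v)^-1.
have mg : measurable_fun setT g by apply: measurable_funM => //; exact: measurable_funX.
have g0 x : 0 <= g x by rewrite mulr_ge0 ?sqr_ge0.
have Eg : (\int[mu]_x (g x)%:E = 1)%E.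
  under eq_integral do rewrite /g EFinM.
  rewrite ge0_integralZr //; try (by apply/measurable_EFinP; exact: measurable_funX);
    try (by move=> x _; rewrite lee_fin sqr_ge0).
  by rewrite isoW -EFinM divff.
have k4 : 1 <= kappa ^+ 4 by rewrite exprn_ege1.
have Eg2 : (\int[mu]_x (g x ^+ 2)%:E <= (kappa ^+ 4)%:E)%E.
  under eq_integral do rewrite /g exprMn -exprM EFinM.
  rewrite ge0_integralZr //; try (by apply/measurable_EFinP; exact: measurable_funX);
    try (by move=> x _; rewrite lee_fin (exprM _ 2 2) sqr_ge0); last by rewrite lee_fin sqr_ge0.
  have -> : kappa ^+ 4 = (kappa ^+ 4 * dot v v ^+ 2) * (dot v v)^-1 ^+ 2.
    by rewrite -mulrA -exprMn mulfV // expr1n mulr1.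
  by rewrite [leRHS]EFinM; apply: lee_wpmul2r => //; rewrite lee_fin sqr_ge0.
(* 1 - 5/8 is the factor 3/8 of [low_products], and (5/8)^2 / 4 is the 25/256 of the exponent. *)
have t01 : 0 <= (5 / 8 : R) <= 1 by lra.
have := chernoff_lower iidX mg g0 k4 t01 Eg Eg2.
have -> : (5 / 8) ^+ 2 / (4 * kappa ^+ 4) = 25 / 256 / kappa ^+ 4 :> R.
  by field; rewrite gt_eqF //; move: kappa_ge1; lra.
apply: le_trans; apply: le_measure; rewrite ?inE.
- exact: measurable_low_products.
- by apply: measurable_bool_set; apply: measurable_fun_ltr => //; exact: measurable_sum_sample.
move=> w /= hw; rewrite /g -mulr_suml ltr_pdivrMr //.
by have -> : 1 - 5 / 8 = 3 / 8 :> R by field.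
Qed.

Definition code_row (f : {ffun 'I_k -> code (3 * k)}) : 'rV[R]_k :=
  int_row R (fun j => decode (f j)).

Definition low_event : set S :=
  \big[setU/set0]_(f in small_codes k (3 * k)) low_products (code_row f).

Lemma measurable_low_event : measurable low_event.
Proof. by apply: bigsetU_measurable => f _; exact: measurable_low_products. Qed.

(* [5 k <= 45/1568 N / kappa^4 < (25/256 - 1/16) N / kappa^4] pays for the union
   over at most [24^k <= e^(5 k)] vectors. *)
Lemma prob_low_event (c3 : R) : c3 <= 9 / (1568 * kappa ^+ 4) -> k%:R <= c3 * N%:R ->
  (P low_event <= (expR (- (16 * kappa ^+ 4)^-1 * N%:R))%:E)%E.
Proof.
move=> hc3 kN.
have kp : 0 < kappa by exact: lt_le_trans ltr01 kappa_ge1.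
have k4 : 0 < kappa ^+ 4 by rewrite exprn_gt0.
apply: le_trans (le_measure_bigsetU _ _ _) _ => [f _|]; first exact: measurable_low_products.
apply: (@le_trans _ _ (\sum_(f in small_codes k (3 * k)) (expR (- (25 / 256 / kappa ^+ 4) * N%:R))%:E)%E).
  by apply: lee_sum => f _; exact: prob_low_products.
rewrite sumEFin lee_fin sumr_const -[leLHS]mulr_natl.
have h2 : 0 < (1 / 2 : R) <= 1 / 2 by lra.
have := card_code_le k (3 * k) h2; rewrite -/(small_codes k (3 * k)) => h.
have e5 : 24 <= expR 5 :> R.
  have -> : expR 5 = expR 1 ^+ 5 :> R by rewrite -expRM_natl mulr1.
  apply: (@le_trans _ _ (2 ^+ 5)); first by rewrite -natrX ler_nat.
  rewrite lerXn2r ?nnegrE ?expR_ge0 //.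
  by have := @expR_ge1Dx R 1; lra.
have hk : #|small_codes k (3 * k)|%:R <= expR (5 * k%:R) :> R.
  apply: le_trans h _; rewrite exprM -exprMn [5 * _]mulrC expRM_natl lerXn2r ?nnegrE ?expR_ge0 //.
  - have -> : (1 / 2)^-1 ^+ 3 * (1 + 4 * (1 / 2)) = 24 :> R by field.
    exact: e5.
apply: le_trans (ler_wpM2r (expR_ge0 _) hk) _; rewrite -expRD ler_expR.
have n0 : 0 <= N%:R :> R := ler0n R N.
have : 5 * k%:R <= 45 / (1568 * kappa ^+ 4) * N%:R.
  have : c3 * N%:R <= 9 / (1568 * kappa ^+ 4) * N%:R by rewrite ler_wpM2r.
  have -> : 45 / (1568 * kappa ^+ 4) * N%:R = 5 * (9 / (1568 * kappa ^+ 4) * N%:R) by field; rewrite gt_eqF.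
  by lra.
have -> : 45 / (1568 * kappa ^+ 4) * N%:R = 45 / 1568 * ((kappa ^+ 4)^-1 * N%:R) by field; rewrite gt_eqF.
have -> : (16 * kappa ^+ 4)^-1 = 1 / 16 * (kappa ^+ 4)^-1 by field; rewrite gt_eqF.
have : 0 <= (kappa ^+ 4)^-1 * N%:R by rewrite mulr_ge0 // invr_ge0 ltW.
lra.
Qed.

Lemma lattice_off_low_event w : ~ low_event w ->
  forall z : 'I_k -> int, (\sum_j `|z j| <= 3 * k)%N ->
     3 / 8 * N%:R * dot (int_row R z) (int_row R z) <=
     \sum_i dot (W (X i w)) (int_row R z) ^+ 2.
Proof.
move=> nlow z zm; rewrite leNgt; apply/negP => hz; apply: nlow.
have zi i : (`|z i| <= 3 * k)%N by apply: leq_trans zm; rewrite (bigD1 i) //= leq_addr.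
have [f fz] : exists f : {ffun 'I_k -> code (3 * k)}, forall i, decode (f i) = z i.
  exists [ffun i => projT1 (cid (decode_surj (zi i)))] => i.
  by rewrite ffunE; case: cid.
apply: (@bigsetU_mem _ _ _ _ _ f); first exact: mem_index_enum.
  rewrite inE; apply: leq_trans zm; apply: leq_sum => i _.
  by rewrite -fz absz_decode.
have fE : (fun j => decode (f j)) = z by apply/funext.
by rewrite /low_products /code_row fE.
Qed.

(* The bound on the norm of the features is known only on an event, hence the
   truncation. *)
Definition trunc_norm2 (delta : R) (x : T) : R :=
  if dot (W x) (W x) <= delta * k%:R then dot (W x) (W x) / k%:R else 0.

Definition trace_event (delta : R) : set S :=
  [set w | 2 * N%:R <= \sum_i trunc_norm2 delta (X i w)].

Lemma measurable_trunc_norm2 delta : measurable_fun setT (trunc_norm2 delta).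
Proof.
have md : measurable_fun setT (fun x => dot (W x) (W x)) by exact: measurable_dot.
apply: measurable_fun_ifT => //; first exact: measurable_fun_ler.
exact: measurable_funM.
Qed.

Lemma measurable_trace_event delta : measurable (trace_event delta).
Proof.
apply: measurable_bool_set; apply: measurable_fun_ler => //.
by apply: measurable_sum_sample; exact: measurable_trunc_norm2.
Qed.

Lemma prob_trace_event delta : (0 < k)%N -> 0 < delta ->
  (P (trace_event delta) <= (expR (- (8 * delta)^-1 * N%:R))%:E)%E.
Proof.
move=> k0 delta0; have kR : 0 < k%:R :> R by rewrite ltr0n.
have md : measurable_fun setT (fun x => dot (W x) (W x)) by exact: measurable_dot.
apply: (chernoff_upper iidX (measurable_trunc_norm2 delta) delta0).
  move=> x; rewrite /trunc_norm2; case: ifP => h; last by rewrite lexx ltW.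
  by rewrite divr_ge0 ?dot_ge0 // ler_pdivrMr.
apply: (@le_trans _ _ (\int[mu]_x ((k%:R^-1)%:E * (dot (W x) (W x))%:E))%E).
  apply: ge0_le_integral => //.
  - by move=> x _; rewrite lee_fin /trunc_norm2; case: ifP => // _; rewrite divr_ge0 ?dot_ge0.
  - by apply/measurable_EFinP; exact: measurable_trunc_norm2.
  - by apply: emeasurable_funM => //; exact/measurable_EFinP.
  - move=> x _; rewrite -EFinM lee_fin /trunc_norm2; case: ifP => _.
      by rewrite mulrC.
    by rewrite mulr_ge0 ?invr_ge0 ?dot_ge0 // ltW.
rewrite ge0_integralZl //; try exact/measurable_EFinP;
  try (by move=> x _; rewrite lee_fin dot_ge0); try (by rewrite lee_fin invr_ge0 ltW).
have -> : (\int[mu]_x (dot (W x) (W x))%:E = k%:R%:E)%E.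
  transitivity (\int[mu]_x (\sum_(a < k) (dot (W x) (delta_mx 0 a) ^+ 2)%:E))%E.
    apply: eq_integral => x _; rewrite sumEFin; congr (_%:E).
    rewrite dot_sqr; apply: eq_bigr => a _; congr (_ ^+ 2).
    rewrite /dot (bigD1 a) //= mxE !eqxx mulr1 big1 ?addr0 // => j /negbTE ja.
    by rewrite mxE ja andbF mulr0.
  rewrite ge0_integral_sum //; last 2 first.
  - by move=> a; apply/measurable_EFinP; exact: measurable_funX.
  - by move=> a x _; rewrite lee_fin sqr_ge0.
  under eq_bigr do rewrite isoW.
  rewrite sumEFin; congr (_%:E).
  rewrite (eq_bigr (fun=> 1)) ?sumr_const ?card_ord // => a _.
  rewrite /dot (bigD1 a) //= mxE !eqxx mulr1 big1 ?addr0 // => j /negbTE ja.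
  by rewrite mxE ja andbF mulr0.
by rewrite -EFinM mulVf // gt_eqF.
Qed.

End low_event.

(** * Both bounds for a sample of isotropic vectors *)

Lemma with_prob_ge_setD (R : realType) d (S : measurableType d) (P : probability S R)
    (p e : R) (A B : set S) :
  measurable A -> measurable B -> (p%:E <= P A)%E -> (P B <= e%:E)%E ->
  measurable (A `\` B) /\ ((p - e)%:E <= P (A `\` B))%E.
Proof.
move=> mA mB pA Be; have mD := measurableD mA mB; split => //.
rewrite EFinB leeBlDr // (le_trans pA) //.
apply: (@le_trans _ _ (P (A `\` B) + P B)%E); last exact: leeD2l.
apply: le_trans (measureU2 _ _ _) => //.
apply: le_measure; rewrite ?inE //; first exact: measurableU.
by move=> w Aw; have [Bw|nBw] := pselect (B w); [right|left].
Qed.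

Lemma expRN_le_powR (R : realType) (eps a : R) : 0 < eps -> 0 < a ->
  exists2 c : R, 0 < c & forall N : nat, (0 < N)%N -> expR (- a * N%:R) <= c / N%:R `^ eps.
Proof.
move=> e0 a0; exists (expR (- eps - eps * ln (a / eps))); first exact: expR_gt0.
move=> N N0; have NR : 0 < N%:R :> R by rewrite ltr0n.
rewrite ler_pdivlMr ?powR_gt0 // mulNr expRN mulrC ler_pdivrMr ?expR_gt0 //.
exact: powR_le_expR.
Qed.

Section isotropic.
Variables (R : realType) (kappa eps delta c3 : R).
Hypothesis kappa_ge1 : 1 <= kappa.
Hypothesis eps_gt0 : 0 < eps.
Hypothesis delta_gt0 : 0 < delta.
Hypothesis c3_le : c3 <= 9 / (1568 * kappa ^+ 4).

(** The constants come before the probability spaces and the dimensions, so they are absolute. [A]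
    is the event on which the rows are bounded; conditioning on it would destroy independence, so
    the bad events are estimated on the whole space and then removed from [A]. The three parts of
    [c] pay for [bad], [low] and [tr]. *)
Theorem isotropic_sample_bounds : exists c C : R, [/\ 0 < c, 0 < C &
  forall (disp disp' : measure_display) (S : measurableType disp) (T : measurableType disp')
    (P : probability S R) (mu : probability T R) (N k : nat) (X : 'I_N -> {RV P >-> T})
    (W : T -> 'rV[R]_k) (p : R) (A : set S),
  iid_sample mu X -> (forall a, measurable_fun setT (fun x => W x 0 a)) ->
  (0 < N)%N -> (0 < k)%N ->
  (forall v, (\int[mu]_x (dot (W x) v ^+ 2)%:E = (dot v v)%:E)%E) ->
  (forall v, (\int[mu]_x (`|dot (W x) v| `^ (4 + eps))%:E <=
     ((kappa * Num.sqrt (dot v v)) `^ (4 + eps))%:E)%E) ->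
  measurable A -> (p%:E <= P A)%E ->
  (forall w i, A w -> dot (W (X i w)) (W (X i w)) <= delta * k%:R) ->
  (exists2 A1 : set S, measurable A1 /\ ((p - c / N%:R `^ eps)%:E <= P A1)%E &
     forall w v, A1 w -> \sum_i dot (W (X i w)) v ^+ 2 <= C * (maxn k N)%:R * dot v v) /\
  (k%:R <= c3 * N%:R ->
   exists2 A2 : set S, measurable A2 /\ ((p - c / N%:R `^ eps)%:E <= P A2)%E &
     forall w v, A2 w ->
       N%:R / 4 * dot v v <= \sum_i dot (W (X i w)) v ^+ 2 <= C * (maxn k N)%:R * dot v v)].
Proof.
have kappa_gt0 : 0 < kappa by exact: lt_le_trans ltr01 kappa_ge1.
have [c1 c10 H1] := union_sum_le kappa_ge1 eps_gt0.
have a20 : 0 < (16 * kappa ^+ 4)^-1 by rewrite invr_gt0 mulr_gt0 // exprn_gt0.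
have a30 : 0 < (8 * delta)^-1 by rewrite invr_gt0 mulr_gt0.
have [c2 c20 H2] := expRN_le_powR eps_gt0 a20.
have [c4 c40 H4] := expRN_le_powR eps_gt0 a30.
have lc : 0 < level_const kappa.
  have := @level_threshold_gt0 R kappa eps 1 1 kappa_gt0 isT isT.
  by rewrite /level_threshold divr1 powR1 mulr1.
have le : 0 < level_exponent eps <= 1 / 4.
  have := eps_gt0; rewrite /level_exponent => e0; apply/andP; split.
    by rewrite divr_gt0 //; lra.
  by rewrite ler_pdivrMr; lra.
have [C C0 HC] := few_large_products_bound (ltW delta_gt0) lc le.
exists (c1 + c2 + c4), C; split => //; first by lra.
move=> disp disp' S T P mu N k X W p A iidX mW N0 k0 iso mom mA pA diagA.
have NR : 0 < N%:R :> R by rewrite ltr0n.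
have Ne : 0 < N%:R `^ eps :> R by rewrite powR_gt0.
pose n := maxn k N.
have nN : (N <= n)%N by rewrite leq_maxr.
have nk : (k <= n)%N by rewrite leq_maxl.
have n0 : (0 < n)%N by exact: leq_trans N0 nN.
have dot_pos (v : 'rV[R]_k) : dot v v != 0 -> 0 < Num.sqrt (dot v v).
  by move=> v0; rewrite sqrtr_gt0 lt0r v0 dot_ge0.
have mdot v : measurable_fun setT (fun x => dot (W x) v) by exact: measurable_dot.
have tailW (t : R) (u : 'rV[R]_k) : 0 < t ->
  (mu [set x | (t * Num.sqrt (dot u u) < `|dot (W x) u|)%R] <= ((kappa / t) `^ (4 + eps))%:E)%E.
  move=> t0; have [u0|/dot_pos u0] := eqVneq (dot u u) 0; last first.
    exact: tail_of_moment.
  rewrite (_ : [set x | _] = set0) ?measure0 ?lee_fin ?powR_ge0 //.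
  apply/seteqP; split => // x /=; rewrite u0 sqrtr0 mulr0 (dot_eq0 u0) dotC dot0l.
  by rewrite normr0 ltxx.
have fourthW v : (\int[mu]_x (dot (W x) v ^+ 4)%:E <= (kappa ^+ 4 * dot v v ^+ 2)%:E)%E.
  have [v0|v0] := eqVneq (dot v v) 0.
    rewrite (eq_integral (fun=> 0%E)); last first.
      by move=> x _; rewrite (dot_eq0 v0) dotC dot0l expr0n.
    by rewrite integral0 v0 expr0n mulr0.
  have := fourth_moment kappa_gt0 eps_gt0 (mdot v) (dot_pos _ v0) (mom v).
  by rewrite exprMn (exprM (Num.sqrt _) 2 2) sqr_sqrtr ?dot_ge0.
pose bad := bad_event X W kappa eps n.
have mbad : measurable bad by exact: measurable_bad_event.
have Pbad : (P bad <= (c1 / N%:R `^ eps)%:E)%E.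
  apply: le_trans (prob_bad_event iidX mW kappa_ge1 n0 tailW) _.
  rewrite lee_fin; apply: le_trans (H1 n N n0 nN) _.
  apply: ler_wpM2l; first exact: ltW.
  rewrite lef_pV2 ?posrE ?powR_gt0 ?ltr0n //.
  by apply: ge0_ler_powR; rewrite ?nnegrE ?ler_nat // ltW.
have [mA1 pA1] := with_prob_ge_setD mA mbad pA Pbad.
have c1le : c1 / N%:R `^ eps <= (c1 + c2 + c4) / N%:R `^ eps.
  by rewrite ler_wpM2r ?invr_ge0 ?(ltW Ne) //; lra.
have upper w v : (A `\` bad) w -> \sum_i dot (W (X i w)) v ^+ 2 <= C * n%:R * dot v v.
  move=> [Aw nbw].
  have rowY i : dot (row i (sample_mx X W w)) (row i (sample_mx X W w)) <= delta * n%:R.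
    rewrite row_sample_mx; apply: le_trans (diagA w i Aw) _.
    by rewrite ler_wpM2l ?ler_nat // ltW.
  have hB := HC N k n (sample_mx X W w) n0 nN rowY (few_large_off_bad_event nbw).
  have Cn : 0 < C * n%:R by rewrite mulr_gt0 // ltr0n.
  have := dual_bound Cn hB v.
  by under eq_bigr do rewrite row_sample_mx.
split.
  exists (A `\` bad) => //; split => //; apply: le_trans pA1.
  by rewrite lee_fin lerB.
move=> kN.
pose low := low_event X W.
have mlow : measurable low by exact: measurable_low_event.
have Plow : (P low <= (c2 / N%:R `^ eps)%:E)%E.
  by apply: le_trans (prob_low_event iidX mW kappa_ge1 iso fourthW c3_le kN) _; rewrite lee_fin H2.
pose tr := trace_event X W delta.
have mtr : measurable tr by exact: measurable_trace_event.
have Ptr : (P tr <= (c4 / N%:R `^ eps)%:E)%E.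
  by apply: le_trans (prob_trace_event iidX mW iso k0 delta_gt0) _; rewrite lee_fin H4.
have [mA2 pA2] := with_prob_ge_setD mA1 mlow pA1 Plow.
have [mA3 pA3] := with_prob_ge_setD mA2 mtr pA2 Ptr.
exists (((A `\` bad) `\` low) `\` tr).
  split => //; apply: le_trans pA3; rewrite lee_fin.
  by rewrite !mulrDl; lra.
move=> w v [[Abw nlw] ntr]; rewrite (upper w v Abw) andbT.
have rE := row_sample_mx X W ^~ w.
have -> : \sum_i dot (W (X i w)) v ^+ 2 = \sum_i dot (row i (sample_mx X W w)) v ^+ 2.
  by apply: eq_bigr => i _; rewrite rE.
apply: lattice_lower_bound => //.
  move=> z zm; under eq_bigr do rewrite rE.
  exact: lattice_off_low_event nlw z zm.
under eq_bigr do rewrite rE.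
have kR : 0 < k%:R :> R by rewrite ltr0n.
move: ntr; rewrite /tr /trace_event /= => /negP; rewrite -ltNge => /ltW.
rewrite (eq_bigr (fun i => dot (W (X i w)) (W (X i w)) / k%:R)).
  by rewrite -mulr_suml ler_pdivrMr // => h; rewrite [leRHS]mulrAC.
by move=> i _; rewrite /trunc_norm2 diagA //; case: Abw.
Qed.

End isotropic.

(** * Reproducing kernel Hilbert space *)

Section rkhs_algebra.
Variables (R : realType) (T : Type) (K : T -> T -> R) (H : set (T -> R)).
Variable ip : (T -> R) -> (T -> R) -> R.
Hypothesis rk : is_rkhs K H ip.

Let H0 : H 0 := rkhs0 rk.

Lemma rkhsZ a f : H f -> H (a *: f).
Proof. by move=> Hf; rewrite -[_ *: _]addr0; exact: rkhs_linear rk a f 0 Hf H0. Qed.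

Lemma rkhsB f g : H f -> H g -> H (f - g).
Proof.
by move=> Hf Hg; rewrite addrC -scaleN1r; exact: rkhs_linear rk (-1) g f Hg Hf.
Qed.

Lemma rkhs_sum (I : Type) (s : seq I) (a : I -> R) (e : I -> T -> R) :
  (forall i, H (e i)) -> H (\sum_(i <- s) a i *: e i).
Proof.
move=> He; elim: s => [|i s IH]; first by rewrite big_nil.
by rewrite big_cons; exact: rkhs_linear rk _ _ _ (He i) IH.
Qed.

Lemma ip0l h : H h -> ip 0 h = 0.
Proof.
move=> Hh; have := rkhs_ip_linear rk 1 H0 H0 Hh.
by rewrite scaler0 addr0 mul1r => /eqP; rewrite -subr_eq0 opprD addNKr oppr_eq0 => /eqP.
Qed.

Lemma ipZl a f h : H f -> H h -> ip (a *: f) h = a * ip f h.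
Proof.
by move=> Hf Hh; have := rkhs_ip_linear rk a Hf H0 Hh; rewrite addr0 ip0l // addr0.
Qed.

Lemma ipBl f g h : H f -> H g -> H h -> ip (f - g) h = ip f h - ip g h.
Proof.
move=> Hf Hg Hh; have := rkhs_ip_linear rk (-1) Hg Hf Hh.
by rewrite scaleN1r addrC mulN1r [RHS]addrC.
Qed.

Lemma ip_suml (I : Type) (s : seq I) (a : I -> R) (e : I -> T -> R) h :
  (forall i, H (e i)) -> H h ->
  ip (\sum_(i <- s) a i *: e i) h = \sum_(i <- s) a i * ip (e i) h.
Proof.
move=> He Hh; elim: s => [|i s IH]; first by rewrite !big_nil ip0l.
by rewrite !big_cons (rkhs_ip_linear rk) ?IH //; exact: rkhs_sum.
Qed.

Lemma ip_ge0 f : H f -> 0 <= ip f f.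
Proof.
by move=> Hf; have [->|f0] := pselect (f = 0); [rewrite ip0l|exact/ltW/(rkhs_ip_gt0 rk)].
Qed.

Lemma ip_unit_le e g : H e -> H g -> ip e e = 1 -> ip e g ^+ 2 <= ip g g.
Proof.
move=> He Hg e1; pose c := ip e g.
have Hc := rkhsZ c He.
have := ip_ge0 (rkhsB Hg Hc).
have E f : H f -> ip (g - c *: e) f = ip g f - c * ip e f.
  by move=> Hf; rewrite ipBl // ipZl.
rewrite E; last exact: rkhsB.
rewrite (rkhs_ipC rk Hg (rkhsB Hg Hc)) (rkhs_ipC rk He (rkhsB Hg Hc)) !E //.
by rewrite (rkhs_ipC rk Hg He) e1 -/c; nra.
Qed.

Variables (k : nat) (e : nat -> T -> R).
Hypothesis He : forall j : 'I_k, H (e j).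
Hypothesis ortho : forall i j : 'I_k, ip (e i) (e j) = (i == j)%:R.

Lemma ip_span_basis (a : 'I_k -> R) (i : 'I_k) : ip (\sum_j a j *: e j) (e i) = a i.
Proof.
rewrite (ip_suml _ _ (e := fun j : 'I_k => e j)) // (bigD1 i) //= ortho eqxx mulr1.
by rewrite big1 ?addr0 // => j /negbTE ji; rewrite ortho ji mulr0.
Qed.

Lemma rkhs_span (a : 'I_k -> R) : H (\sum_j a j *: e j).
Proof. exact: (rkhs_sum _ _ (e := fun j : 'I_k => e j)). Qed.

Lemma ip_span_span (a b : 'I_k -> R) :
  ip (\sum_j a j *: e j) (\sum_j b j *: e j) = \sum_j a j * b j.
Proof.
rewrite (ip_suml _ _ (e := fun j : 'I_k => e j)) //; last exact: rkhs_span.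
by apply: eq_bigr => j _; rewrite (rkhs_ipC rk) ?ip_span_basis //; exact: rkhs_span.
Qed.

Lemma hnorm_span (a : 'I_k -> R) :
  hnorm ip (\sum_j a j *: e j) = Num.sqrt (\sum_j a j ^+ 2).
Proof. by rewrite /hnorm ip_span_span; congr Num.sqrt; apply: eq_bigr => j _; rewrite expr2. Qed.

Lemma ip_basis_eval (j : 'I_k) x : ip (e j) (K x) = e j x.
Proof. exact: (rkhs_reproducing rk x (He j)). Qed.

(** [orth_proj] is a choice, so both existence and uniqueness of the projection are needed;
    uniqueness follows by testing orthogonality against each [e j]. *)
Lemma feature_uptoE x : feature_upto K ip e k x = \sum_(j < k) e j x *: e j.
Proof.
pose p := \sum_(j < k) e j x *: e j.
have Hp : H p by exact: rkhs_span.
have HK := rkhs_kernel rk x.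
apply: xget_unique.
  split; first by exists (fun j : 'I_k => e j x).
  move=> _ [b ->]; rewrite (rkhs_ipC rk); [|exact: rkhsB|exact: rkhs_span].
  rewrite (ip_suml _ _ (e := fun j : 'I_k => e j)) //; last exact: rkhsB.
  rewrite big1 // => j _; rewrite (rkhs_ipC rk) //; last exact: rkhsB.
  by rewrite ipBl // (rkhs_ipC rk) // ip_basis_eval ip_span_basis subrr mulr0.
move=> _ [[b ->] hb]; congr (\sum_(j < k) _); apply/funext => j; congr (_ *: _).
have := hb _ (ex_intro _ (fun i : 'I_k => (i == j)%:R) erefl).
rewrite (rkhs_ipC rk); [|by apply: rkhsB => //; exact: rkhs_span|exact: rkhs_span].
rewrite (ip_suml _ _ (e := fun j : 'I_k => e j)) //; last by apply: rkhsB => //; exact: rkhs_span.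
rewrite (bigD1 j) //= eqxx mul1r [X in _ + X]big1 ?addr0; last by move=> i /negbTE ->; rewrite mul0r.
rewrite (rkhs_ipC rk) //; last by apply: rkhsB => //; exact: rkhs_span.
rewrite ipBl //; last exact: rkhs_span.
by rewrite ip_span_basis (rkhs_ipC rk) // ip_basis_eval => /eqP; rewrite subr_eq0 eq_sym => /eqP.
Qed.

Variable s : nat -> R.

Lemma cov_invsqrt_span (a : 'I_k -> R) :
  cov_invsqrt ip s e k (\sum_j a j *: e j) = \sum_(j < k) ((Num.sqrt (s j))^-1 * a j) *: e j.
Proof.
apply: eq_bigr => j _; rewrite /tensor (rkhs_ipC rk) //; last exact: rkhs_span.
by rewrite ip_span_basis scalerA.
Qed.

Lemma cov_sqrt_span (a : 'I_k -> R) :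
  cov_sqrt ip s e k (\sum_j a j *: e j) = \sum_(j < k) (Num.sqrt (s j) * a j) *: e j.
Proof.
apply: eq_bigr => j _; rewrite /tensor (rkhs_ipC rk) //; last exact: rkhs_span.
by rewrite ip_span_basis scalerA.
Qed.

Definition whitened_row (x : T) : 'rV[R]_k := \row_j (e j x / Num.sqrt (s j)).

Lemma whitened_featureE x :
  whitened_feature K ip s e k x = \sum_(j < k) whitened_row x 0 j *: e j.
Proof.
rewrite /whitened_feature feature_uptoE cov_invsqrt_span; apply: eq_bigr => j _.
by rewrite mxE mulrC.
Qed.

Lemma hnorm_whitened x :
  hnorm ip (whitened_feature K ip s e k x) ^+ 2 = dot (whitened_row x) (whitened_row x).
Proof. by rewrite whitened_featureE hnorm_span -dot_sqr sqr_sqrtr // dot_ge0. Qed.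

Lemma whitened_mxE N (X : 'I_N -> T) i j :
  whitened_mx K ip s e k X i j = whitened_row (X i) 0 j.
Proof.
by rewrite mxE whitened_featureE (rkhs_ipC rk) ?ip_span_basis //; exact: rkhs_span.
Qed.

Hypothesis s_gt0 : forall j : 'I_k, 0 < s j.

(** Coordinates of Gamma^(1/2) f. In terms of them both sides of the claim become quantities of the
    isotropic sample: a norm, and products with the whitened rows. *)
Definition span_coord (a : 'I_k -> R) : 'rV[R]_k := \row_j (Num.sqrt (s j) * a j).

Lemma span_evalE (a : 'I_k -> R) x :
  (\sum_(j < k) a j *: e j) x = dot (whitened_row x) (span_coord a).
Proof.
rewrite fct_sumE; apply: eq_bigr => j _; rewrite !mxE.
have : Num.sqrt (s j) != 0 by rewrite gt_eqF // sqrtr_gt0.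
by move=> sj; rewrite -mulrA mulKf // mulrC.
Qed.

Lemma hnorm_cov_sqrt (a : 'I_k -> R) :
  hnorm ip (cov_sqrt ip s e k (\sum_j a j *: e j)) =
  Num.sqrt (dot (span_coord a) (span_coord a)).
Proof.
rewrite cov_sqrt_span hnorm_span dot_sqr; congr Num.sqrt.
by apply: eq_bigr => j _; rewrite mxE.
Qed.

Lemma norm2_sampling N (X : 'I_N -> T) (a : 'I_k -> R) :
  norm2 (sampling_op K ip e k X (\sum_j a j *: e j)) =
  Num.sqrt (\sum_i dot (whitened_row (X i)) (span_coord a) ^+ 2).
Proof.
congr Num.sqrt; apply: eq_bigr => i _; rewrite mxE -span_evalE feature_uptoE ip_span_span.
by congr (_ ^+ 2); rewrite fct_sumE; apply: eq_bigr => j _; rewrite mulrC.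
Qed.

End rkhs_algebra.

(** For a reproducing kernel the right-hand side is the squared distance of the features of x and y.
    This is how eigenfunctions are shown to be continuous, hence Borel measurable. *)
Lemma continuous_of_kernel_modulus (R : realType) (T : topologicalType) (K : T -> T -> R)
    (f : T -> R) :
  continuous (fun p : T * T => K p.1 p.2) ->
  (forall x y, (f y - f x) ^+ 2 <= K y y - K x y - (K y x - K x x)) ->
  continuous f.
Proof.
move=> cK fK x; have Kat (g h : T -> T) : {for x, continuous g} -> {for x, continuous h} ->
    {for x, continuous (fun y => K (g y) (h y))}.
  move=> cg ch; apply: (@continuous_comp _ _ _ (fun y => (g y, h y)) (fun p => K p.1 p.2)).
    exact: cvg_pair.
  exact: cK.
pose m y := K y y - K x y - (K y x - K x x).
have cm : m y @[y --> x] --> m x.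
  apply: cvgB; apply: cvgB.
  - exact: (Kat id id).
  - by apply: (Kat (fun=> x) id) => //; exact: cvg_cst.
  - by apply: (Kat id (fun=> x)) => //; exact: cvg_cst.
  - exact: cvg_cst.
have m0 : m x = 0 by rewrite /m; ring.
rewrite m0 in cm.
apply/cvgrPdist_lt => r r0; have /cvgrPdist_lt /(_ (r ^+ 2)) := cm.
rewrite exprn_gt0 // => /(_ isT); apply: filterS => y; rewrite sub0r normrN => my.
have := fK x y; rewrite -/(m y) => fm.
rewrite -(@ltr_pXn2r _ 2) ?nnegrE ?(ltW r0) // real_normK ?num_real // -sqrrN opprB.
by rewrite (le_lt_trans fm) // (le_lt_trans _ my) // ler_norm.
Qed.

Lemma continuous_measurable_subspace (R : realType) d (Om : set 'rV[R]_d) (x0 : Om)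
    (f : subspace_of x0 -> R) : continuous f -> measurable_fun setT f.
Proof.
move=> cf; apply: (measurability _ (RGenOInfty.measurableE R)) => //.
move=> _ [_ [a ->] <-]; rewrite setTI; apply: sub_sigma_algebra.
by move/continuousP : cf; apply; rewrite set_itvE; exact: open_gt.
Qed.

Section isotropy.
Variables (R : realType) (disp : measure_display) (T : measurableType disp).
Variables (mu : probability T R) (K : T -> T -> R) (H : set (T -> R)).
Variables (ip : (T -> R) -> (T -> R) -> R) (s : nat -> R) (e : nat -> T -> R).
Hypothesis K_le1 : forall x y, `|K x y| <= 1.
Hypothesis rk : is_rkhs K H ip.
Hypothesis es : is_eigensystem H ip (cov_op mu H ip K) s e.
Variable k : nat.
Hypothesis s_gt0 : forall j : 'I_k, 0 < s j.

Let He (j : 'I_k) : H (e j) := eigen_mem es (s_gt0 j).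

Lemma eigen_ortho (i j : 'I_k) : ip (e i) (e j) = (i == j)%:R.
Proof. exact: (eigen_orthonormal es). Qed.

Lemma eigenfun_modulus (j : 'I_k) x y :
  (e j y - e j x) ^+ 2 <= K y y - K x y - (K y x - K x x).
Proof.
have HK := rkhs_kernel rk; have ev f z : H f -> ip f (K z) = f z.
  by move=> Hf; rewrite (rkhs_reproducing rk).
have HD := rkhsB rk (HK y) (HK x).
have := ip_unit_le rk (He j) HD; rewrite eigen_ortho eqxx => /(_ erefl).
rewrite (rkhs_ipC rk) // !(ipBl rk) // ![ip (K _) (e j)](rkhs_ipC rk) // !ev //.
by rewrite ![ip (K _) (_ - _)](rkhs_ipC rk) // !(ipBl rk) // !ev // opprB; lra.
Qed.

Lemma eigenfun_bounded (j : 'I_k) x : `|e j x| <= 1.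
Proof.
have HK := rkhs_kernel rk.
have := ip_unit_le rk (He j) (HK x); rewrite eigen_ortho eqxx => /(_ erefl).
rewrite !(rkhs_reproducing rk) // => h.
rewrite -(@ler_pXn2r _ 2) ?nnegrE // real_normK ?num_real // expr1n.
by rewrite (le_trans h) // (le_trans (ler_norm _)).
Qed.

(* As [s j *: e j] is nonzero, it is not the default value of [hexpectation], so
   it is a genuine weak expectation. *)
Lemma eigen_weak (j : 'I_k) h : H h ->
  s j * ip (e j) h = (\int[mu]_x (e j x * h x))%R.
Proof.
move=> Hh; have se0 : s j *: e j <> 0.
  move=> E; have := eigen_ortho j j; rewrite eqxx => /eqP.
  have : ip (s j *: e j) (e j) = 0 by rewrite E (ip0l rk).
  by rewrite (ipZl rk) // => /eqP; rewrite mulf_eq0 gt_eqF //= => /eqP ->; rewrite eq_sym oner_eq0.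
have := eigen_eq es (s_gt0 j); rewrite /cov_op /hexpectation.
case: xgetP => [g -> [Hg hg] E|_ E]; last by case: se0.
rewrite -(ipZl rk) // -E hg //; apply: eq_Rintegral => x _.
rewrite /tensor (ipZl rk) //; last exact: (rkhs_kernel rk).
rewrite (rkhs_ipC rk) //; last exact: (rkhs_kernel rk).
by rewrite [ip (K x) h](rkhs_ipC rk) ?(rkhs_reproducing rk) //; exact: (rkhs_kernel rk).
Qed.

Hypothesis e_meas : forall j : 'I_k, measurable_fun setT (e j).

Lemma measurable_whitened_row (j : 'I_k) :
  measurable_fun setT (fun x => whitened_row k e s x 0 j).
Proof.
apply: (@eq_measurable_fun _ _ _ _ _ (fun x => e j x * (Num.sqrt (s j))^-1)).
  by move=> x _; rewrite mxE.
exact: measurable_funM.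
Qed.

Definition unwhiten (v : 'rV[R]_k) (j : 'I_k) : R := v 0 j / Num.sqrt (s j).

Lemma dot_whitened_row x (v : 'rV[R]_k) :
  dot (whitened_row k e s x) v = (\sum_j unwhiten v j *: e j) x.
Proof.
rewrite (span_evalE _ s_gt0); congr dot; apply/rowP => j; rewrite !mxE mulrC divfK //.
by rewrite gt_eqF // sqrtr_gt0.
Qed.

Lemma integrable_eigenfun_mul (j : 'I_k) (v : 'rV[R]_k) :
  mu.-integrable setT (fun x => (e j x * dot (whitened_row k e s x) v)%:E).
Proof.
apply: measurable_bounded_integrable => //.
- by rewrite (le_lt_trans (probability_le1 mu _)) // ltry.
- apply: measurable_funM => //; apply: measurable_dot => a; last exact: measurable_cst.
  exact: measurable_whitened_row.
exists (\sum_j `|unwhiten v j|); split; first exact: num_real.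
move=> M ltM x _; rewrite /= (le_trans _ (ltW ltM)) // dot_whitened_row normrM.
rewrite -[leRHS]mul1r ler_pM ?eigenfun_bounded // fct_sumE (le_trans (ler_norm_sum _ _ _)) //.
apply: ler_sum => i _; rewrite normrM -[leRHS]mulr1 ler_wpM2l //.
exact: eigenfun_bounded.
Qed.

(** Expand one factor of the square in the eigenfunctions and apply [eigen_weak] to the other: the
    eigenvalue cancels the two square roots and leaves v_j^2. The terms have no sign, so the sum is
    split by integrability, which comes from the boundedness of the eigenfunctions. *)
Lemma whitened_row_isotropic (v : 'rV[R]_k) :
  (\int[mu]_x (dot (whitened_row k e s x) v ^+ 2)%:E = (dot v v)%:E)%E.
Proof.
pose f := \sum_j unwhiten v j *: e j.
have Hf : H f by exact: (rkhs_span rk He).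
transitivity (\int[mu]_x \sum_(j < k)
    ((unwhiten v j)%:E * (e j x * dot (whitened_row k e s x) v)%:E))%E.
  apply: eq_integral => x _; rewrite sumEFin; congr EFin.
  rewrite expr2 {1}dot_whitened_row fct_sumE mulr_suml.
  by apply: eq_bigr => j _; rewrite mulrA.
rewrite integral_sum //; last first.
  by move=> j; apply: integrableZl => //; exact: integrable_eigenfun_mul.
rewrite -sumEFin; apply: eq_bigr => j _.
have mf := integrable_eigenfun_mul j v.
rewrite integralZl // -[X in (_ * X)%E]fineK ?integrable_fin_num // -EFinM.
congr EFin; have := eigen_weak j Hf.
have -> : (\int[mu]_x (e j x * f x))%R = fine (\int[mu]_x (e j x * dot (whitened_row k e s x) v)%:E)%E.
  by congr fine; apply: eq_integral => x _; rewrite dot_whitened_row.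
move=> <-; rewrite (rkhs_ipC rk) // (ip_span_basis rk He eigen_ortho).
have sj := s_gt0 j; rewrite /unwhiten.
by rewrite -[X in X * (_ / _)]sqr_sqrtr ?ltW //; field; rewrite gt_eqF // sqrtr_gt0.
Qed.

Lemma whitened_row_moment (q kappa : R) (v : 'rV[R]_k) : 1 < q -> 0 <= kappa ->
  (forall f, span_upto e k f ->
     ('N[mu]_(q%:E)[EFin \o f] <= kappa%:E * 'N[mu]_(2%:E)[EFin \o f])%E) ->
  (\int[mu]_x (`|dot (whitened_row k e s x) v| `^ q)%:E <=
     ((kappa * Num.sqrt (dot v v)) `^ q)%:E)%E.
Proof.
move=> q1 kap0 hN; have q0 : 0 < q by rewrite (lt_trans _ q1).
have /hN := ex_intro _ (unwhiten v) erefl : span_upto e k (\sum_j unwhiten v j *: e j).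
set f := \sum_j _; have fE : f = fun x => dot (whitened_row k e s x) v.
  by apply/funext => x; rewrite dot_whitened_row.
have N2 : ('N[mu]_2%:E[EFin \o f] = (Num.sqrt (dot v v))%:E)%E.
  have -> : ('N[mu]_2%:E[EFin \o f] = ('N[mu]_2%:E[EFin \o f] `^ 2) `^ 2^-1)%E.
    by rewrite -poweRrM mulfV // poweRe1 // Lnorm_ge0.
  rewrite poweR_Lnorm //.
  have -> : (\int[mu]_x `|(EFin \o f) x| `^ 2 = (dot v v)%:E)%E.
    rewrite -whitened_row_isotropic; apply: eq_integral => x _.
    by rewrite fE /= powR_mulrn // real_normK ?num_real.
  by rewrite poweR_EFin powR12_sqrt // dot_ge0.
rewrite N2 => h.
have -> : (\int[mu]_x (`|dot (whitened_row k e s x) v| `^ q)%:E = 'N[mu]_q%:E[EFin \o f] `^ q)%E.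
  by rewrite poweR_Lnorm ?gt_eqF //; apply: eq_integral => x _; rewrite fE.
rewrite -poweR_EFin; apply: gt0_ler_poweR; rewrite ?(ltW q0) // in_itv /= leey andbT //.
  exact: Lnorm_ge0.
by rewrite lee_fin mulr_ge0 // sqrtr_ge0.
Qed.

End isotropy.

(** * From isotropic samples to the theorem *)

Lemma dot_mx (R : realType) k (u v : 'rV[R]_k) : dot u v = (u *m v^T) 0 0.
Proof. by rewrite mxE; apply: eq_bigr => j _; rewrite mxE. Qed.

Lemma dot_mulmx_tr (R : realType) N k (M : 'M[R]_(N, k)) (v : 'rV[R]_k) :
  dot (v *m M^T) (v *m M^T) = \sum_i dot (row i M) v ^+ 2.
Proof.
rewrite dot_sqr; apply: eq_bigr => i _; rewrite mxE; congr (_ ^+ 2).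
by apply: eq_bigr => j _; rewrite !mxE mulrC.
Qed.

Lemma max_singular_value_le (R : realType) N k (M : 'M[R]_(N, k)) (B : R) :
  0 <= B -> (forall v : 'rV[R]_k, \sum_i dot (row i M) v ^+ 2 <= B ^+ 2 * dot v v) ->
  max_singular_value M <= B.
Proof.
move=> B0 hB; rewrite /max_singular_value.
set E := [set t | _]; have ubE : ubound E B.
  move=> t [t0 /eigenvalueP [v /= vM v0]].
  have vv : 0 < dot v v.
    rewrite lt_def dot_ge0 andbT; apply/eqP => /dot_eq0; exact/eqP.
  rewrite -(@ler_pXn2r _ 2) ?nnegrE // -(ler_pM2r vv) (le_trans _ (hB v)) //.
  by rewrite -dot_mulmx_tr [leRHS]dot_mx trmx_mul trmxK mulmxA -[v *m _ *m _]mulmxA vM -scalemxAl mxE -dot_mx.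
(* The supremum of the empty set is 0, so no eigenvalue has to be exhibited. *)
have [E0|/set0P nE] := eqVneq E set0; first by rewrite E0 sup0.
exact: ge_sup.
Qed.

Lemma maxn_le_sqrtD_sqr (R : realType) (k N : nat) :
  (maxn k N)%:R <= (Num.sqrt k%:R + Num.sqrt N%:R) ^+ 2 :> R.
Proof.
have k0 := sqrtr_ge0 (k%:R : R); have N0 := sqrtr_ge0 (N%:R : R).
have kk := sqr_sqrtr (ler0n R k); have NN := sqr_sqrtr (ler0n R N).
rewrite sqrrD kk NN; case: leqP => _; rewrite -addrA ?lerDl ?addr_ge0 ?mulrn_wge0 ?mulr_ge0 //.
by rewrite addrA lerDr addr_ge0 ?mulrn_wge0 ?mulr_ge0.
Qed.

Theorem proposition2 (R : realType) (kappa c3 gamma3 eps delta3 : R)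
  (hkappa : 1 <= kappa)
  (hc3 : 0 < c3) (hc3' : c3 <= 9 / (1568 * kappa ^+ 4))
  (hgamma3 : 0 <= gamma3) (hgamma3' : gamma3 < 1 / 16)
  (heps : 0 < eps) (hdelta3 : 0 <= delta3) :
  exists c c_l C_u C_DMU : R,
    [/\ 0 < c, 0 < c_l, 0 < C_u & 0 < C_DMU] /\
    c_l = 1 / 2 /\
    C_u = Num.sqrt (2 * C_DMU ^+ 2 * (1 + c3)) /\
    forall (d : nat) (Om : set 'rV[R]_d) (x0 : Om)
      (mu : probability (subspace_of x0) R)
      (K : subspace_of x0 -> subspace_of x0 -> R)
      (H : set (subspace_of x0 -> R))
      (ip : (subspace_of x0 -> R) -> (subspace_of x0 -> R) -> R)
      (sigma : nat -> R) (e : nat -> subspace_of x0 -> R)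
      (disp : measure_display) (S : measurableType disp) (P : probability S R)
      (N k : nat) (X : 'I_N -> {RV P >-> subspace_of x0}),
    compact Om ->
    continuous (fun p : subspace_of x0 * subspace_of x0 => K p.1 p.2) ->
    posdef_kernel K ->
    (forall x y, `|K x y| <= 1) ->
    is_rkhs K H ip ->
    is_eigensystem H ip (cov_op mu H ip K) sigma e ->
    iid_sample mu X ->
    (0 < N)%N -> (0 < k)%N -> 0 < sigma k.-1 ->
    with_prob_ge P (1 - gamma3)
      [set w | \big[Num.max/0]_(i < N)
                 hnorm ip (whitened_feature K ip sigma e k (X i w)) ^+ 2
               <= delta3 * k%:R] ->
    (forall f, span_upto e k f ->
       ('N[mu]_((4 + eps)%:E)[EFin \o f] <=
        kappa%:E * 'N[mu]_(2%:E)[EFin \o f])%E) ->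
    with_prob_ge P (1 - gamma3 - c / N%:R `^ eps)
      [set w | max_singular_value
                 (whitened_mx K ip sigma e k (fun i => X i w))
               <= C_DMU * (Num.sqrt k%:R + Num.sqrt N%:R)] /\
    (k%:R <= c3 * N%:R ->
     with_prob_ge P (1 - gamma3 - c / N%:R `^ eps - 2 * expR (- k%:R))
       [set w | forall f, span_upto e k f ->
          c_l * hnorm ip (cov_sqrt ip sigma e k f)
            <= (Num.sqrt N%:R)^-1 *
               norm2 (sampling_op K ip e k (fun i => X i w) f)
            <= C_u * hnorm ip (cov_sqrt ip sigma e k f)]).
Proof.
(* [delta3] may be 0, whereas the Chernoff bound for the trace divides by its parameter. *)
have d0 : 0 < delta3 + 1 by rewrite ltr_wpDl.
have [c [C [c0 C0 main]]] := isotropic_sample_bounds hkappa heps d0 hc3'.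
(* [C_DMU] is the square root of [C], because max(k, N) is at most the square of sqrt k + sqrt N. *)
exists c, (1 / 2), (Num.sqrt (2 * Num.sqrt C ^+ 2 * (1 + c3))), (Num.sqrt C).
have CC : Num.sqrt C ^+ 2 = C by rewrite sqr_sqrtr // ltW.
have C30 : 0 < 2 * C * (1 + c3) by rewrite !mulr_gt0 // addr_gt0.
split; first by rewrite CC !sqrtr_gt0.
split=> //; split=> //.
move=> d Om x0 mu K H ip s e disp S P N k X _ cK _ K1 rk es iid N0 k0 sk [A [mA AE pA]] hN.
have s0 (j : 'I_k) : 0 < s j.
  by rewrite (lt_le_trans sk) // (eigen_noninc es) // -ltnS prednK.
have He (j : 'I_k) : H (e j) := eigen_mem es (s0 j).
have ortho := eigen_ortho es s0.
have me (j : 'I_k) : measurable_fun setT (e j).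
  apply: continuous_measurable_subspace; apply: continuous_of_kernel_modulus cK _.
  exact: (eigenfun_modulus rk es s0).
have q1 : 1 < 4 + eps by rewrite ltr_wpDr ?(ltW heps) // ltr1n.
have [|A1 A2] := main _ _ _ _ P mu N k X (whitened_row k e s) (1 - gamma3) A iid
  (measurable_whitened_row _ me) N0 k0 (whitened_row_isotropic K1 rk es s0 me)
  (fun v => whitened_row_moment K1 rk es s0 me v q1 (le_trans ler01 hkappa) hN) mA pA.
  move=> w i /AE /=; rewrite -(hnorm_whitened rk He ortho) => h.
  rewrite (le_trans _ (_ : delta3 * k%:R <= _)) ?ler_wpM2r ?lerDl //.
  exact: (le_trans (le_bigmax _ _ _) h).
split=> [|kN].
  have [E [mE pE] hE] := A1; exists E; split=> // w Ew /=.
  apply: max_singular_value_le => [|v].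
    by rewrite mulr_ge0 ?addr_ge0 ?sqrtr_ge0.
  rewrite exprMn CC (le_trans _ (_ : C * (maxn k N)%:R * dot v v <= _)) //; last first.
    by rewrite ler_wpM2r ?dot_ge0 // ler_wpM2l ?(ltW C0) // maxn_le_sqrtD_sqr.
  rewrite (le_trans _ (hE w v Ew)) // le_eqVlt; apply/orP; left; apply/eqP.
  apply: eq_bigr => i _; congr (dot _ _ ^+ 2); apply/rowP => j.
  by rewrite mxE (whitened_mxE rk He ortho).
have [E [mE pE] hE] := A2 kN; exists E; split=> //; last first.
  (* The failure of the lower bound is already charged to c / N^eps, so the exponential term only
     weakens the estimate. *)
  by rewrite (le_trans _ pE) // lee_fin gerBl mulr_ge0 // expR_ge0.
move=> w Ew _ [a ->].
have N0R : 0 < N%:R :> R by rewrite ltr0n.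
rewrite (hnorm_cov_sqrt rk He ortho) (norm2_sampling rk He ortho s0).
have /andP[] := hE w (span_coord s a) Ew; set D := dot _ _; set Q := \sum_i _ => lo up.
have D0 : 0 <= D by rewrite dot_ge0.
rewrite CC -sqrtrV ?(ltW N0R) // -!sqrtrM ?(ltW C30) ?invr_ge0 ?(ltW N0R) //.
apply/andP; split.
  have -> : 1 / 2 = Num.sqrt (1 / 4) :> R.
    by rewrite -[LHS]ger0_norm ?divr_ge0 // -sqrtr_sqr; congr Num.sqrt; field.
  rewrite -sqrtrM // ler_wsqrtr // [leRHS]mulrC ler_pdivlMr //.
  by move: lo; congr (_ <= _); field.
rewrite ler_wsqrtr // [leLHS]mulrC ler_pdivrMr // (le_trans up) //.
(* The factor 2 (1 + c3) is the one from (sqrt k + sqrt N)^2 <= 2 (k + N); for the maximum it holds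
   with room. *)
have kmax : (maxn k N)%:R <= 2 * (1 + c3) * N%:R :> R.
  have : 0 <= c3 * N%:R by rewrite mulr_ge0 ?ltW.
  by case: leqP => _; move: kN N0R; lra.
rewrite [leRHS](_ : _ = C * (2 * (1 + c3) * N%:R) * D); last by ring.
by rewrite ler_wpM2r // ler_wpM2l // ltW.
Qed.
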